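(* $\mathrm{PT_P}=\mathrm{P}$; that is, a decision problem $L$ can be made pseudo-tractable if and only if $L\in\mathrm{P}$.
   Context: A random-access Turing machine (RATM) is a Turing machine with $k\ge 2$ ordinary tapes (a read-only input tape, an output tape and work tapes), each equipped with its own write-only binary index tape; when it enters a special random-access state $q_a$, the heads of all ordinary tapes jump (in that step) to the cells whose addresses are written in binary on the respective index tapes. Running time is the number of steps. For a language $S$ of pairs $\langle D,Q\rangle$: $S$ is pseudo-tractable by reducing (resp. extending) datasets if there exist a polynomial-time computable preprocessing function $\Pi$ and a language $S'$ such that for all $D,Q$: $\langle D,Q\rangle\in S\iff\langle\Pi(D),Q\rangle\in S'$, $|\Pi(D)|<|D|$ (resp. $|\Pi(D)|\ge|D|$), and membership of $\langle\Pi(D),Q\rangle$ in $S'$ can be decided by a RATM in time $o(|D|)$. $\mathrm{PTR^0_Q}$ (resp. $\mathrm{PTE^0_Q}$) is the class of such languages (query classes), and $\mathrm{PT^0_Q}=\mathrm{PTR^0_Q}\cup\mathrm{PTE^0_Q}$. A factorization of a language $L$ is a triple $\Upsilon=(\pi_1,\pi_2,\rho)$ of $\mathrm{NC}$-computable functions with $\rho(\pi_1(x),\pi_2(x))=x$ for all $x\in L$; the associated language of pairs is $S_{(L,\Upsilon)}=\{\langle\pi_1(x),\pi_2(x)\rangle: x\in L\}$. A decision problem $L$ can be made pseudo-tractable if there exists a factorization $\Upsilon$ of $L$ with $S_{(L,\Upsilon)}\in\mathrm{PT^0_Q}$. $\mathrm{PT_P}$ is the set of all decision problems that can be made pseudo-tractable.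 *)

(* Defs.v *)
(* MathComp world, with the classical sets of MathComp-Analysis. *)
From mathcomp Require Import all_boot all_order all_algebra.
From mathcomp Require Import boolp classical_sets.

Set Implicit Arguments.
Unset Strict Implicit.
Unset Printing Implicit Defensive.

Definition word := seq bool.
Definition language := set word.

(* <D, Q> is D#Q written in binary with 0 -> 00, 1 -> 11, # -> 01. *)
Definition double (w : word) : word := flatten [seq [:: b; b] | b <- w].
Definition pair_code (D Q : word) : word :=
  double D ++ [:: false; true] ++ double Q.

(* Tapes are infinite in both directions.  Cell p >= 0 is entry p of [nneg],
   cell -(p+1) is entry p of [neg]; entries past the end are blank ([None]). *)

Inductive move := MoveL | MoveS | MoveR.

Definition shift (m : move) : int :=
  match m with MoveL => (-1)%R | MoveS => 0%R | MoveR => 1%R end.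

Record tape (S : Type) := Tape {
  head : int;
  neg : seq (option S);
  nneg : seq (option S) }.

Definition read S (t : tape S) : option S :=
  match head t with
  | Posz p => nth None (nneg t) p
  | Negz p => nth None (neg t) p
  end.

Definition write S (a : option S) (t : tape S) : tape S :=
  match head t with
  | Posz p => Tape (head t) (neg t) (set_nth None (nneg t) p a)
  | Negz p => Tape (head t) (set_nth None (neg t) p a) (nneg t)
  end.

Definition move_head S (m : move) (t : tape S) : tape S :=
  Tape (head t + shift m)%R (neg t) (nneg t).

Definition jump S (p : nat) (t : tape S) : tape S :=
  Tape (Posz p) (neg t) (nneg t).

Definition tape_of S (w : seq S) : tape S := Tape 0%R [::] (map Some w).

Fixpoint nonblank_prefix S (s : seq (option S)) : seq S :=
  if s is Some a :: s' then a :: nonblank_prefix s' else [::].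

(* The word on a tape: cells 0, 1, ... up to the first blank. *)
Definition contents S (t : tape S) : seq S := nonblank_prefix (nneg t).

(* Deterministic Turing machines with nwork.+2 tapes: tape 0 is the input tape,
   tape 1 the output tape.  The tape alphabet consists of the blank, the two
   bits and the symbols of [aux].  [verdict q] is [None] iff q is not halting;
   [Some true] accepts and [Some false] rejects. *)
Record tm := TM {
  nwork : nat;
  aux : finType;
  state : finType;
  start : state;
  verdict : state -> option bool;
  delta : state -> {ffun 'I_nwork.+2 -> option (bool + aux)} ->
          state * {ffun 'I_nwork.+2 -> option (bool + aux) * move} }.

Definition in_tape (n : nat) : 'I_n.+2 := ord0.
Definition out_tape (n : nat) : 'I_n.+2 := lift ord0 ord0.

Definition config (M : tm) : Type :=
  (state M * {ffun 'I_(nwork M).+2 -> tape (bool + aux M)})%type.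

Definition scan (M : tm) (c : config M) :
    {ffun 'I_(nwork M).+2 -> option (bool + aux M)} :=
  [ffun i => read (c.2 i)].

Definition next (M : tm) (c : config M) : config M :=
  let: (q, act) := delta c.1 (scan c) in
  (q, [ffun i => move_head (act i).2
        (if i == in_tape (nwork M) then c.2 i else write (act i).1 (c.2 i))]).

Definition halted (M : tm) (c : config M) : bool := isSome (verdict c.1).

Definition step (M : tm) (c : config M) : config M :=
  if halted c then c else next c.

Definition init (M : tm) (x : word) : config M :=
  (start M, [ffun i => tape_of
     (if i == in_tape (nwork M) then [seq inl b | b <- x] else [::])]).

Definition run (M : tm) (x : word) (t : nat) : config M :=
  iter t (@step M) (init M x).

Definition output (M : tm) (c : config M) (w : word) : Prop :=
  contents (c.2 (out_tape (nwork M))) = [seq inl b | b <- w].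

Definition poly (c n : nat) : nat := n ^ c + c.
Definition polylog (c n : nat) : nat := c * trunc_log 2 n ^ c + c.

Definition PTIME : set language :=
  [set L | exists (M : tm) (c : nat), forall x,
    exists2 b : bool, verdict (run M x (poly c (size x))).1 = Some b & (b <-> L x)].

Definition polytime_fun (f : word -> word) : Prop :=
  exists (M : tm) (c : nat), forall x,
    halted (run M x (poly c (size x))) /\
    output (run M x (poly c (size x))) (f x).

(* A random-access machine extends an ordinary one: each ordinary tape has an
   index tape, on which [index_delta] writes (possibly a blank, to erase) and
   moves; neither transition function sees the contents of the index tapes. *)
Record ratm := RATM {
  base :> tm;
  access : state base;
  index_delta : state base ->
    {ffun 'I_(nwork base).+2 -> option (bool + aux base)} ->
    {ffun 'I_(nwork base).+2 -> option bool * move} }.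

Definition rconfig (M : ratm) : Type :=
  (config M * {ffun 'I_(nwork M).+2 -> tape bool})%type.

(* Most significant bit first; the empty word has value 0. *)
Definition binary_value (w : word) : nat :=
  foldl (fun v (b : bool) => v.*2 + b) 0 w.

Definition rnext (M : ratm) (c : rconfig M) : rconfig M :=
  let act := index_delta c.1.1 (scan c.1) in
  let ix := [ffun i => move_head (act i).2 (write (act i).1 (c.2 i))] in
  let: (q, ts) := next c.1 in
  (q, if q == access M
      then [ffun i => jump (binary_value (contents (ix i))) (ts i)]
      else ts, ix).

Definition rstep (M : ratm) (c : rconfig M) : rconfig M :=
  if halted c.1 then c else rnext c.

Definition rrun (M : ratm) (x : word) (t : nat) : rconfig M :=
  iter t (@rstep M) (init M x, [ffun => tape_of [::]]).

(* Boolean circuits as straight-line programs of fan-in at most 2.  [GNot j],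
   [GAnd j k], [GOr j k] refer to earlier gates by position; references out of
   range read [false]. *)
Inductive gate :=
  | GInput of nat
  | GConst of bool
  | GNot of nat
  | GAnd of nat & nat
  | GOr of nat & nat.

Record circuit := Circuit { gates : seq gate; outputs : seq nat }.

Definition gate_value (x : word) (v : seq bool) (g : gate) : bool :=
  match g with
  | GInput i => nth false x i
  | GConst b => b
  | GNot j => ~~ nth false v j
  | GAnd j k => nth false v j && nth false v k
  | GOr j k => nth false v j || nth false v k
  end.

Definition gate_depth (d : seq nat) (g : gate) : nat :=
  match g with
  | GInput _ | GConst _ => 0
  | GNot j => (nth 0 d j).+1
  | GAnd j k | GOr j k => (maxn (nth 0 d j) (nth 0 d k)).+1
  end.

Definition circuit_eval (C : circuit) (x : word) : word :=
  let v := foldl (fun v g => rcons v (gate_value x v g)) [::] (gates C) in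
  [seq nth false v j | j <- outputs C].

Definition circuit_depth (C : circuit) : nat :=
  \max_(k <- foldl (fun d g => rcons d (gate_depth d g)) [::] (gates C)) k.

(* Description of a circuit: a prefix code, with gate numbers in unary. *)
Definition nat_code (n : nat) : word := nseq n true ++ [:: false].

Definition gate_code (g : gate) : word :=
  match g with
  | GInput i => [:: false; false; false] ++ nat_code i
  | GConst b => [:: false; false; true; b]
  | GNot j => [:: false; true; false] ++ nat_code j
  | GAnd j k => [:: false; true; true] ++ nat_code j ++ nat_code k
  | GOr j k => [:: true; false; false] ++ nat_code j ++ nat_code k
  end.

Definition circuit_code (C : circuit) : word :=
  flatten [seq gate_code g | g <- gates C] ++ [:: true; true; true] ++
  flatten [seq nat_code j | j <- outputs C].

(* The output tape is write-only and its head never moves left, so that it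
   cannot serve as storage in the space bound below. *)
Definition one_way_output (M : tm) : Prop :=
  (forall (q : state M) (r r' : {ffun 'I_(nwork M).+2 -> option (bool + aux M)}),
     (forall i, i != out_tape (nwork M) -> r i = r' i) ->
     delta q r = delta q r') /\
  (forall (q : state M) (r : {ffun 'I_(nwork M).+2 -> option (bool + aux M)}),
     ((delta q r).2 (out_tape (nwork M))).2 <> MoveL).

(* The input head stays on the input or on the blanks next to it, and the work
   heads stay within distance s of their initial cells. *)
Definition in_space (M : tm) (x : word) (s : nat) : Prop :=
  forall t (i : 'I_(nwork M).+2),
    let p := head ((run M x t).2 i) in
    (i = in_tape (nwork M) -> (-1 <= p <= (size x)%:Z)%R) /\
    ((1 < i)%N -> (`|p| <= s%:Z)%R).

Definition logspace_uniform (C : nat -> circuit) : Prop :=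
  exists (M : tm) (c : nat), one_way_output M /\
    forall n, in_space M (nseq n true) (c * trunc_log 2 n + c) /\
      exists t, halted (run M (nseq n true) t) /\
                output (run M (nseq n true) t) (circuit_code (C n)).

(* Inputs of equal length may have outputs of different lengths, so a circuit
   outputs f x followed by an end mark 1 and a padding of zeros. *)
Definition nc_fun (f : word -> word) : Prop :=
  exists (C : nat -> circuit) (c : nat),
    [/\ logspace_uniform C,
        forall n, (size (gates (C n)) <= poly c n)%N,
        forall n, (circuit_depth (C n) <= polylog c n)%N
      & forall x, exists j, circuit_eval (C (size x)) x = f x ++ true :: nseq j false].

Definition nc_fun2 (f : word -> word -> word) : Prop :=
  exists2 g : word -> word, nc_fun g & forall D Q, g (pair_code D Q) = f D Q.

Definition little_o (t : nat -> nat) : Prop :=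
  forall c, exists n0, forall n, (n0 <= n)%N -> (c * t n <= n)%N.

(* Query classes.  The time bound depends on |D| only, not on |Q|. *)
Definition pseudo_tractable (size_cond : word -> word -> Prop)
    (S : set (word * word)) : Prop :=
  exists (Pi : word -> word) (S' : set (word * word)),
    [/\ polytime_fun Pi,
        forall D Q, S (D, Q) <-> S' (Pi D, Q),
        forall D, size_cond (Pi D) D
      & exists (M : ratm) (t : nat -> nat), little_o t /\
          forall D Q, exists2 b : bool,
            verdict (rrun M (pair_code (Pi D) Q) (t (size D))).1.1 = Some b
            & (b <-> S' (Pi D, Q))].

(* The empty dataset is exempt: no word is shorter than it, so without the
   exemption PTR0Q would be empty. *)
Definition PTR0Q : set (set (word * word)) :=
  [set S | pseudo_tractable
    (fun D' D => D <> [::] -> (size D' < size D)%N) S].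

Definition PTE0Q : set (set (word * word)) :=
  [set S | pseudo_tractable (fun D' D => (size D <= size D')%N) S].

Definition PT0Q : set (set (word * word)) := (PTR0Q `|` PTE0Q)%classic.

Record factorization (L : language) := Factorization {
  pi1 : word -> word;
  pi2 : word -> word;
  rho : word -> word -> word;
  pi1_nc : nc_fun pi1;
  pi2_nc : nc_fun pi2;
  rho_nc : nc_fun2 rho;
  rhoK : forall x, L x -> rho (pi1 x) (pi2 x) = x }.

Definition pair_language (L : language) (U : factorization L) :
    set (word * word) :=
  [set (pi1 U x, pi2 U x) | x in L]%classic.

Definition can_be_made_pseudo_tractable (L : language) : Prop :=
  exists U : factorization L, PT0Q (pair_language U).

Definition PTP : set language := [set L | can_be_made_pseudo_tractable L].

(* Main.v *)
From HB Require Import structures.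
From mathcomp Require Import all_boot all_order all_algebra.
From mathcomp Require Import boolp classical_sets.
From mathcomp Require Import zify.
Require Import Defs.

Set Implicit Arguments.
Unset Strict Implicit.
Unset Printing Implicit Defensive.

(** If L is in P, map x to the pair <11x, []>. Preprocessing replaces a dataset
    11x with x in L by the one-letter word 1 and every other dataset by the
    empty word; the prefix 11 makes room for this to be a shortening. It
    remains to compare the input with the code of <1, []>, which takes constant
    time. The factorization only selects input bits, and a circuit for this is
    described by a machine that keeps the input head position in a binary
    counter while it prints that position in unary.

    Conversely, x is in L iff the random-access machine accepts
    <Pi (pi1 x), pi2 x> and rho (pi1 x, pi2 x) = x: the second condition makes
    up for pairs that come from another word. This test takes polynomial time.
    A machine in logarithmic space with a one-way output tape halts before its
    configuration, output apart, repeats, so circuit descriptions can be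
    computed and evaluated; and the o(|D|) steps of the random-access machine
    are simulated with each tape stored as the list of its writes, since
    addresses may be exponential.

    To avoid programming Turing machines directly, polynomial time is
    characterized by an algebra of functions on binary trees, which is compiled
    to machines by way of a language of stack programs and contains a simulator
    of Turing machines. *)

(** * Tapes *)

(** The algebra of tree functions has an iterator that can double its state in every round, so being
    definable in it says nothing about time. Polynomial time is therefore not syntactic: [FP] asks
    for a program together with a polynomial bound on its [cost], and every use of iteration comes
    with a bound on the sizes of all intermediate states.

    One compiler serves two purposes. An execution of a stack program carries a predicate on the
    stores that it meets: the trivial predicate leaves a time bound, and a bound on the stack
    lengths yields the logarithmic space needed to print circuit descriptions. Compiled machines
    ignore the output cell under the head, so all of them have a one-way output tape.

    Numbers occur in two encodings: clocks and lengths in unary, head positions in binary, since a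
    jump may reach an exponential address although the numeral of that address is no longer than the
    run that wrote it. *)

Definition cell S (t : tape S) (p : int) : option S :=
  match p with
  | Posz n => nth None (nneg t) n
  | Negz n => nth None (neg t) n
  end.

Lemma readE S (t : tape S) : read t = cell t (head t).
Proof. by []. Qed.

Lemma head_write S a (t : tape S) : head (write a t) = head t.
Proof. by rewrite /write; case: (head t). Qed.

Lemma cell_write S a (t : tape S) p :
  cell (write a t) p = if p == head t then a else cell t p.
Proof.
by rewrite /write /cell; case: (head t) p => n [] m //=; rewrite nth_set_nth.
Qed.

Lemma cell_move S m (t : tape S) p : cell (move_head m t) p = cell t p.
Proof. by []. Qed.

Lemma cell_write_read S (t : tape S) p : cell (write (read t) t) p = cell t p.
Proof. by rewrite cell_write; case: eqP => // ->. Qed.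

(** Comparing entries with default [None] disregards trailing blanks, which erasures leave behind;
    the entry at position [size w] makes the prefix end there. *)
Lemma nonblank_prefixP S (s : seq (option S)) (w : seq S) :
  (forall n, nth None s n = nth None (map Some w) n) -> nonblank_prefix s = w.
Proof.
elim: s w => [|a s IH] [|b w] H //=.
- by have := H 0.
- by have := H 0; rewrite /= => ->.
have := H 0 => /= ->; congr (_ :: _); apply: IH => n.
exact: (H n.+1).
Qed.

(** * A language of stack programs *)

Inductive stack := kV | kW | kX | kK.

Record store := Store {
  ipos : int; outw : word; sV : word; sW : word; sX : word; sK : word }.

Definition get (k : stack) (s : store) : word :=
  match k with kV => sV s | kW => sW s | kX => sX s | kK => sK s end.

Definition put (k : stack) (w : word) (s : store) : store :=
  let: Store p o v w' x y := s in
  match k with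
  | kV => Store p o w w' x y
  | kW => Store p o v w x y
  | kX => Store p o v w' w y
  | kK => Store p o v w' x w
  end.

Definition emit (b : bool) (s : store) : store :=
  let: Store p o v w x y := s in Store p (rcons o b) v w x y.

Definition advance (m : move) (s : store) : store :=
  let: Store p o v w x y := s in Store (p + shift m)%R o v w x y.

(* [Pop] and [In] branch on the popped bit and on the scanned input cell
   (blank, 0, 1).  [Loop k] runs until [k] is empty; [While k] pops a bit before
   each round and leaves on 0 or on the empty stack; [WhileIn] runs while the
   scanned input cell is not blank. *)
Inductive cmd :=
  | Skip
  | Push of stack & bool
  | Out of bool
  | Mv of move
  | Seq of cmd & cmd
  | Pop of stack & cmd & cmd & cmd
  | In of cmd & cmd & cmd
  | Loop of stack & cmd & cmd
  | While of stack & cmd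
  | WhileIn of cmd.

Definition input_cell (x : word) (p : int) : option bool :=
  if p is Posz n then nth None (map Some x) n else None.

Definition branch T (a : option bool) (e f t : T) : T :=
  match a with None => e | Some false => f | Some true => t end.

(* [exec x P c s n s']: on input [x], [c] leads from store [s] to [s'] in [n]
   machine steps, and [P] holds of all stores met after [s]. *)
Inductive exec (x : word) (P : store -> Prop) : cmd -> store -> nat -> store -> Prop :=
  | exec_skip s : exec x P Skip s 0 s
  | exec_push k b s : P (put k (b :: get k s) s) ->
      exec x P (Push k b) s 2 (put k (b :: get k s) s)
  | exec_out b s : P (emit b s) -> exec x P (Out b) s 1 (emit b s)
  | exec_mv m s : P (advance m s) -> exec x P (Mv m) s 1 (advance m s)
  | exec_seq c1 c2 s n1 s1 n2 s2 : exec x P c1 s n1 s1 -> exec x P c2 s1 n2 s2 ->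
      exec x P (Seq c1 c2) s (n1 + n2) s2
  | exec_pop k ce cf ct s n s' : P (put k (behead (get k s)) s) ->
      exec x P (branch (ohead (get k s)) ce cf ct) (put k (behead (get k s)) s) n s' ->
      exec x P (Pop k ce cf ct) s (1 + n + 1) s'
  | exec_in ce cf ct s n s' :
      exec x P (branch (input_cell x (ipos s)) ce cf ct) s n s' ->
      exec x P (In ce cf ct) s (1 + n + 1) s'
  | exec_loop_end k cf ct s : get k s = [::] -> exec x P (Loop k cf ct) s 1 s
  | exec_loop k cf ct s b w n1 s1 n2 s2 : get k s = b :: w ->
      P (put k w s) -> exec x P (if b then ct else cf) (put k w s) n1 s1 ->
      exec x P (Loop k cf ct) s1 n2 s2 ->
      exec x P (Loop k cf ct) s (1 + n1 + 1 + n2) s2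
  | exec_while_end k c s : ohead (get k s) <> Some true ->
      P (put k (behead (get k s)) s) ->
      exec x P (While k c) s 1 (put k (behead (get k s)) s)
  | exec_while k c s w n1 s1 n2 s2 : get k s = true :: w ->
      P (put k w s) -> exec x P c (put k w s) n1 s1 ->
      exec x P (While k c) s1 n2 s2 ->
      exec x P (While k c) s (1 + n1 + 1 + n2) s2
  | exec_whilein_end c s : input_cell x (ipos s) = None -> exec x P (WhileIn c) s 1 s
  | exec_whilein c s n1 s1 n2 s2 : input_cell x (ipos s) <> None ->
      exec x P c s n1 s1 -> exec x P (WhileIn c) s1 n2 s2 ->
      exec x P (WhileIn c) s (1 + n1 + 1 + n2) s2.

Lemma exec_inv x P c s n s' : exec x P c s n s' -> P s -> P s'.
Proof. by elim; auto. Qed.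

(** * Compilation of stack programs to Turing machines *)

(** The head of a stack tape rests on the top symbol. As a machine step writes before it moves, a
    pop is a single instruction, while a push needs two: [IGrow] moves to the new cell and [ISet]
    fills it. *)
Inductive instr :=
  | IGrow of stack
  | ISet of stack & bool
  | IOut of bool
  | IMv of move
  | IPop of stack & nat & nat & nat
  | IIn of nat & nat & nat
  | IJmp of nat.

Fixpoint csize (c : cmd) : nat :=
  match c with
  | Skip => 0
  | Push _ _ => 2
  | Out _ | Mv _ => 1
  | Seq c1 c2 => csize c1 + csize c2
  | Pop _ ce cf ct | In ce cf ct => (csize ce + csize cf + csize ct).+4
  | Loop _ cf ct => (csize cf + csize ct).+3
  | While _ c | WhileIn c => (csize c).+2
  end.

(* All jump targets are absolute: [b] is the address at which the code is placed. *)
Fixpoint comp (b : nat) (c : cmd) : seq instr :=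
  match c with
  | Skip => [::]
  | Push k a => [:: IGrow k; ISet k a]
  | Out a => [:: IOut a]
  | Mv m => [:: IMv m]
  | Seq c1 c2 => comp b c1 ++ comp (b + csize c1) c2
  | Pop k ce cf ct =>
      let e := b.+1 in let f := (e + csize ce).+1 in
      let t := (f + csize cf).+1 in let z := (t + csize ct).+1 in
      IPop k e f t :: comp e ce ++ IJmp z :: comp f cf ++ IJmp z ::
      comp t ct ++ [:: IJmp z]
  | In ce cf ct =>
      let e := b.+1 in let f := (e + csize ce).+1 in
      let t := (f + csize cf).+1 in let z := (t + csize ct).+1 in
      IIn e f t :: comp e ce ++ IJmp z :: comp f cf ++ IJmp z ::
      comp t ct ++ [:: IJmp z]
  | Loop k cf ct =>
      let f := b.+1 in
      let t := (f + csize cf).+1 in let z := (t + csize ct).+1 in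
      IPop k z f t :: comp f cf ++ IJmp b :: comp t ct ++ [:: IJmp b]
  | While k c =>
      let z := (b.+1 + csize c).+1 in
      IPop k z z b.+1 :: comp b.+1 c ++ [:: IJmp b]
  | WhileIn c =>
      let z := (b.+1 + csize c).+1 in
      IIn z b.+1 b.+1 :: comp b.+1 c ++ [:: IJmp b]
  end.

Lemma size_comp c b : size (comp b c) = csize c.
Proof.
elim: c b => //= [c1 IH1 c2 IH2|k ce IH1 cf IH2 ct IH3|ce IH1 cf IH2 ct IH3
  |k cf IH1 ct IH2|k c IH1|c IH1] b; rewrite ?size_cat /= ?IH1 ?IH2 ?size_cat /=
  ?IH2 ?size_cat /= ?IH3; lia.
Qed.

Notation sym := (option (bool + void)).

Definition sidx (k : stack) : 'I_6 :=
  match k with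
  | kV => @Ordinal 6 2 isT | kW => @Ordinal 6 3 isT
  | kX => @Ordinal 6 4 isT | kK => @Ordinal 6 5 isT
  end.

Lemma sidx_inj : injective sidx.
Proof. by case=> -[]. Qed.

Lemma tapeP (i : 'I_6) :
  [\/ i = in_tape 4, i = out_tape 4 | exists k, i = sidx k].
Proof.
case: i => [[|[|[|[|[|[|//]]]]]] lt_i].
- by apply: Or31; apply: val_inj.
- by apply: Or32; apply: val_inj.
- by apply: Or33; exists kV; apply: val_inj.
- by apply: Or33; exists kW; apply: val_inj.
- by apply: Or33; exists kX; apply: val_inj.
- by apply: Or33; exists kK; apply: val_inj.
Qed.

Definition bit_of (a : sym) : option bool :=
  if a is Some (inl b) then Some b else None.

Definition target (ins : instr) (pc : nat) (r : {ffun 'I_6 -> sym}) : nat :=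
  match ins with
  | IPop k e f t => branch (bit_of (r (sidx k))) e f t
  | IIn e f t => branch (bit_of (r (in_tape 4))) e f t
  | IJmp t => t
  | _ => pc.+1
  end.

(** On the output tape a blank is written instead of the scanned [r i]. The head is always just past
    the output, so this changes nothing, and the action does not depend on that cell, as
    [one_way_output] demands. *)
Definition action (ins : instr) (r : {ffun 'I_6 -> sym}) : {ffun 'I_6 -> sym * move} :=
  [ffun i => if i == out_tape 4 then
      (if ins is IOut b then (Some (inl b), MoveR) else (None, MoveS))
    else match ins with
      | IMv m => (r i, if i == in_tape 4 then m else MoveS)
      | IGrow k => (r i, if i == sidx k then MoveR else MoveS)
      | ISet k b => (if i == sidx k then Some (inl b) else r i, MoveS)
      | IPop k _ _ _ => if i == sidx k
          then (None, if r i is None then MoveS else MoveL) else (r i, MoveS)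
      | _ => (r i, MoveS)
      end].

(* States [size p] and [(size p).+1] accept and reject. *)
Definition machine (p : seq instr) : tm :=
  @TM 4 void 'I_(size p).+2 ord0
    (fun q => if q == size p :> nat then Some true
              else if q == (size p).+1 :> nat then Some false else None)
    (fun q r => let ins := nth (IJmp 0) p q in
                (inord (target ins q r), action ins r)).

Lemma machine_one_way p : one_way_output (machine p).
Proof.
split=> [q r r' eqr | q r] /=; last first.
  by rewrite ffunE; case: (nth _ _ _).
have Er i : i != out_tape 4 -> r i = r' i by exact: eqr.
congr (inord _, _).
  case: (nth _ _ _) => //= [k e f t|e f t]; rewrite Er //; by case: k.
apply/ffunP => i; rewrite !ffunE; case: (boolP (i == out_tape 4)) => // ne_i.
by rewrite Er.
Qed.

(** Cell 0 stays blank and marks the bottom: the head of an empty stack reads a blank there, and a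
    pop then leaves it in place. *)
Definition stack_cell (w : word) (p : int) : sym :=
  if p is Posz n.+1 then nth None [seq Some (inl b) | b <- rev w] n else None.

Definition stack_rep (t : tape (bool + void)) (w : word) : Prop :=
  head t = size w /\ forall p, cell t p = stack_cell w p.

Definition out_rep (t : tape (bool + void)) (w : word) : Prop :=
  head t = size w /\ forall p, cell t p =
    if p is Posz n then nth None [seq Some (inl b) | b <- w] n else None.

Definition bits_tape (x : word) (p : int) : tape (bool + void) :=
  Tape p [::] [seq Some (inl b) | b <- x].

Definition rep (x : word) p (c : config (machine p)) (pc : nat) (s : store) : Prop :=
  [/\ nat_of_ord c.1 = pc, c.2 (in_tape 4) = bits_tape x (ipos s),
      out_rep (c.2 (out_tape 4)) (outw s)
    & forall k, stack_rep (c.2 (sidx k)) (get k s)].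

Lemma stack_cell_top w : stack_cell w (size w) = omap inl (ohead w).
Proof.
case: w => // b w; rewrite /stack_cell /= rev_cons map_rcons nth_rcons size_map.
by rewrite size_rev ltnn eqxx.
Qed.

Lemma stack_rep_read t w : stack_rep t w -> read t = omap inl (ohead w).
Proof. by case=> Eh Ec; rewrite readE Eh Ec stack_cell_top. Qed.

Lemma stack_rep_keep t t' w : stack_rep t w ->
  head t' = head t -> (forall p, cell t' p = cell t p) -> stack_rep t' w.
Proof. by move=> [Eh Ec] Eh' Ec'; split=> [|p]; rewrite ?Eh' ?Ec'. Qed.

Lemma stack_cell_cons b w p :
  stack_cell (b :: w) p = if p == (size w).+1 then Some (inl b) else stack_cell w p.
Proof.
case: p => // -[//|n]; rewrite /stack_cell rev_cons map_rcons nth_rcons size_map size_rev.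
rewrite [_ == _]/=; case: ltngtP => // ltn; first by case: eqP => //; lia.
  by rewrite nth_default ?size_map ?size_rev //; [case: eqP => // -[]; lia | lia].
by rewrite ltn eqxx.
Qed.

Lemma stack_cell_out w (p : int) : ((size w)%:Z < p)%R -> stack_cell w p = None.
Proof.
case: p => // -[|n] //= lt_wn; rewrite nth_default // size_map size_rev; lia.
Qed.

(** ** One machine step *)

Section Simulation.
Variables (x : word) (P : store -> Prop) (p : seq instr).

Local Notation conf := (config (machine p)).

(* The heads of [c] are where they are in some store satisfying [P]. *)
Definition tracked (c : conf) : Prop :=
  exists s, [/\ P s, head (c.2 (in_tape 4)) = ipos s
    & forall k, (`|head (c.2 (sidx k))| <= (size (get k s))%:Z)%R].

Lemma rep_tracked (c : conf) pc s : rep x c pc s -> P s -> tracked c.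
Proof.
move=> [_ Ei _ Ek] Ps; exists s; split; rewrite ?Ei // => k.
by have [-> _] := Ek k; lia.
Qed.

Definition runs (pc : nat) (s : store) (n pc' : nat) (s' : store) : Prop :=
  forall c : conf, rep x c pc s ->
    rep x (iter n (@step (machine p)) c) pc' s' /\
    forall t, t <= n -> tracked (iter t (@step (machine p)) c).

Lemma runs0 pc s : P s -> runs pc s 0 pc s.
Proof.
by move=> Ps c rc; split=> // t; rewrite leqn0 => /eqP->; exact: rep_tracked rc Ps.
Qed.

Lemma runs_trans pc s n pc' s' n' pc'' s'' :
  runs pc s n pc' s' -> runs pc' s' n' pc'' s'' -> runs pc s (n + n') pc'' s''.
Proof.
move=> r1 r2 c /r1[rc1 tr1]; have [rc2 tr2] := r2 _ rc1.
rewrite addnC iterD; split=> // t le_t.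
have [/tr1 //|lt_t] := leqP t n.
by rewrite -(subnK (ltnW lt_t)) iterD; apply: tr2; lia.
Qed.

Lemma step_instr (c : conf) pc s : rep x c pc s -> pc < size p ->
  let ins := nth (IJmp 0) p pc in let r := scan c in
  target ins pc r <= (size p).+1 ->
  nat_of_ord (step c).1 = target ins pc r /\
  forall i, (step c).2 i = move_head (action ins r i).2
    (if i == in_tape 4 then c.2 i else write (action ins r i).1 (c.2 i)).
Proof.
case=> Epc _ _ _ lt_pc ins r le_t.
have nh : halted c = false.
  by rewrite /halted /= Epc !ifN //; apply/eqP; lia.
rewrite /step nh /next /= Epc -/ins -/r; split; first by rewrite inordK.
by move=> i; rewrite ffunE.
Qed.

Lemma out_rep_keep (t : tape (bool + void)) w : out_rep t w ->
  out_rep (move_head MoveS (write None t)) w.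
Proof.
move=> [Eh Ec]; split=> [|q]; first by rewrite /= head_write Eh; lia.
rewrite cell_move cell_write Ec; case: eqP => // ->; rewrite Eh.
by rewrite nth_default // size_map.
Qed.

Lemma stack_rep_stay (t : tape (bool + void)) w : stack_rep t w ->
  stack_rep (move_head MoveS (write (read t) t)) w.
Proof.
move=> rt; apply: (stack_rep_keep rt); first by rewrite /= head_write; lia.
by move=> q; rewrite cell_move cell_write_read.
Qed.

Lemma sidx_in k : (sidx k == in_tape 4) = false. Proof. by case: k. Qed.
Lemma sidx_out k : (sidx k == out_tape 4) = false. Proof. by case: k. Qed.

Lemma get_put k w s j : get j (put k w s) = if sidx j == sidx k then w else get j s.
Proof. by case: s; case: k; case: j. Qed.

Lemma ipos_put k w s : ipos (put k w s) = ipos s. Proof. by case: s; case: k. Qed.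
Lemma outw_put k w s : outw (put k w s) = outw s. Proof. by case: s; case: k. Qed.

Lemma put_get k s : put k (get k s) s = s. Proof. by case: s; case: k. Qed.

Lemma move_bits_tape m q : move_head m (bits_tape x q) = bits_tape x (q + shift m)%R.
Proof. by []. Qed.

Lemma shiftS (q : int) : (q + shift MoveS)%R = q. Proof. by rewrite /=; lia. Qed.

Lemma bits_tape_read q : bit_of (read (bits_tape x q)) = input_cell x q.
Proof.
case: q => [n|n]; last by rewrite /read /= nth_nil.
rewrite /read /=; have [lt_n|le_n] := ltnP n (size x).
  by rewrite !(nth_map false).
by rewrite !nth_default ?size_map.
Qed.

Lemma runs_jmp pc s t : pc < size p -> nth (IJmp 0) p pc = IJmp t -> t <= (size p).+1 ->
  P s -> runs pc s 1 t s.
Proof.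
move=> lt_pc Ei le_t Ps c rc; have := step_instr rc lt_pc; rewrite Ei /= => /(_ le_t)[E1 E2].
have rc' : rep x (step c) t s.
  have [_ Ri Ro Rk] := rc; split; rewrite ?E2 ?ffunE //=.
  - by rewrite Ri move_bits_tape shiftS.
  - exact: out_rep_keep.
  - by move=> k; rewrite E2 !ffunE sidx_in sidx_out; apply: stack_rep_stay.
split=> // -[|[|//]] _; [exact: rep_tracked rc Ps | exact: rep_tracked rc' Ps].
Qed.

Lemma runs_in pc s e f t : pc < size p -> nth (IJmp 0) p pc = IIn e f t ->
  branch (input_cell x (ipos s)) e f t <= (size p).+1 ->
  P s -> runs pc s 1 (branch (input_cell x (ipos s)) e f t) s.
Proof.
move=> lt_pc Ei le_t Ps c rc; have := step_instr rc lt_pc; rewrite Ei /= !ffunE.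
have [_ Ri Ro Rk] := rc; rewrite Ri bits_tape_read => /(_ le_t)[E1 E2].
have rc' : rep x (step c) (branch (input_cell x (ipos s)) e f t) s.
  split; rewrite ?E2 ?ffunE //=.
  - by rewrite Ri move_bits_tape shiftS.
  - exact: out_rep_keep.
  - by move=> k; rewrite E2 !ffunE sidx_in sidx_out; apply: stack_rep_stay.
split=> // -[|[|//]] _; [exact: rep_tracked rc Ps | exact: rep_tracked rc' Ps].
Qed.

Lemma runs_mv pc s m : pc < size p -> nth (IJmp 0) p pc = IMv m ->
  P s -> P (advance m s) -> runs pc s 1 pc.+1 (advance m s).
Proof.
move=> lt_pc Ei Ps Ps' c rc; have := step_instr rc lt_pc; rewrite Ei /= => /(_ (leqW lt_pc))[E1 E2].
have rc' : rep x (step c) pc.+1 (advance m s).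
  have [_ Ri Ro Rk] := rc; split; rewrite ?E2 ?ffunE //=.
  - by rewrite Ri move_bits_tape; case: (s).
  - by rewrite (_ : outw _ = outw s); [apply: out_rep_keep | case: (s)].
  - move=> k; rewrite E2 !ffunE sidx_in sidx_out (_ : get k _ = get k s); last by case: (s).
    exact: stack_rep_stay.
split=> // -[|[|//]] _; [exact: rep_tracked rc Ps | exact: rep_tracked rc' Ps'].
Qed.

Lemma runs_out pc s b : pc < size p -> nth (IJmp 0) p pc = IOut b ->
  P s -> P (emit b s) -> runs pc s 1 pc.+1 (emit b s).
Proof.
move=> lt_pc Ei Ps Ps' c rc; have := step_instr rc lt_pc; rewrite Ei /= => /(_ (leqW lt_pc))[E1 E2].
have rc' : rep x (step c) pc.+1 (emit b s).
  have [_ Ri [Eh Ec] Rk] := rc; split; rewrite ?E2 ?ffunE //=.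
  - by rewrite Ri move_bits_tape shiftS; case: (s).
  - have -> : outw (emit b s) = rcons (outw s) b by case: (s).
    split=> [|q]; rewrite /= ?head_write ?cell_move ?cell_write ?Eh ?Ec ?size_rcons; first lia.
    case: q => [n|n] //; rewrite map_rcons nth_rcons size_map [_ == _]/=.
    case: ltngtP => lt_n; [by case: eqP => //; lia| |by rewrite lt_n eqxx].
    by rewrite nth_default ?size_map 1?ltnW //; case: eqP => //; lia.
  - move=> k; rewrite E2 !ffunE sidx_in sidx_out (_ : get k _ = get k s); last by case: (s).
    exact: stack_rep_stay.
split=> // -[|[|//]] _; [exact: rep_tracked rc Ps | exact: rep_tracked rc' Ps'].
Qed.

Lemma runs_pop pc s k e f t : pc < size p -> nth (IJmp 0) p pc = IPop k e f t ->
  branch (ohead (get k s)) e f t <= (size p).+1 ->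
  P s -> P (put k (behead (get k s)) s) ->
  runs pc s 1 (branch (ohead (get k s)) e f t) (put k (behead (get k s)) s).
Proof.
move=> lt_pc Ei le_t Ps Ps' c rc; have := step_instr rc lt_pc; rewrite Ei /= !ffunE.
have [_ Ri Ro Rk] := rc.
have Er j : read (c.2 (sidx j)) = omap inl (ohead (get j s)) by apply: stack_rep_read.
have -> : bit_of (read (c.2 (sidx k))) = ohead (get k s) by rewrite Er; case: (ohead _).
move=> /(_ le_t)[E1 E2].
have rc' : rep x (step c) (branch (ohead (get k s)) e f t) (put k (behead (get k s)) s).
  split; rewrite ?E2 ?ffunE //= ?ipos_put ?outw_put.
  - by rewrite eq_sym sidx_in Ri move_bits_tape shiftS.
  - exact: out_rep_keep.
  - move=> j; rewrite E2 !ffunE sidx_in sidx_out get_put.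
    case: eqP => [/sidx_inj->|_]; last exact: stack_rep_stay.
    rewrite Er; have [Eh Ec] := Rk k; case: (get k s) Eh Ec => [|b w] Eh Ec.
      split=> [|q]; rewrite /= ?head_write ?cell_move ?cell_write ?Eh ?Ec //.
      by case: eqP => // ->.
    split=> [|q]; rewrite /= ?head_write ?cell_move ?cell_write ?Eh ?Ec; first by rewrite /=; lia.
    by rewrite stack_cell_cons; case: eqP => // ->; rewrite stack_cell_out //=; lia.
split=> // -[|[|//]] _; [exact: rep_tracked rc Ps | exact: rep_tracked rc' Ps'].
Qed.

(* Between the two steps of a push the head already stands on the new cell. *)
Lemma runs_push pc s k b : pc.+1 < size p -> nth (IJmp 0) p pc = IGrow k ->
  nth (IJmp 0) p pc.+1 = ISet k b ->
  P s -> P (put k (b :: get k s) s) -> runs pc s 2 pc.+2 (put k (b :: get k s) s).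
Proof.
move=> lt_pc Ei Ei' Ps Ps' c rc.
have := step_instr rc (ltnW lt_pc); rewrite Ei /= => /(_ (leqW (ltnW lt_pc)))[E1 E2].
have [_ Ri Ro Rk] := rc.
set c' := step c in E1 E2 *.
have Ri' : c'.2 (in_tape 4) = bits_tape x (ipos s).
  by rewrite E2 ffunE /= eq_sym sidx_in Ri move_bits_tape shiftS.
have Ro' : out_rep (c'.2 (out_tape 4)) (outw s).
  by rewrite E2 ffunE /=; apply: out_rep_keep.
have Rk' j : j <> k -> stack_rep (c'.2 (sidx j)) (get j s).
  move=> ne_jk; rewrite E2 !ffunE sidx_in sidx_out ifN; first exact: stack_rep_stay.
  by apply/eqP => /sidx_inj.
have Eh' : head (c'.2 (sidx k)) = (size (get k s)).+1.
  by rewrite E2 !ffunE sidx_in sidx_out eqxx /= head_write; have [-> _] := Rk k; lia.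
have Ec' q : cell (c'.2 (sidx k)) q = stack_cell (get k s) q.
  rewrite E2 !ffunE sidx_in sidx_out cell_move cell_write_read.
  by have [_ ->] := Rk k.
have nh : halted c' = false by rewrite /halted /= E1 !ifN //; apply/eqP; lia.
have lt_pc2 : pc.+2 < (size p).+2 by lia.
have rc' : rep x (step c') pc.+2 (put k (b :: get k s) s).
  rewrite /step nh /next /= E1 Ei' /=; split; rewrite ?ipos_put ?outw_put.
  - by rewrite /= inordK.
  - by rewrite !ffunE /= Ri' move_bits_tape shiftS.
  - by rewrite !ffunE /=; apply: out_rep_keep.
  - move=> j; rewrite get_put !ffunE sidx_in sidx_out /=.
    case: eqP => [/sidx_inj->|ne]; last first.
      by apply: stack_rep_stay; apply: Rk' => // Ejk; rewrite Ejk in ne.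
    split=> [|q]; rewrite /= ?head_write ?cell_move ?cell_write ?Eh' ?Ec'; first lia.
    by rewrite stack_cell_cons.
split=> // -[|[|[|//]]] _; [exact: rep_tracked rc Ps | | exact: rep_tracked rc' Ps'].
(* A half-completed push represents no store, but its heads stand as in the store after the push,
   which satisfies [P]. *)
exists (put k (b :: get k s) s); split=> //; first by rewrite ipos_put /= Ri'.
move=> j; rewrite get_put; case: eqP => [/sidx_inj->|ne]; first by rewrite Eh'.
by have [->] := Rk' j (fun E => ne (congr1 sidx E)); lia.
Qed.

Definition code_at (b : nat) (l : seq instr) : Prop :=
  b + size l <= size p /\ forall i, i < size l -> nth (IJmp 0) p (b + i) = nth (IJmp 0) l i.

Lemma code_at_cat b l1 l2 : code_at b (l1 ++ l2) ->
  code_at b l1 /\ code_at (b + size l1) l2.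
Proof.
move=> [le_b E]; rewrite size_cat in le_b E; split; split; try lia.
  by move=> i lt_i; rewrite E ?nth_cat ?lt_i //; lia.
by move=> i lt_i; rewrite -addnA E ?nth_cat; [rewrite ifN ?addKn //; lia | lia].
Qed.

Lemma code_at_cons b ins l : code_at b (ins :: l) ->
  [/\ b < size p, nth (IJmp 0) p b = ins & code_at b.+1 l].
Proof.
move=> [/= le_b E]; split; [lia | by rewrite -[b]addn0 (E 0) | split; first lia].
by move=> i lt_i; rewrite addSnnS E.
Qed.

Lemma code_at_comp b c l : code_at b (comp b c ++ l) ->
  code_at b (comp b c) /\ code_at (b + csize c) l.
Proof. by move/code_at_cat; rewrite size_comp. Qed.

End Simulation.

(** The induction is on the execution and not on the program: after one round of a loop there
    remains a smaller execution of the same loop at the same address. *)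
Lemma exec_runs x P p c s n s' : exec x P c s n s' -> P s ->
  forall b, code_at p b (comp b c) -> runs x P p b s n (b + csize c) s'.
Proof.
elim=> {c s n s'} /=.
- by move=> s Ps b _; rewrite addn0; apply: runs0.
- move=> k a s Ps' Ps b /code_at_cons[_ E1 /code_at_cons[lt2 E2 _]].
  by rewrite addn2; apply: runs_push.
- by move=> a s Ps' Ps b /code_at_cons[lt1 E1 _]; rewrite addn1; apply: runs_out.
- by move=> m s Ps' Ps b /code_at_cons[lt1 E1 _]; rewrite addn1; apply: runs_mv.
- move=> c1 c2 s n1 s1 n2 s2 e1 IH1 e2 IH2 Ps b /code_at_comp[h1 h2].
  rewrite addnA; apply: runs_trans (IH1 Ps _ h1) _.
  exact: IH2 (exec_inv e1 Ps) _ h2.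
- move=> k ce cf ct s n s' Ps1 e1 IH Ps b.
  move=> /code_at_cons[lt_b Eb /code_at_comp[h1]].
  move=> /code_at_cons[lt1 E1 /code_at_comp[h2]].
  move=> /code_at_cons[lt2 E2 /code_at_comp[h3]] /code_at_cons[lt3 E3 _].
  (* The intermediate address is that of the jump which closes the chosen branch and leads to the
     common exit. *)
  apply: (@runs_trans _ _ _ _ _ _ (branch (ohead (get k s)) (b.+1 + csize ce)
    ((b.+1 + csize ce).+1 + csize cf) (((b.+1 + csize ce).+1 + csize cf).+1 + csize ct))); last first.
    have Ps' := exec_inv e1 Ps1.
    rewrite (_ : b + _ = (((b.+1 + csize ce).+1 + csize cf).+1 + csize ct).+1); last by lia.
    case: (ohead _) IH => [[]|] /= IH.
    + by apply: (runs_jmp lt3 E3 _ Ps'); lia.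
    + by apply: (runs_jmp lt2 E2 _ Ps'); lia.
    + by apply: (runs_jmp lt1 E1 _ Ps'); lia.
  apply: runs_trans.
    by apply: (runs_pop _ Eb) => //; case: (ohead _) => [[]|] /=; lia.
  by case: (ohead _) IH => [[]|] /= IH; apply: IH.
- move=> ce cf ct s n s' e1 IH Ps b.
  move=> /code_at_cons[lt_b Eb /code_at_comp[h1]].
  move=> /code_at_cons[lt1 E1 /code_at_comp[h2]].
  move=> /code_at_cons[lt2 E2 /code_at_comp[h3]] /code_at_cons[lt3 E3 _].
  apply: (@runs_trans _ _ _ _ _ _ (branch (input_cell x (ipos s)) (b.+1 + csize ce)
    ((b.+1 + csize ce).+1 + csize cf) (((b.+1 + csize ce).+1 + csize cf).+1 + csize ct))); last first.
    have Ps' := exec_inv e1 Ps.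
    rewrite (_ : b + _ = (((b.+1 + csize ce).+1 + csize cf).+1 + csize ct).+1); last by lia.
    case: (input_cell _ _) IH => [[]|] /= IH.
    + by apply: (runs_jmp lt3 E3 _ Ps'); lia.
    + by apply: (runs_jmp lt2 E2 _ Ps'); lia.
    + by apply: (runs_jmp lt1 E1 _ Ps'); lia.
  apply: runs_trans.
    by apply: (runs_in _ Eb) => //; case: (input_cell _ _) => [[]|] /=; lia.
  by case: (input_cell _ _) IH => [[]|] /= IH; apply: IH.
- move=> k cf ct s Ek Ps b.
  move=> /code_at_cons[lt_b Eb /code_at_comp[h1]].
  move=> /code_at_cons[lt1 E1 /code_at_comp[h2]] /code_at_cons[lt2 E2 _].
  rewrite (_ : b + _ = ((b.+1 + csize cf).+1 + csize ct).+1); last by lia.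
  have := @runs_pop x P p _ s _ _ _ _ lt_b Eb; rewrite Ek /= -[X in put k X]Ek put_get.
  by apply=> //; lia.
- move=> k cf ct s a w n1 s1 n2 s2 Ek Ps1 e1 IH1 e2 IH2 Ps b cat.
  have := cat => /code_at_cons[lt_b Eb /code_at_comp[h1]].
  move=> /code_at_cons[lt1 E1 /code_at_comp[h2]] /code_at_cons[lt2 E2 _].
  have Ps' := exec_inv e1 Ps1.
  apply: runs_trans (IH2 Ps' _ cat).
  have := @runs_pop x P p _ s _ _ _ _ lt_b Eb; rewrite Ek /= => r1.
  apply: (@runs_trans _ _ _ _ _ _ (if a then (b.+1 + csize cf).+1 + csize ct
    else b.+1 + csize cf)); last first.
    case: (a) IH1 => /= IH1.
    + exact: (@runs_jmp _ _ _ _ _ _ lt2 E2 (leqW (ltnW lt_b)) Ps').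
    + exact: (@runs_jmp _ _ _ _ _ _ lt1 E1 (leqW (ltnW lt_b)) Ps').
  apply: runs_trans; first by apply: r1 => //; case: (a); lia.
  by case: (a) IH1 => /= IH1; apply: IH1.
- move=> k c s Ek Ps1 Ps b.
  move=> /code_at_cons[lt_b Eb /code_at_comp[h1]] /code_at_cons[lt1 E1 _].
  rewrite (_ : b + _ = (b.+1 + csize c).+1); last by lia.
  have := @runs_pop x P p _ s _ _ _ _ lt_b Eb.
  by case: (ohead _) Ek => [[]|] //= _; apply=> //; lia.
- move=> k c s w n1 s1 n2 s2 Ek Ps1 e1 IH1 e2 IH2 Ps b cat.
  have := cat => /code_at_cons[lt_b Eb /code_at_comp[h1]] /code_at_cons[lt1 E1 _].
  have Ps' := exec_inv e1 Ps1.
  apply: runs_trans (IH2 Ps' _ cat).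
  have := @runs_pop x P p _ s _ _ _ _ lt_b Eb; rewrite Ek /= => r1.
  apply: runs_trans (@runs_jmp _ _ _ _ _ _ lt1 E1 (leqW (ltnW lt_b)) Ps').
  apply: runs_trans; first by apply: r1 => //; lia.
  exact: IH1.
- move=> c s Ei Ps b.
  move=> /code_at_cons[lt_b Eb /code_at_comp[h1]] /code_at_cons[lt1 E1 _].
  rewrite (_ : b + _ = (b.+1 + csize c).+1); last by lia.
  by have := @runs_in x P p _ s _ _ _ lt_b Eb; rewrite Ei /=; apply=> //; lia.
- move=> c s n1 s1 n2 s2 Ei e1 IH1 e2 IH2 Ps b cat.
  have := cat => /code_at_cons[lt_b Eb /code_at_comp[h1]] /code_at_cons[lt1 E1 _].
  have Ps' := exec_inv e1 Ps.
  apply: runs_trans (IH2 Ps' _ cat).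
  have r1 := @runs_in x P p _ s _ _ _ lt_b Eb.
  apply: runs_trans (@runs_jmp _ _ _ _ _ _ lt1 E1 (leqW (ltnW lt_b)) Ps').
  apply: runs_trans; last exact: IH1.
  by case: (input_cell _ _) Ei r1 => [[]|] //= _ r1; apply: r1 => //; lia.
Qed.

(** * Complete machines: initial configuration, verdict and output *)

Definition empty_store : store := Store 0%R [::] [::] [::] [::] [::].

(* The machine of [c] accepts iff [c] leaves a 1 on top of [kV]. *)
Definition prog_of (c : cmd) : seq instr :=
  let n := csize c in comp 0 c ++ [:: IPop kV n.+2 n.+2 n.+1].

Definition machine_of (c : cmd) : tm := machine (prog_of c).

Lemma run_halted (M : tm) x t t' : halted (run M x t) -> t <= t' -> run M x t' = run M x t.
Proof.
move=> Ht /subnK <-; rewrite addnC /run addnC iterD.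
by elim: (t' - t) => //= n ->; rewrite /step -/(run M x t) Ht.
Qed.

Section Machine.
Variables (x : word) (P : store -> Prop) (c : cmd) (n : nat) (s : store).
Hypotheses (e : exec x P c empty_store n s) (P0 : P empty_store).

Lemma rep_init : @rep x (prog_of c) (init (machine_of c) x) 0 empty_store.
Proof.
split=> //=; rewrite ?ffunE //=.
- by rewrite /tape_of /bits_tape -map_comp.
- by split=> // -[] *; rewrite /= ?nth_nil.
- by move=> k; rewrite ffunE sidx_in; case: k; split=> // -[[|m]|m]; rewrite /cell /= ?nth_nil.
Qed.

(** The heads are tracked at every time [t], as [in_space] requires, because a halted machine
    repeats its last configuration. The extra step in [n.+1] is the final pop, which selects the
    verdict. *)
Lemma machine_of_runs : P (put kV (behead (get kV s)) s) ->
  let m := n.+1 in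
  [/\ @rep x (prog_of c) (run (machine_of c) x m)
        (branch (ohead (get kV s)) (csize c).+2 (csize c).+2 (csize c).+1)
        (put kV (behead (get kV s)) s)
    & forall t, tracked P (run (machine_of c) x t)].
Proof.
move=> Ps' m; rewrite {}/m.
have Es : size (prog_of c) = (csize c).+1 by rewrite size_cat size_comp addn1.
have Ec : code_at (prog_of c) 0 (comp 0 c ++ [:: IPop kV (csize c).+2 (csize c).+2 (csize c).+1]).
  by split; rewrite ?Es ?size_cat ?size_comp ?addn1.
have [Ec1 Ec2] := code_at_comp Ec.
have [lt_b Eb _] := code_at_cons Ec2.
rewrite add0n in lt_b Eb.
have r1 := exec_runs e P0 Ec1; rewrite add0n in r1.
have Ps := exec_inv e P0.
have r2 : runs x P (prog_of c) 0 empty_store n.+1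
    (branch (ohead (get kV s)) (csize c).+2 (csize c).+2 (csize c).+1)
    (put kV (behead (get kV s)) s).
  rewrite -addn1; apply: runs_trans r1 _; apply: runs_pop Eb _ Ps Ps' => //.
  by rewrite Es; case: (ohead _) => [[]|] /=; lia.
have [rf tr] := r2 _ rep_init; split=> // t.
have [/tr //|lt_t] := leqP t n.+1.
rewrite (run_halted _ (ltnW lt_t)); first exact: tr.
have [E1 _ _ _] := rf; rewrite /halted /= /run E1 Es.
by case: (ohead _) => [[]|] /=; rewrite ?eqxx //; case: eqP.
Qed.

Lemma machine_of_verdict : P (put kV (behead (get kV s)) s) ->
  verdict (run (machine_of c) x n.+1).1 = Some (ohead (get kV s) == Some true).
Proof.
move/machine_of_runs => [[E1 _ _ _] _]; rewrite /= E1 size_cat size_comp addn1 /=.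
by case: (ohead _) => [[]|] /=; rewrite ?eqxx //; case: eqP => //; lia.
Qed.

Lemma machine_of_output : P (put kV (behead (get kV s)) s) ->
  output (run (machine_of c) x n.+1) (outw s).
Proof.
move/machine_of_runs => [[_ _ [_ Ec] _] _]; apply: nonblank_prefixP => m.
have := Ec (Posz m); rewrite /cell /= => ->; rewrite -map_comp /=.
by case: (s); case: (kV).
Qed.

End Machine.

(** * An algebra of functions on binary trees *)

Inductive tree := Leaf | Node of tree & tree.

(** The preorder code is prefix-free, so that one stack can hold several trees without
    separators. *)
Fixpoint code (a : tree) : word :=
  if a is Node l r then true :: code l ++ code r else [:: false].

Definition tsize (a : tree) : nat := size (code a).

(* The tree is read as a list, of which this is the length. *)
Fixpoint spine (a : tree) : nat := if a is Node _ r then (spine r).+1 else 0.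

Fixpoint eq_tree (a b : tree) : bool :=
  match a, b with
  | Leaf, Leaf => true
  | Node l r, Node l' r' => eq_tree l l' && eq_tree r r'
  | _, _ => false
  end.

Lemma eq_treeP a b : reflect (a = b) (eq_tree a b).
Proof.
apply: (iffP idP) => [|<-]; last by elim: a => //= l -> r ->.
by elim: a b => [|l IHl r IHr] [|l' r'] //= /andP[/IHl-> /IHr->].
Qed.

HB.instance Definition _ := hasDecEq.Build tree eq_treeP.

Lemma code_inj a b v w : code a ++ v = code b ++ w -> a = b /\ v = w.
Proof.
elim: a b v w => [|l IHl r IHr] [|l' r'] v w //=; first by case.
by case; rewrite -!catA => /IHl[-> /IHr[-> ->]].
Qed.

Lemma code_eq a b : (code a == code b) = (a == b).
Proof.
apply/eqP/eqP => [E|->//]; have [] := @code_inj a b [::] [::] => //.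
by rewrite E.
Qed.

Definition tbool (b : bool) : tree := if b then Node Leaf Leaf else Leaf.

Inductive fn :=
  | FId
  | FComp of fn & fn
  | FFst
  | FSnd
  | FPair of fn & fn
  | FLeaf
  | FIf of fn & fn & fn
  | FEq
  | FIter of fn.

Fixpoint eval (f : fn) (a : tree) : tree :=
  match f with
  | FId => a
  | FComp g h => eval g (eval h a)
  | FFst => if a is Node l _ then l else Leaf
  | FSnd => if a is Node _ r then r else Leaf
  | FPair g h => Node (eval g a) (eval h a)
  | FLeaf => Leaf
  | FIf c g h => if eval c a is Node _ _ then eval g a else eval h a
  | FEq => if a is Node l r then tbool (l == r) else Leaf
  | FIter g => if a is Node l r then iter (spine l) (eval g) r else Leaf
  end.

(* An upper bound on the number of machine steps of the compiled program; the
   constants are generous. *)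
Fixpoint cost (f : fn) (a : tree) : nat :=
  match f with
  | FId => 0
  | FComp g h => cost h a + cost g (eval h a)
  | FFst | FSnd | FLeaf | FEq => 200 * tsize a
  | FPair g h => cost g a + cost h a + 400 * (tsize a + tsize (eval g a) + tsize (eval h a))
  | FIf c g h => 200 * (tsize a + tsize (eval c a)) + cost c a +
      (if eval c a is Node _ _ then cost g a else cost h a)
  | FIter g => 200 * tsize a + if a is Node l r then
      \sum_(i < spine l) (cost g (iter i (eval g) r) +
        200 * (tsize l + tsize (iter i (eval g) r) + tsize (iter i.+1 (eval g) r)))
      else 0
  end.

Lemma tsize_gt0 a : 0 < tsize a. Proof. by case: a. Qed.

Lemma tsize_node l r : tsize (Node l r) = (tsize l + tsize r).+1.
Proof. by rewrite /tsize /= size_cat. Qed.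

(** The cost pays for everything that is built, so a polynomial cost also bounds the size of the
    value; this is what makes compositions polynomial. *)
Lemma leq_tsize_eval f a : tsize (eval f a) <= tsize a + cost f a.
Proof.
elim: f a => [|g IHg h IHh||| g IHg h IHh||c IHc g IHg h IHh||g IHg] a /=.
- by rewrite addn0.
- by have := IHh a; have := IHg (eval h a); lia.
- by case: a => [|l r] //; rewrite tsize_node; lia.
- by case: a => [|l r] //; rewrite tsize_node; lia.
- by rewrite tsize_node; have := IHh a; have := IHg a; have := tsize_gt0 a; lia.
- by have := tsize_gt0 a; change (tsize Leaf) with 1; lia.
- by case: (eval c a) => *; [have := IHh a | have := IHg a]; lia.
- case: a => [|l r] //; have := tsize_gt0 (Node l r).
  by rewrite /tbool; case: eqP => _; rewrite ?tsize_node; change (tsize Leaf) with 1; lia.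
- case: a => [|l r]; first exact: leq_addr.
  case: (spine l) => [|n]; first by rewrite big_ord0 tsize_node /=; lia.
  by rewrite big_ord_recr /=; have := tsize_gt0 l; lia.
Qed.

(** ** Compilation to stack programs *)

Definition move_all (j k : stack) : cmd := Loop j (Push k false) (Push k true).

(* Moves the tree on top of [kV] to [k], reversing its code; [kK] counts the
   subtrees still to be read. *)
Definition move_tree (k : stack) : cmd :=
  Seq (Push kK true) (While kK
    (Pop kV Skip (Push k false)
      (Seq (Push k true) (Seq (Push kK true) (Push kK true))))).

Definition drop_tree : cmd := Seq (move_tree kW) (Loop kW Skip Skip).

Definition swap_trees : cmd :=
  Seq (move_tree kW) (Seq (move_tree kX) (Seq (move_all kW kV) (move_all kX kV))).

Definition dup_tree : cmd :=
  Seq (move_tree kW) (Seq (Loop kW (Seq (Push kV false) (Push kX false))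
                                   (Seq (Push kV true) (Push kX true)))
    (Seq (move_all kX kW) (move_all kW kV))).

(* Leaves in [kK] a 1 for each position where [kW] and [kX] differ. *)
Definition compare : cmd :=
  Seq (Loop kW (Pop kX (Push kK true) Skip (Push kK true))
               (Pop kX (Push kK true) (Push kK true) Skip))
    (Loop kX (Push kK true) (Push kK true)).

(** Each program replaces the tree on top of [kV] by its value. In [FPair] the second component is
    computed first: its code then lies below that of the first, and pushing a single 1 joins them to
    a node. In [FIter] the list lies on top: the bit popped by [While] tells whether there is
    another entry, and the 0 that ends the list is popped on exit. *)
Fixpoint cmd_of (f : fn) : cmd :=
  match f with
  | FId => Skip
  | FComp g h => Seq (cmd_of h) (cmd_of g)
  | FFst => Pop kV Skip (Push kV false) (Seq swap_trees drop_tree)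
  | FSnd => Pop kV Skip (Push kV false) drop_tree
  | FPair g h => Seq dup_tree (Seq (cmd_of h) (Seq swap_trees (Seq (cmd_of g) (Push kV true))))
  | FLeaf => Seq drop_tree (Push kV false)
  | FIf c g h => Seq dup_tree (Seq (cmd_of c) (Pop kV Skip (cmd_of h)
      (Seq drop_tree (Seq drop_tree (cmd_of g)))))
  | FEq => Pop kV Skip (Push kV false)
      (Seq (move_tree kW) (Seq (move_tree kX) (Seq compare
        (Pop kK (Seq (Push kV false) (Seq (Push kV false) (Push kV true)))
                (Seq (Loop kK Skip Skip) (Push kV false))
                (Seq (Loop kK Skip Skip) (Push kV false))))))
  | FIter g => Pop kV Skip (Push kV false)
      (While kV (Seq drop_tree (Seq swap_trees (Seq (cmd_of g) swap_trees))))
  end.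

Section Reach.
Variables (x : word).

Local Notation P := (fun _ : store => True).

Definition reach (c : cmd) (s : store) (n : nat) (s' : store) : Prop :=
  exists2 m, m <= n & exec x P c s m s'.

Lemma reach_leq c s m n s' : reach c s m s' -> m <= n -> reach c s n s'.
Proof. by case=> k le_k e le_n; exists k => //; apply: leq_trans le_n. Qed.

Lemma reach_skip s : reach Skip s 0 s.
Proof. by exists 0 => //; constructor. Qed.

Lemma reach_push k b s : reach (Push k b) s 2 (put k (b :: get k s) s).
Proof. by exists 2 => //; constructor. Qed.

Lemma reach_seq c1 c2 s n1 s1 n2 s2 : reach c1 s n1 s1 -> reach c2 s1 n2 s2 ->
  reach (Seq c1 c2) s (n1 + n2) s2.
Proof.
move=> [m1 le1 e1] [m2 le2 e2]; exists (m1 + m2); first exact: leq_add.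
by econstructor; eassumption.
Qed.

Lemma reach_pop k ce cf ct s n s' :
  reach (branch (ohead (get k s)) ce cf ct) (put k (behead (get k s)) s) n s' ->
  reach (Pop k ce cf ct) s (n + 2) s'.
Proof. by move=> [m le_m e]; exists (1 + m + 1); [lia | constructor]. Qed.

Lemma reach_loop_end k cf ct s : get k s = [::] -> reach (Loop k cf ct) s 1 s.
Proof. by move=> E; exists 1 => //; constructor. Qed.

Lemma reach_loop k cf ct s b w n1 s1 n2 s2 : get k s = b :: w ->
  reach (if b then ct else cf) (put k w s) n1 s1 -> reach (Loop k cf ct) s1 n2 s2 ->
  reach (Loop k cf ct) s (n1 + n2 + 2) s2.
Proof.
move=> E [m1 le1 e1] [m2 le2 e2]; exists (1 + m1 + 1 + m2); first lia.
exact: exec_loop E I e1 e2.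
Qed.

Lemma reach_while_end k c s : ohead (get k s) <> Some true ->
  reach (While k c) s 1 (put k (behead (get k s)) s).
Proof. by move=> E; exists 1 => //; apply: exec_while_end. Qed.

Lemma reach_while k c s w n1 s1 n2 s2 : get k s = true :: w ->
  reach c (put k w s) n1 s1 -> reach (While k c) s1 n2 s2 ->
  reach (While k c) s (n1 + n2 + 2) s2.
Proof.
move=> E [m1 le1 e1] [m2 le2 e2]; exists (1 + m1 + 1 + m2); first lia.
exact: exec_while E I e1 e2.
Qed.

End Reach.

Ltac straight := repeat first
  [ apply: reach_skip | apply: reach_push | apply: reach_pop; rewrite /=
  | apply: reach_seq; rewrite /= ].

Section Compilation.
Variables (x : word).

Local Notation reach := (reach x).

Lemma reach_move_all j k s : j <> k ->
  reach (move_all j k) s (4 * size (get j s)).+1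
    (put j [::] (put k (catrev (get j s) (get k s)) s)).
Proof.
move=> ne_jk; move E: (get j s) => w; elim: w s E => [|b w IH] s E.
  have -> : put j [::] (put k (catrev [::] (get k s)) s) = s.
    by rewrite /= put_get -E put_get.
  exact: reach_loop_end.
have Ej : get j (put k (b :: get k s) (put j w s)) = w.
  by case: (s); case: (j) ne_jk; case: (k).
have -> : put j [::] (put k (catrev (b :: w) (get k s)) s) =
    put j [::] (put k (catrev w (get k (put k (b :: get k s) (put j w s))))
    (put k (b :: get k s) (put j w s))).
  by case: (s); case: (j) ne_jk; case: (k).
have rp : reach (if b then Push k true else Push k false) (put j w s) 2
    (put k (b :: get k s) (put j w s)).
  have -> : get k s = get k (put j w s) by case: (s); case: (j) ne_jk; case: (k).
  by case: b {E Ej}; apply: reach_push.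
by apply: reach_leq (reach_loop E rp (IH _ Ej)) _; rewrite /=; lia.
Qed.

Lemma reach_clear k s :
  reach (Loop k Skip Skip) s (2 * size (get k s)).+1 (put k [::] s).
Proof.
move E: (get k s) => w; elim: w s E => [|b w IH] s E.
  have -> : put k [::] s = s by rewrite -E put_get.
  exact: reach_loop_end.
have Ek : get k (put k w s) = w by case: (s); case: (k).
have -> : put k [::] s = put k [::] (put k w s) by case: (s); case: (k).
have rs : reach (if b then Skip else Skip) (put k w s) 0 (put k w s).
  by case: b {E}; apply: reach_skip.
by apply: reach_leq (reach_loop E rs (IH _ Ek)) _; rewrite /=; lia.
Qed.

Variables (i : int) (o : word).

Local Notation store_at k v w y z :=
  (if k is kX then Store i o v y w z else Store i o v w y z).

Lemma reach_move_tree k a v w y : k = kW \/ k = kX ->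
  reach (move_tree k) (store_at k (code a ++ v) w y [::]) (12 * tsize a).+3
    (store_at k v (catrev (code a) w) y [::]).
Proof.
move=> Hk; rewrite /move_tree; set body := Pop _ _ _ _.
(* The statement has an arbitrary continuation of the loop, because the loop runs through the left
   subtree of a node and then goes on with the right one. *)
have loop z n s' : reach (While kK body) (store_at k v (catrev (code a) w) y z) n s' ->
    reach (While kK body) (store_at k (code a ++ v) w y (true :: z)) (12 * tsize a + n) s'.
  elim: a v w z n => [|l IHl r IHr] v w z n /=.
    move=> r0; apply: (@reach_leq _ _ _ (2 + 2 + n + 2)); last first.
      by change (tsize Leaf) with 1; lia.
    by case: Hk @body r0 => -> body r0; (apply: reach_while r0; [by [] | straight]).
  rewrite catrev_catl => /IHr/IHl r0; rewrite tsize_node -catA.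
  case: Hk @body r0 {IHl IHr} => -> body r0;
    (apply: reach_leq; [apply: reach_while r0; [by [] | straight] | lia]).
have e : reach (While kK body) (store_at k v (catrev (code a) w) y [::]) 1
    (store_at k v (catrev (code a) w) y [::]).
  by case: Hk => ->; apply: (@reach_while_end _ kK).
have {}e := loop _ _ _ e.
case: Hk e => -> e; (apply: reach_leq; [apply: reach_seq; [apply: reach_push | exact: e] | lia]).
Qed.

Local Notation S v := (Store i o v [::] [::] [::]).

Lemma reach_drop a v : reach drop_tree (S (code a ++ v)) (20 * tsize a) (S v).
Proof.
have r := @reach_move_tree kW a v [::] [::] (or_introl erefl).
apply: reach_leq (reach_seq r (reach_clear kW _)) _.
by rewrite /= size_rev -/(tsize a); have := tsize_gt0 a; lia.
Qed.

Lemma catrev_rev (w w' : word) : catrev (catrev w [::]) w' = w ++ w'.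
Proof. by rewrite -/(rev w) catrevE revK. Qed.

Lemma size_catrev0 (w : word) : size (catrev w [::]) = size w.
Proof. exact: size_rev. Qed.

Lemma reach_swap a b v : reach swap_trees (S (code a ++ code b ++ v))
  (40 * (tsize a + tsize b)) (S (code b ++ code a ++ v)).
Proof.
have r1 := @reach_move_tree kW a (code b ++ v) [::] [::] (or_introl erefl).
have r2 := @reach_move_tree kX b v [::] (catrev (code a) [::]) (or_intror erefl).
have r3 := @reach_move_all kW kV
  (Store i o v (catrev (code a) [::]) (catrev (code b) [::]) [::]) ltac:(by []).
rewrite /= size_catrev0 catrev_rev in r3.
have r4 := @reach_move_all kX kV
  (Store i o (code a ++ v) [::] (catrev (code b) [::]) [::]) ltac:(by []).
rewrite /= size_catrev0 catrev_rev in r4.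
apply: reach_leq (reach_seq r1 (reach_seq r2 (reach_seq r3 r4))) _.
rewrite -/(tsize a) -/(tsize b).
by have := tsize_gt0 a; have := tsize_gt0 b; lia.
Qed.

Lemma reach_dup a v : reach dup_tree (S (code a ++ v)) (40 * tsize a)
  (S (code a ++ code a ++ v)).
Proof.
have r1 := @reach_move_tree kW a v [::] [::] (or_introl erefl).
set c2 := Loop kW (Seq (Push kV false) (Push kX false)) (Seq (Push kV true) (Push kX true)).
have r2 w v' y : reach c2 (Store i o v' w y [::]) (6 * size w + 1)
    (Store i o (catrev w v') [::] (catrev w y) [::]).
  elim: w v' y => [|b w IH] v' y; first exact: reach_loop_end.
  have r0 := IH (b :: v') (b :: y).
  apply: reach_leq; first apply: (@reach_loop _ kW _ _ _ _ _ 4) r0 => //.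
    by case: b; (apply: reach_leq; [straight|]).
  by rewrite /=; lia.
have {}r2 := r2 (catrev (code a) [::]) v [::].
rewrite !catrev_rev size_catrev0 cats0 in r2.
have r3 := @reach_move_all kX kW (Store i o (code a ++ v) [::] (code a) [::]) ltac:(by []).
have r4 := @reach_move_all kW kV
  (Store i o (code a ++ v) (catrev (code a) [::]) [::] [::]) ltac:(by []).
rewrite /= size_catrev0 catrev_rev in r4.
apply: reach_leq (reach_seq r1 (reach_seq r2 (reach_seq r3 r4))) _.
by rewrite /= -/(tsize a); have := tsize_gt0 a; lia.
Qed.

Lemma reach_compare w y v : exists z,
  reach compare (Store i o v w y [::]) (6 * (size w + size y) + 2)
    (Store i o v [::] [::] z) /\
  [/\ size z <= size w + size y & (z == [::]) = (w == y)].
Proof.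
have loop2 y' z : exists z', reach (Loop kX (Push kK true) (Push kK true))
     (Store i o v [::] y' z) (4 * size y' + 1) (Store i o v [::] [::] z') /\
    size z' = size y' + size z.
  elim: y' z => [|b y' IH] z; first by exists z; split=> //; apply: reach_loop_end.
  have [z' [r0 Ez]] := IH (true :: z); exists z'; split; last by rewrite Ez /=; lia.
  apply: reach_leq; first apply: (@reach_loop _ kX _ _ _ _ _ 2) r0 => //.
    by case: b; straight.
  by rewrite /=; lia.
rewrite /compare; set c1 := Loop kW _ _.
(* Letters of [y] that remain are counted like marks already made, as the second loop will turn them
   into marks; the words are equal iff there are none of either. *)
have loop1 z : exists z' y', [/\ reach c1 (Store i o v w y z) (6 * size w + 1)
        (Store i o v [::] y' z'), size y' <= size y, size z <= size z' <= size z + size w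
      & (size y' + size z' == size z) = (w == y)].
  elim: w y z => [|b w IH] y z.
    exists z, y; split=> //; first exact: reach_loop_end.
      by rewrite addn0 leqnn.
    by case: (y) => [|c y'] /=; rewrite ?eqxx //; apply/negbTE/eqP; lia.
  have glue y1 z1 y2 z2 : reach c1 (Store i o v w y1 z1) (6 * size w + 1)
        (Store i o v [::] y2 z2) ->
      reach (if b then Pop kX (Push kK true) (Push kK true) Skip
        else Pop kX (Push kK true) Skip (Push kK true)) (Store i o v w y z) 4
        (Store i o v w y1 z1) ->
      reach c1 (Store i o v (b :: w) y z) (6 * size (b :: w) + 1) (Store i o v [::] y2 z2).
    move=> r2 r1; apply: reach_leq (@reach_loop _ kW _ _ (Store i o v (b :: w) y z) _ _ _ _ _ _ erefl r1 r2) _.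
    by rewrite /=; lia.
  case: y glue => [|b' y] glue.
    have [z' [y' [r2 /= ly lz Ez]]] := IH [::] (true :: z).
    exists z', y'; split=> //=; [|lia|by apply/negbTE/eqP; lia].
    by apply: glue r2 _; case: b; (apply: reach_leq; [straight|]).
  have [Eb|ne_b] := eqVneq b b'.
    have [z' [y' [r2 /= ly lz Ez]]] := IH y z.
    exists z', y'; split=> //=; [|lia|lia|by rewrite Ez eqseq_cons Eb eqxx].
    by apply: glue r2 _; rewrite -Eb; case: b {Eb}; (apply: reach_leq; [straight|]).
  have [z' [y' [r2 /= ly lz Ez]]] := IH y (true :: z).
  exists z', y'; split=> //=; [|lia|lia|rewrite eqseq_cons (negbTE ne_b); apply/negbTE/eqP; lia].
  by apply: glue r2 _; case: b b' ne_b => [] [] // _; (apply: reach_leq; [straight|]).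
have [z1 [y1 [r1 l1 l2 E1]]] := loop1 [::].
have [z2 [r2 E2]] := loop2 y1 z1.
exists z2; split; last first.
  by split; [rewrite /= in l2; lia | rewrite -E1 -size_eq0 E2].
by apply: reach_leq (reach_seq r1 r2) _; lia.
Qed.

Lemma reach_cmd_of f a v :
  reach (cmd_of f) (S (code a ++ v)) (cost f a) (S (code (eval f a) ++ v)).
Proof.
elim: f a v => [|g IHg h IHh||| g IHg h IHh||c IHc g IHg h IHh||g IHg] a v /=.
- exact: reach_skip.
- exact: reach_seq (IHh _ _) (IHg _ _).
- case: a => [|l r] /=.
    by apply: reach_leq; [apply: reach_pop; straight | change (tsize Leaf) with 1].
  rewrite -catA; apply: reach_leq; first apply: reach_pop.
    exact: reach_seq (reach_swap l r v) (reach_drop r (code l ++ v)).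
  by rewrite tsize_node; have := tsize_gt0 l; lia.
- case: a => [|l r] /=.
    by apply: reach_leq; [apply: reach_pop; straight | change (tsize Leaf) with 1].
  rewrite -catA; apply: reach_leq; first apply: reach_pop.
    exact: (reach_drop l (code r ++ v)).
  by rewrite tsize_node; have := tsize_gt0 l; lia.
- have r1 := reach_dup a v.
  have r2 := IHh a (code a ++ v).
  have r3 := reach_swap (eval h a) a v.
  have r4 := IHg a (code (eval h a) ++ v).
  have r5 := reach_push x kV true (S (code (eval g a) ++ code (eval h a) ++ v)).
  rewrite -catA; apply: reach_leq (reach_seq r1 (reach_seq r2 (reach_seq r3 (reach_seq r4 r5)))) _.
  by have := tsize_gt0 a; have := tsize_gt0 (eval h a); lia.
- apply: reach_leq (reach_seq (reach_drop a v) (reach_push x kV false (S v))) _.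
  by have := tsize_gt0 a; lia.
- have r1 := reach_dup a v; have r2 := IHc a (code a ++ v).
  case E: (eval c a) r2 => [|l r] /= r2.
    apply: reach_leq.
      apply: reach_seq r1 (reach_seq r2 _).
      by apply: reach_pop; apply: IHh.
    by have := tsize_gt0 a; lia.
  apply: reach_leq.
    apply: reach_seq r1 (reach_seq r2 _).
    apply: reach_pop; rewrite /= -catA; apply: reach_seq (reach_drop _ _) _.
    apply: reach_seq (reach_drop _ _) _; exact: IHg.
  by rewrite tsize_node; have := tsize_gt0 a; lia.
- case: a => [|l r] /=.
    by apply: reach_leq; [apply: reach_pop; straight | change (tsize Leaf) with 1].
  have r1 := @reach_move_tree kW l (code r ++ v) [::] [::] (or_introl erefl).
  have r2 := @reach_move_tree kX r v [::] (catrev (code l) [::]) (or_intror erefl).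
  have [z [r3 [lz Ez]]] := reach_compare (catrev (code l) [::]) (catrev (code r) [::]) v.
  rewrite !size_catrev0 -!/(tsize _) in r3 lz.
  (* The codes were compared in reversed form, which is harmless since reversal is injective. *)
  have {}Ez : (z == [::]) = (l == r).
    by rewrite Ez -code_eq; exact: (inj_eq (can_inj revK)).
  have le1 := tsize_gt0 l.
  rewrite -catA; apply: (@reach_leq _ _ _ ((12 * tsize l).+3 + ((12 * tsize r).+3 +
     (6 * (tsize l + tsize r) + 2 + (2 * (tsize l + tsize r) + 10 + 2))) + 2)); last first.
    by rewrite tsize_node; lia.
  apply: reach_pop; apply: reach_seq r1 _; apply: reach_seq r2 _.
  apply: reach_seq r3 _; apply: reach_pop; rewrite -Ez.
  case: z {Ez} lz => [|b z] lz /=.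
    by apply: reach_leq; [straight | lia].
  by case: b lz => lz; (apply: reach_leq; first apply: reach_seq (reach_clear kK _) (reach_push x _ _ _));
    rewrite /= in lz *; lia.
- case: a => [|l r] /=.
    by apply: reach_leq; [apply: reach_pop; straight | change (tsize Leaf) with 1].
  rewrite -catA; set body := Seq drop_tree _.
  have loop : reach (While kV body) (S (code l ++ code r ++ v))
     (\sum_(i < spine l) (cost g (iter i (eval g) r) +
        200 * (tsize l + tsize (iter i (eval g) r) + tsize (iter i.+1 (eval g) r))) + 1)
     (S (code (iter (spine l) (eval g) r) ++ v)).
    elim: l r => [|h _ l IHl] r /=.
      by rewrite big_ord0; apply: (@reach_while_end _ kV).
    rewrite -iterS iterSr big_ord_recl.
    have r1 := reach_drop h (code l ++ code r ++ v).
    have r2 := reach_swap l r v.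
    have r3 := IHg r (code l ++ v).
    have r4 := reach_swap (eval g r) l v.
    have rb := reach_seq r1 (reach_seq r2 (reach_seq r3 r4)).
    have r5 := IHl (eval g r).
    have E : get kV (S ((true :: code h ++ code l) ++ code r ++ v)) =
       true :: code h ++ code l ++ code r ++ v by rewrite /= -catA.
    apply: reach_leq (reach_while E rb r5) _.
    have le_sum : \sum_(j < spine l) (cost g (iter j (eval g) (eval g r)) + 200 * (tsize l +
        tsize (iter j (eval g) (eval g r)) + tsize (iter j.+1 (eval g) (eval g r)))) <=
      \sum_(j < spine l) (cost g (iter (bump 0 j) (eval g) r) + 200 * (tsize (Node h l) +
        tsize (iter (bump 0 j) (eval g) r) + tsize (iter (bump 0 j).+1 (eval g) r))).
      apply: leq_sum => j _; have -> : bump 0 j = j.+1 by [].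
      by rewrite -!iterSr tsize_node; lia.
    by rewrite /= !tsize_node in le_sum *; have := tsize_gt0 l; lia.
  apply: reach_leq; first by apply: reach_pop; exact: loop.
  by rewrite tsize_node /=; have := tsize_gt0 l; lia.
Qed.

End Compilation.

(** * Polynomial-time functions on encoded data *)

Class Enc (A : Type) := enc : A -> tree.
Arguments enc {A _} a.

Definition esize {A} {EA : Enc A} (a : A) : nat := tsize (enc a).

Instance Enc_tree : Enc tree := id.
Instance Enc_bool : Enc bool := tbool.
(** Unary, so that a number is a list that [FIter] can use as a clock. Head positions are of type
    [int] and get a binary encoding. *)
Instance Enc_nat : Enc nat := fun n => iter n (Node Leaf) Leaf.
Instance Enc_pair A B {EA : Enc A} {EB : Enc B} : Enc (A * B) :=
  fun p => Node (enc p.1) (enc p.2).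
Instance Enc_seq A {EA : Enc A} : Enc (seq A) := foldr (fun a => Node (enc a)) Leaf.

Lemma leq_exp2 m n e : m <= n -> m ^ e <= n ^ e.
Proof. by case: e => // e; rewrite leq_exp2r. Qed.

(** * Polynomial bounds in the size of the encoding *)

Section PolyBounds.
Context {A : Type} {EA : Enc A}.

(** The base is at least 2, so the exponent alone absorbs constants and sums, and no coefficients
    have to be carried along. *)
Definition pbounded (g : A -> nat) : Prop := exists c, forall a, g a <= (esize a).+2 ^ c.

Lemma pbounded_leq g h : (forall a, g a <= h a) -> pbounded h -> pbounded g.
Proof. by move=> le [c lec]; exists c => a; apply: leq_trans (lec a). Qed.

Lemma pbounded_const k : pbounded (fun _ => k).
Proof.
exists k => a; apply: leq_trans (ltnW (ltn_expl k (isT : 1 < 2))) _.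
exact: leq_exp2.
Qed.

Lemma pbounded_mul g h : pbounded g -> pbounded h -> pbounded (fun a => g a * h a).
Proof. by move=> [c lec] [d led]; exists (c + d) => a; rewrite expnD leq_mul. Qed.

Lemma pbounded_add g h : pbounded g -> pbounded h -> pbounded (fun a => g a + h a).
Proof.
move=> [c lec] [d led]; exists (c + d).+1 => a.
apply: (@leq_trans (2 * (esize a).+2 ^ (c + d))); last by rewrite expnS leq_mul.
rewrite mul2n -addnn leq_add //.
  by apply: leq_trans (lec a) _; rewrite leq_exp2l ?leq_addr.
by apply: leq_trans (led a) _; rewrite leq_exp2l ?leq_addl.
Qed.

Lemma pbounded_exp g k : pbounded g -> pbounded (fun a => g a ^ k).
Proof. by move=> [c lec]; exists (c * k) => a; rewrite expnM leq_exp2. Qed.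

Lemma pbounded_esize : pbounded esize.
Proof. by exists 1 => a; rewrite expn1; lia. Qed.

Lemma pbounded_sum (n : A -> nat) (F : A -> nat -> nat) q : pbounded n -> pbounded q ->
  (forall a i, i < n a -> F a i <= q a) -> pbounded (fun a => \sum_(i < n a) F a i).
Proof.
move=> pn pq le_F; apply: pbounded_leq (pbounded_mul pn pq) => a.
rewrite -[leqRHS]/(n a * q a) -[X in X * _]card_ord -sum_nat_const.
by apply: leq_sum => i _; apply: le_F.
Qed.

End PolyBounds.

Lemma pbounded_comp A B {EA : Enc A} {EB : Enc B} (f : A -> B) (g : B -> nat) :
  pbounded (fun a => esize (f a)) -> pbounded g -> pbounded (fun a => g (f a)).
Proof.
move=> pf [c lec]; apply: (@pbounded_leq _ _ _ (fun a => (esize (f a) + 2) ^ c)).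
  by move=> a; rewrite addn2.
by apply: pbounded_exp; apply: pbounded_add pf (pbounded_const 2).
Qed.

Ltac pbound := lazymatch goal with
  | |- pbounded (fun _ => ?k) => exact: pbounded_const
  | |- pbounded (fun a => @?g a + @?h a) => apply: (@pbounded_add _ _ g h); pbound
  | |- pbounded (fun a => @?g a * @?h a) => apply: (@pbounded_mul _ _ g h); pbound
  | |- pbounded (fun a => @?g a ^ ?k) => apply: (@pbounded_exp _ _ g k); pbound
  | |- _ => first [assumption | exact: pbounded_esize]
  end.

(** * Polynomial-time functions and their closure properties *)

Definition FP A B {EA : Enc A} {EB : Enc B} (f : A -> B) : Prop :=
  exists2 p : fn, (forall a, eval p (enc a) = enc (f a)) &
    pbounded (fun a : A => cost p (enc a)).

Lemma FP_esize A B {EA : Enc A} {EB : Enc B} (f : A -> B) :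
  FP f -> pbounded (fun a => esize (f a)).
Proof.
move=> [p Ep cp]; apply: (@pbounded_leq _ _ _ (fun a => esize a + cost p (enc a))).
  by move=> a; rewrite /esize -Ep leq_tsize_eval.
by pbound.
Qed.

Section Basics.
Context {A B C : Type} {EA : Enc A} {EB : Enc B} {EC : Enc C}.

Lemma FP_ext (f g : A -> B) : (forall a, f a = g a) -> FP f -> FP g.
Proof. by move=> Efg [p Ep cp]; exists p => // a; rewrite Ep Efg. Qed.

Lemma FP_id : FP (fun a : A => a).
Proof. by exists FId => //; apply: pbounded_const. Qed.

Lemma FP_comp (g : B -> C) (f : A -> B) : FP g -> FP f -> FP (fun a => g (f a)).
Proof.
move=> [q Eq cq] Pf; have pf := FP_esize Pf; case: Pf => p Ep cp.
exists (FComp q p) => [a|] /=; first by rewrite Ep Eq.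
apply: pbounded_add => //; apply: (@pbounded_leq _ _ _ (fun a => cost q (enc (f a)))).
  by move=> a; rewrite Ep.
exact: (pbounded_comp pf cq).
Qed.

Lemma FP_pair (f : A -> B) (g : A -> C) : FP f -> FP g -> FP (fun a => (f a, g a)).
Proof.
move=> Pf Pg; have pf := FP_esize Pf; have pg := FP_esize Pg.
case: Pf Pg => p Ep cp [q Eq cq].
exists (FPair p q) => [a|] /=; first by rewrite Ep Eq.
apply: (@pbounded_leq _ _ _ (fun a => cost p (enc a) + cost q (enc a) +
  400 * (esize a + esize (f a) + esize (g a)))).
  by move=> a; rewrite Ep Eq.
by pbound.
Qed.

End Basics.

Section Operations.
Context {A B C : Type} {EA : Enc A} {EB : Enc B} {EC : Enc C}.

Lemma FP_fst (f : A -> B * C) : FP f -> FP (fun a => (f a).1).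
Proof.
move=> Pf; apply: FP_comp Pf; exists FFst => //=.
exact: pbounded_mul (pbounded_const _) pbounded_esize.
Qed.

Lemma FP_snd (f : A -> B * C) : FP f -> FP (fun a => (f a).2).
Proof.
move=> Pf; apply: FP_comp Pf; exists FSnd => //=.
exact: pbounded_mul (pbounded_const _) pbounded_esize.
Qed.

Lemma FP_const (b : B) : FP (fun _ : A => b).
Proof.
rewrite /FP; elim: (enc b) => [|l [p Ep cp] r [q Eq cq]].
  by exists FLeaf => //=; exact: pbounded_mul (pbounded_const _) pbounded_esize.
exists (FPair p q) => [a|] /=; first by rewrite Ep Eq.
apply: (@pbounded_leq _ _ _ (fun a => cost p (enc a) + cost q (enc a) +
  400 * (esize a + tsize l + tsize r))); first by move=> a; rewrite Ep Eq.
by pbound.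
Qed.

(* Any type whose encoding is a leaf or a node serves as the condition. *)
Lemma FP_branch (c : A -> B) (f g : A -> C) : FP c -> FP f -> FP g ->
  FP (fun a => if enc (c a) is Node _ _ then f a else g a).
Proof.
move=> Pc; have pc := FP_esize Pc; case: Pc => r Er cr [p Ep cp] [q Eq cq].
exists (FIf r p q) => [a|] /=; first by rewrite Er; case: (enc (c a)).
apply: (@pbounded_leq _ _ _ (fun a => 200 * (esize a + esize (c a)) + cost r (enc a) +
  (cost p (enc a) + cost q (enc a)))).
  by move=> a; rewrite Er /esize; case: (enc (c a)) => *; lia.
by pbound.
Qed.

Lemma FP_eq (f g : A -> B) (e : B -> B -> bool) : injective (@enc B EB) ->
  (forall b b', reflect (b = b') (e b b')) -> FP f -> FP g -> FP (fun a => e (f a) (g a)).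
Proof.
move=> inj eP Pf Pg; have Pp := FP_pair Pf Pg.
have Pe : FP (fun p : B * B => e p.1 p.2); last first.
  by apply: FP_ext (FP_comp Pe Pp).
exists FEq; last exact: pbounded_mul (pbounded_const _) pbounded_esize.
move=> [b b'] /=; congr tbool; apply/eqP/eP => [/inj //|-> //].
Qed.

(** A round is polynomial in its current state, but growth could compound from round to round. The
    bound [q] on all intermediate states excludes this and makes every round polynomial in [a]. *)
Lemma FP_iter_tree (n : A -> C) (f : A * B -> B) (z : A -> B) q : FP n -> FP f -> FP z ->
  pbounded q ->
  (forall a i, i <= spine (enc (n a)) -> esize (iter i (fun b => f (a, b)) (z a)) <= q a) ->
  FP (fun a => iter (spine (enc (n a))) (fun b => f (a, b)) (z a)).
Proof.
move=> Pn Pf Pz pq le_q; have pn := FP_esize Pn; have pz := FP_esize Pz.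
case: Pn Pf Pz => p Ep cp [r Er cr] [s Es cs].
(* [FIter] iterates a function of the state alone, so the parameter [a] is made a part of the
   state. *)
pose step := FPair FFst r.
have Estep a i : iter i (eval step) (Node (enc a) (enc (z a))) =
    enc (a, iter i (fun b => f (a, b)) (z a)).
  have E1 b : eval step (enc (a, b)) = enc (a, f (a, b)).
    by rewrite /step /= Er.
  by elim: i => //= i ->; exact: E1.
exists (FComp FSnd (FComp (FIter step) (FPair p (FPair FId s)))) => [a|].
  by rewrite /= Ep Es Estep.
pose st a i := (a, iter i (fun b => f (a, b)) (z a)).
pose eA := @esize A EA; pose eC := @esize C EC; pose eS := @esize (A * B) (@Enc_pair A B EA EB).
pose eB := @esize B EB; pose eP := @enc (A * B) (@Enc_pair A B EA EB).
pose G a i := 200 * eS (st a i) + cost r (eP (st a i)) +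
   400 * (eS (st a i) + eA a + eB (st a i.+1).2)
  + 200 * (eC (n a) + eS (st a i) + eS (st a i.+1)).
have [c lec] := cr.
(* This is [G a i] with the size of the pair of parameter and state replaced by its bound
   [eA a + q a + 1]; it no longer depends on [i]. *)
pose Q a := 200 * (eA a + q a + 1) + ((eA a + q a + 1) + 2) ^ c +
  400 * ((eA a + q a + 1) + eA a + q a)
  + 200 * (eC (n a) + (eA a + q a + 1) + (eA a + q a + 1)).
have pA : pbounded eA by apply: pbounded_esize.
have pQ : pbounded Q by rewrite /Q; pbound.
have le_st a i : i <= spine (enc (n a)) -> eS (st a i) <= eA a + q a + 1.
  by move=> /le_q; rewrite /eS /eA /st /esize [enc (_, _)]/enc /Enc_pair tsize_node /=; lia.
have psum : pbounded (fun a => \sum_(i < spine (enc (n a))) G a i).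
  apply: pbounded_sum pQ _.
    apply: pbounded_leq pn => a; rewrite /esize; elim: (enc (n a)) => //= l _ t IH.
    by rewrite tsize_node; lia.
  move=> a i lt_i; have l1 := le_st a i (ltnW lt_i); have l2 := le_st a i.+1 lt_i.
  have l3 : cost r (eP (st a i)) <= ((eA a + q a + 1) + 2) ^ c.
    by apply: leq_trans (lec _) _; apply: leq_exp2; rewrite -/(eS (st a i)); lia.
  have l4 : eB (st a i.+1).2 <= q a by apply: le_q.
  rewrite /G /Q; lia.
apply: (@pbounded_leq _ _ _ (fun a => cost p (enc a) + (cost s (enc a) +
   400 * (eA a + eA a + eB (z a))) +
   400 * (eA a + eC (n a) + (eA a + eB (z a) + 1)) +
   (200 * (eC (n a) + (eA a + eB (z a) + 1) + 1) +
    \sum_(i < spine (enc (n a))) G a i) + 200 * (eA a + q a + 1))); last by pbound.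
move=> a.
have -> : cost (FComp FSnd (FComp (FIter step) (FPair p (FPair FId s)))) (enc a) =
   cost p (enc a) + (0 + cost s (enc a) + 400 * (eA a + eA a + eB (z a))) +
   400 * (eA a + eC (n a) + tsize (Node (enc a) (enc (z a)))) +
   (200 * tsize (Node (enc (n a)) (Node (enc a) (enc (z a)))) +
    \sum_(i < spine (enc (n a))) (cost step (iter i (eval step) (Node (enc a) (enc (z a)))) +
        200 * (tsize (enc (n a)) + tsize (iter i (eval step) (Node (enc a) (enc (z a))))
         + tsize (iter i.+1 (eval step) (Node (enc a) (enc (z a))))))) +
    200 * tsize (enc (a, iter (spine (enc (n a))) (fun b => f (a, b)) (z a))).
  by rewrite /= Ep Es Estep.
rewrite !tsize_node -!/(esize _) -/(eA a) -/(eB (z a)) -/(eC (n a)).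
have le_sum : \sum_(i < spine (enc (n a))) (cost step (iter i (eval step) (Node (enc a) (enc (z a)))) +
        200 * (eC (n a) + tsize (iter i (eval step) (Node (enc a) (enc (z a))))
         + tsize (iter i.+1 (eval step) (Node (enc a) (enc (z a)))))) <=
    \sum_(i < spine (enc (n a))) G a i.
  apply: leq_sum => i _; rewrite !Estep.
  have -> : cost step (enc (a, iter i (fun b => f (a, b)) (z a))) =
     200 * eS (st a i) + cost r (eP (st a i)) +
     400 * (eS (st a i) + eA a + tsize (eval r (eP (st a i)))) by [].
  by rewrite Er.
have := le_q a _ (leqnn _); rewrite [(_, _).2]/=; lia.
Qed.

End Operations.

Lemma esize_pair A B {EA : Enc A} {EB : Enc B} (p : A * B) :
  esize p = (esize p.1 + esize p.2).+1.
Proof. by rewrite /esize {1}/enc /Enc_pair tsize_node. Qed.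

Lemma esize_cons A {EA : Enc A} (a : A) s : esize (a :: s) = (esize a + esize s).+1.
Proof. by rewrite /esize {1}/enc /Enc_seq /= tsize_node. Qed.

Lemma esize_nil A {EA : Enc A} : esize ([::] : seq A) = 1.
Proof. by []. Qed.

Lemma esize_nat (n : nat) : esize n = n.*2.+1.
Proof. by elim: n => // n; rewrite /esize {2}/enc /= tsize_node => ->. Qed.

Lemma esize_bool (b : bool) : 0 < esize b <= 3.
Proof. by case: b. Qed.

Lemma esize_gt0 A {EA : Enc A} (a : A) : 0 < esize a.
Proof. exact: tsize_gt0. Qed.

Lemma leq_size_esize A {EA : Enc A} (s : seq A) : size s < esize s.
Proof. by elim: s => // a s IH; rewrite esize_cons /=; lia. Qed.

Lemma esize_cat A {EA : Enc A} (s t : seq A) : (esize (s ++ t)).+1 = esize s + esize t.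
Proof. by elim: s => //= a s IH; rewrite !esize_cons; lia. Qed.

Lemma spine_nat (n : nat) : spine (enc n) = n.
Proof. by elim: n => //= n ->. Qed.

Lemma spine_seq A {EA : Enc A} (s : seq A) : spine (enc s) = size s.
Proof. by elim: s => //= a s ->. Qed.

(** * Case distinction, iteration and folds *)

Section Case.
Context {A B C : Type} {EA : Enc A} {EB : Enc B} {EC : Enc C}.

Lemma FP_if (c : A -> bool) (f g : A -> B) : FP c -> FP f -> FP g ->
  FP (fun a => if c a then f a else g a).
Proof.
by move=> Pc Pf Pg; apply: FP_ext (FP_branch Pc Pf Pg) => a; case: (c a).
Qed.

(** A nonempty list has the same encoding as the pair of its head and its tail, so [h] can be given
    the list itself. *)
Lemma FP_list_case (s : A -> seq B) (g : A -> C) (h : A * (B * seq B) -> C) :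
  FP s -> FP g -> FP h -> FP (fun a => if s a is b :: t then h (a, (b, t)) else g a).
Proof.
move=> Ps; have ps := FP_esize Ps; case: Ps => p Ep cp [q Eq cq] [r Er [c lec]].
exists (FIf p (FComp r (FPair FId p)) q) => [a|] /=.
  by rewrite Ep; case: (s a) => [|b t] /=; rewrite ?Eq // -Er.
apply: (@pbounded_leq _ _ _ (fun a => 200 * (esize a + esize (s a)) + cost p (enc a) +
  (cost p (enc a) + 400 * (esize a + esize a + esize (s a)) +
  (esize a + esize (s a) + 3) ^ c + cost q (enc a)))); last by pbound.
move=> a; rewrite Ep -!/(esize _); case E: (s a) => [|b t] /=; first lia.
have := lec (a, (b, t)); rewrite -addn2.
have -> : esize (a, (b, t)) + 2 = esize a + esize (b :: t) + 3.
  by rewrite !esize_pair esize_cons /=; lia.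
rewrite -!/(esize _); have -> : Node (enc a) (enc (b :: t)) = enc (a, (b, t)) by [].
lia.
Qed.
End Case.

Lemma esize_take A {EA : Enc A} i (s : seq A) : esize (take i s) <= esize s.
Proof.
have := @esize_cat A EA (take i s) (drop i s).
by have := @esize_gt0 _ (@Enc_seq A EA) (drop i s); rewrite cat_take_drop; lia.
Qed.

Lemma esize_drop A {EA : Enc A} i (s : seq A) : esize (drop i s) <= esize s.
Proof.
have := @esize_cat A EA (take i s) (drop i s).
by have := @esize_gt0 _ (@Enc_seq A EA) (take i s); rewrite cat_take_drop; lia.
Qed.

Section Iteration.
Context {A B : Type} {EA : Enc A} {EB : Enc B}.

Lemma FP_iter (n : A -> nat) (f : A * B -> B) (z : A -> B) q : FP n -> FP f -> FP z ->
  pbounded q ->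
  (forall a i, i <= n a -> esize (iter i (fun b => f (a, b)) (z a)) <= q a) ->
  FP (fun a => iter (n a) (fun b => f (a, b)) (z a)).
Proof.
move=> Pn Pf Pz pq le_q; apply: FP_ext (FP_iter_tree Pn Pf Pz pq _) => a; rewrite spine_nat //.
exact: le_q.
Qed.

Lemma pbounded_nat (n : A -> nat) : FP n -> pbounded n.
Proof.
by move=> /FP_esize; apply: pbounded_leq => a; rewrite esize_nat; lia.
Qed.

(** If growth is additive, with a summand that depends on the parameter only, then after [n a]
    rounds the state is still polynomial. *)
Lemma FP_iter_add (n : A -> nat) (f : A * B -> B) (z : A -> B) q : FP n -> FP f -> FP z ->
  pbounded q -> (forall a b, esize (f (a, b)) <= esize b + q a) ->
  FP (fun a => iter (n a) (fun b => f (a, b)) (z a)).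
Proof.
move=> Pn Pf Pz pq le_q; have pz := FP_esize Pz; have pn := pbounded_nat Pn.
apply: (FP_iter Pn Pf Pz (q := fun a => esize (z a) + n a * q a)) => [|a i].
  by pbound.
have le : esize (iter i (fun b => f (a, b)) (z a)) <= esize (z a) + i * q a; last first.
  by move=> le_i; have := leq_mul le_i (leqnn (q a)); lia.
elim: i => [|i IH]; first by rewrite addn0.
by rewrite iterS mulSn; have := le_q a (iter i (fun b => f (a, b)) (z a)); lia.
Qed.

Context {E : Type} {EE : Enc E}.

Lemma FP_behead (s : A -> seq E) : FP s -> FP (fun a => behead (s a)).
Proof.
move=> Ps; apply: (@FP_comp _ _ _ _ _ _ behead) Ps; exists FSnd => [[] //|].
exact: pbounded_mul (pbounded_const _) pbounded_esize.
Qed.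

Lemma FP_cons (f : A -> E) (s : A -> seq E) : FP f -> FP s -> FP (fun a => f a :: s a).
Proof.
move=> Pf Ps; have Pp := FP_pair Pf Ps.
apply: FP_ext (@FP_comp _ _ _ _ _ _ (fun p : E * seq E => p.1 :: p.2) _ _ Pp) => //.
by exists FId; [case | apply: pbounded_const].
Qed.

Lemma FP_head d (s : A -> seq E) : FP s -> FP (fun a => seq.head d (s a)).
Proof.
move=> Ps; apply: FP_ext (FP_list_case Ps (FP_const d) (FP_fst (FP_snd FP_id))) => a.
by case: (s a).
Qed.

Lemma FP_nilp (s : A -> seq E) : FP s -> FP (fun a => nilp (s a)).
Proof.
move=> Ps; apply: FP_ext (FP_list_case Ps (FP_const true) (FP_const false)) => a.
by case: (s a).
Qed.

Lemma FP_foldl (s : A -> seq E) (f : A * (B * E) -> B) (z : A -> B) q :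
  FP s -> FP f -> FP z -> pbounded q ->
  (forall a i, esize (foldl (fun b e => f (a, (b, e))) (z a) (take i (s a))) <= q a) ->
  FP (fun a => foldl (fun b e => f (a, (b, e))) (z a) (s a)).
Proof.
move=> Ps Pf Pz pq le_q; have ps := FP_esize Ps.
(* The state consists of the accumulator and the entries still to be read; the list itself serves as
   the clock. *)
pose g (p : A * (B * seq E)) :=
  if p.2.2 is e :: t then (f (p.1, (p.2.1, e)), t) else p.2.
have Pg : FP g.
  apply: FP_ext (FP_list_case (s := fun p => p.2.2) (g := snd)
    (h := fun p : (A * (B * seq E)) * (E * seq E) =>
       (f (p.1.1, (p.1.2.1, p.2.1)), p.2.2)) _ _ _) => [p|||].
  - by rewrite /g; case: p.2.2.
  - exact: FP_snd (FP_snd FP_id).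
  - exact: FP_snd FP_id.
  - apply: FP_pair; last exact: FP_snd (FP_snd FP_id).
    apply: FP_comp Pf _; apply: FP_pair; first exact: FP_fst (FP_fst FP_id).
    apply: FP_pair; first exact: FP_fst (FP_snd (FP_fst FP_id)).
    exact: FP_fst (FP_snd FP_id).
have Eg a i : iter i (fun b => g (a, b)) (z a, s a) =
    (foldl (fun b e => f (a, (b, e))) (z a) (take i (s a)), drop i (s a)).
  elim: i => [|i IH]; first by rewrite /= take0 drop0.
  rewrite iterS IH /g /=; case E1: (drop i (s a)) => [|e t].
    have le_i : size (s a) <= i by rewrite -subn_eq0 -size_drop E1.
    by rewrite !take_oversize ?drop_oversize // ltnW.
  have lt_i : i < size (s a) by rewrite -subn_gt0 -size_drop E1.
  rewrite (take_nth e) // foldl_rcons; congr (f (a, (_, _)), _).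
    by rewrite -[i in RHS]addn0 -nth_drop E1.
  by rewrite -[i.+1]add1n -drop_drop E1 /= ?drop0.
have P2 := FP_iter_tree Ps Pg (FP_pair Pz Ps) 
  (q := fun a => q a + @esize _ (@Enc_seq E EE) (s a) + 1).
apply: FP_ext (FP_fst (P2 _ _)); [by move=> a; rewrite spine_seq Eg take_size|by pbound|].
move=> a i le_i.
by rewrite Eg esize_pair /= addn1 ltnS leq_add ?le_q ?esize_drop.
Qed.

(** Besides [q a], a round may add the size of the entry that it consumes: these sizes sum up to at
    most the size of the list. *)
Lemma FP_foldl_add (s : A -> seq E) (f : A * (B * E) -> B) (z : A -> B) q :
  FP s -> FP f -> FP z -> pbounded q ->
  (forall a b e, esize (f (a, (b, e))) <= esize b + esize e + q a) ->
  FP (fun a => foldl (fun b e => f (a, (b, e))) (z a) (s a)).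
Proof.
move=> Ps Pf Pz pq le_q; have ps := FP_esize Ps; have pz := FP_esize Pz.
apply: (FP_foldl Ps Pf Pz (q := fun a => esize (z a) + esize (s a) * (q a + 1))) => [|a i].
  by pbound.
have le t b : esize (foldl (fun b e => f (a, (b, e))) b t) <= esize b + esize t * (q a + 1); last first.
  have le_t : esize (take i (s a)) <= esize (s a) by exact: esize_take.
  by have := leq_mul le_t (leqnn (q a + 1)); have := le (take i (s a)) (z a); lia.
elim: t b => [|e t IH] b; first by rewrite esize_nil /=; lia.
rewrite /= esize_cons; have := IH (f (a, (b, e))); have := le_q a b e.
by have := @esize_gt0 E EE e; rewrite -addSn mulnDl; nia.
Qed.
End Iteration.

(** Programs see encodings only, so a program may be reused at another type. For example, [n.+1] is
    encoded like the pair [(Leaf, n)]. *)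
Lemma FP_recode A B C {EA : Enc A} {EB : Enc B} {EC : Enc C} (f : A -> B) (g : A -> C) :
  (forall a, enc (f a) = enc (g a)) -> FP f -> FP g.
Proof. by move=> E [p Ep cp]; exists p => // a; rewrite Ep. Qed.

Ltac fp := lazymatch goal with
  | |- FP (fun _ => ?k) => exact: FP_const
  | |- FP (fun a => a) => exact: FP_id
  | |- FP (@fst _ _) => exact: FP_fst FP_id
  | |- FP (@snd _ _) => exact: FP_snd FP_id
  | |- FP (fun a => (@?f a).1) => apply: (FP_fst (f := f)); fp
  | |- FP (fun a => (@?f a).2) => apply: (FP_snd (f := f)); fp
  | |- FP (fun a => (@?f a, @?g a)) => apply: (FP_pair (f := f) (g := g)); fp
  | |- FP (fun a => @?f a :: @?s a) => apply: (FP_cons (f := f) (s := s)); fp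
  | |- FP (fun a => behead (@?s a)) => apply: (FP_behead (s := s)); fp
  | |- FP (fun a => seq.head ?d (@?s a)) => apply: (FP_head d (s := s)); fp
  | |- FP (fun a => nilp (@?s a)) => apply: (FP_nilp (s := s)); fp
  | |- FP (fun _ => if _ then _ else _) => apply: FP_if; fp
  | |- _ => try assumption
  end.

(** * List operations and unary arithmetic *)

Section Lists.
Context {A E : Type} {EA : Enc A} {EE : Enc E}.

Lemma FP_catrev (s t : A -> seq E) : FP s -> FP t -> FP (fun a => catrev (s a) (t a)).
Proof.
move=> Ps Pt; apply: FP_ext (FP_foldl_add (f := fun p : A * (seq E * E) => p.2.2 :: p.2.1)
  (q := fun _ => 1) Ps _ Pt _ _).
- by move=> a; elim: (s a) (t a) => //= e s' IH t'; rewrite IH.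
- by fp.
- by pbound.
- by move=> a b e; rewrite esize_cons /=; lia.
Qed.

Lemma FP_size (s : A -> seq E) : FP s -> FP (fun a => size (s a)).
Proof.
move=> Ps; apply: FP_ext (FP_foldl_add (f := fun p : A * (nat * E) => p.2.1.+1)
  (z := fun _ => 0) (q := fun _ => 2) Ps _ _ _ _).
- move=> a; rewrite -[RHS]addn0; elim: (s a) 0 => //= e s' IH n.
  by rewrite IH addnS.
- apply: (@FP_recode _ _ _ _ _ _ (fun p : A * (nat * E) => (Leaf, p.2.1))) => //.
  by fp.
- by fp.
- by pbound.
- by move=> a b e; rewrite !esize_nat /=; have := esize_gt0 e; lia.
Qed.

Lemma FP_rev (s : A -> seq E) : FP s -> FP (fun a => rev (s a)).
Proof. by move=> Ps; apply: FP_catrev Ps _; fp. Qed.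

Lemma FP_succn (n : A -> nat) : FP n -> FP (fun a => (n a).+1).
Proof.
by move=> Pn; apply: (@FP_recode _ _ _ _ _ _ (fun a => (Leaf, n a))) => //; fp.
Qed.

Lemma FP_drop (n : A -> nat) (s : A -> seq E) : FP n -> FP s -> FP (fun a => drop (n a) (s a)).
Proof.
move=> Pn Ps; apply: FP_ext (FP_iter_add (f := fun p : A * seq E => behead p.2)
  (q := fun _ => 0) Pn _ Ps _ _).
- move=> a; elim: (n a) => [|m IH]; first by rewrite drop0.
  by rewrite iterS IH -drop1 drop_drop.
- by fp.
- by pbound.
- by move=> a [|e s'] //=; rewrite esize_cons; lia.
Qed.

Lemma FP_nseq (n : A -> nat) (x : A -> E) : FP n -> FP x -> FP (fun a => nseq (n a) (x a)).
Proof.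
move=> Pn Px; have px := FP_esize Px.
apply: FP_ext (FP_iter_add (f := fun p : A * seq E => x p.1 :: p.2) (z := fun _ => [::])
  (q := fun a => esize (x a) + 1) Pn _ _ _ _).
- by move=> a; elim: (n a) => //= m ->.
- by apply: FP_cons; fp; exact: FP_comp Px (FP_fst FP_id).
- by fp.
- by pbound.
- by move=> a s'; rewrite esize_cons /=; lia.
Qed.
End Lists.

Section Arith.
Context {A E : Type} {EA : Enc A} {EE : Enc E}.

Lemma FP_cat (s t : A -> seq E) : FP s -> FP t -> FP (fun a => s a ++ t a).
Proof.
move=> Ps Pt; apply: FP_ext (FP_catrev (FP_rev Ps) Pt) => a.
by rewrite catrevE revK.
Qed.

Lemma FP_rcons (s : A -> seq E) (x : A -> E) : FP s -> FP x -> FP (fun a => rcons (s a) (x a)).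
Proof.
move=> Ps Px; apply: FP_ext (FP_cat Ps (t := fun a => [:: x a]) _) => [a|].
  by rewrite cats1.
by fp.
Qed.

Lemma FP_nth d (s : A -> seq E) (n : A -> nat) : FP s -> FP n -> FP (fun a => nth d (s a) (n a)).
Proof.
move=> Ps Pn; apply: FP_ext (FP_head d (FP_drop Pn Ps)) => a.
by rewrite -nth0 nth_drop addn0.
Qed.

Lemma FP_addn (m n : A -> nat) : FP m -> FP n -> FP (fun a => m a + n a).
Proof.
move=> Pm Pn; apply: FP_ext (FP_iter_add (f := fun p : A * nat => p.2.+1)
  (q := fun _ => 2) Pm _ Pn _ _).
- by move=> a; elim: (m a) => //= k ->.
- by apply: FP_succn; fp.
- by pbound.
- by move=> a k; rewrite !esize_nat /=; lia.
Qed.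

Lemma FP_negb (b : A -> bool) : FP b -> FP (fun a => ~~ b a).
Proof.
by move=> Pb; apply: (@FP_ext _ _ _ _ (fun a => if b a then false else true)); fp => a; case: (b a).
Qed.

Lemma FP_andb (b c : A -> bool) : FP b -> FP c -> FP (fun a => b a && c a).
Proof.
by move=> Pb Pc; apply: (@FP_ext _ _ _ _ (fun a => if b a then c a else false)); fp => a; case: (b a).
Qed.

Lemma FP_orb (b c : A -> bool) : FP b -> FP c -> FP (fun a => b a || c a).
Proof.
by move=> Pb Pc; apply: (@FP_ext _ _ _ _ (fun a => if b a then true else c a)); fp => a; case: (b a).
Qed.

End Arith.

Section Powers.
Context {A : Type} {EA : Enc A}.

Lemma FP_muln (m n : A -> nat) : FP m -> FP n -> FP (fun a => m a * n a).
Proof.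
move=> Pm Pn; have pn := FP_esize Pn.
apply: FP_ext (FP_iter_add (f := fun p : A * nat => n p.1 + p.2) (z := fun _ => 0)
  (q := fun a => esize (n a)) Pm _ _ _ _).
- by move=> a; elim: (m a) => //= k ->; rewrite mulSn.
- by apply: FP_addn; fp; exact: FP_comp Pn (FP_fst FP_id).
- by fp.
- by pbound.
- by move=> a k; rewrite !esize_nat /=; lia.
Qed.

Lemma FP_expn (n : A -> nat) k : FP n -> FP (fun a => n a ^ k).
Proof.
move=> Pn; elim: k => [|k IH]; first exact: (FP_const 1).
by apply: FP_ext (FP_muln Pn IH) => a; rewrite expnS.
Qed.
End Powers.

Lemma enc_bool_inj : injective (@enc bool _).
Proof. by case=> [] []. Qed.

Lemma enc_pair_inj A B {EA : Enc A} {EB : Enc B} :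
  injective (@enc A _) -> injective (@enc B _) -> injective (@enc (A * B) _).
Proof. by move=> iA iB [a b] [a' b'] [/iA-> /iB->]. Qed.

Lemma enc_seq_inj A {EA : Enc A} : injective (@enc A _) -> injective (@enc (seq A) _).
Proof. by move=> iA; elim=> [|a s IH] [|b t] // [/iA-> /IH->]. Qed.

(** * Polynomial-time functions are computed by Turing machines *)

Lemma esize_word (w : seq bool) : esize w <= 4 * size w + 1.
Proof.
elim: w => // b w IH; rewrite esize_cons /=.
by case/andP: (esize_bool b); lia.
Qed.

Lemma pbounded_word (g : seq bool -> nat) : pbounded g -> exists c, forall x, g x <= poly c (size x).
Proof.
(* The base [(esize x).+2] is at most [4 * n + 3] for a word of length [n]. It is below 8 if
   [n <= 1], and below [n ^ 4] if [n >= 2]. *)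
move=> [c lec]; exists (8 ^ c + 4 * c) => x; apply: leq_trans (lec x) _.
have [le1|lt1] := leqP (size x) 1.
  apply: (@leq_trans (8 ^ c)); last exact: leq_trans (leq_addr _ _) (leq_addl _ _).
  by apply: leq_exp2; have := esize_word x; lia.
apply: (@leq_trans (size x ^ (4 * c))).
  rewrite expnM; apply: leq_exp2.
  apply: leq_trans (_ : (4 * size x + 1).+2 <= _); first by rewrite !ltnS esize_word.
  rewrite (_ : size x ^ 4 = size x * size x * (size x * size x)); last by rewrite !expnS expn0 muln1 mulnA.
  have h : 4 <= size x * size x by rewrite (@leq_mul 2 2).
  nia.
apply: leq_trans (leq_addr _ _); rewrite leq_exp2l //; exact: leq_addl.
Qed.

Section Load.
Variables (x : word).
Local Notation P := (fun _ : store => True).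

Lemma reach_in ce cf ct s n s' :
  reach x (branch (input_cell x (ipos s)) ce cf ct) s n s' ->
  reach x (In ce cf ct) s (n + 2) s'.
Proof. by move=> [m le_m e]; exists (1 + m + 1); [lia | constructor]. Qed.

Lemma reach_mv m s : reach x (Mv m) s 1 (advance m s).
Proof. by exists 1 => //; constructor. Qed.

Lemma reach_out b s : reach x (Out b) s 1 (emit b s).
Proof. by exists 1 => //; constructor. Qed.

Lemma reach_whilein_end c s : input_cell x (ipos s) = None -> reach x (WhileIn c) s 1 s.
Proof. by move=> E; exists 1 => //; constructor. Qed.

Lemma reach_whilein c s n1 s1 n2 s2 : input_cell x (ipos s) <> None ->
  reach x c s n1 s1 -> reach x (WhileIn c) s1 n2 s2 -> reach x (WhileIn c) s (n1 + n2 + 2) s2.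
Proof.
move=> E [m1 le1 e1] [m2 le2 e2]; exists (1 + m1 + 1 + m2); first lia.
exact: exec_whilein E e1 e2.
Qed.

(** The input is read from right to left: the first bit of a word comes first in the code of its
    list and so has to be pushed last. *)
Definition load_bit : cmd :=
  Seq (In Skip (Seq (Push kV false) (Push kV true))
    (Seq (Push kV false) (Seq (Push kV false) (Seq (Push kV true) (Push kV true)))))
    (Mv MoveL).

Definition load : cmd :=
  Seq (WhileIn (Mv MoveR)) (Seq (Mv MoveL) (Seq (Push kV false) (WhileIn load_bit))).

Lemma input_cellE i : i < size x -> input_cell x i = Some (nth false x i).
Proof. by move=> lt_i; rewrite /= (nth_map false). Qed.

Lemma reach_load : reach x load empty_store (20 * size x + 20)
  (Store (-1)%R [::] (code (enc x)) [::] [::] [::]).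
Proof.
have go_right n i : i + n = size x -> reach x (WhileIn (Mv MoveR))
    (Store i [::] [::] [::] [::] [::]) (4 * n + 1) (Store (size x) [::] [::] [::] [::] [::]).
  elim: n i => [|n IH] i E.
    rewrite addn0 in E; rewrite E; apply: reach_whilein_end.
    by rewrite /= nth_default ?size_map.
  have r := IH i.+1 ltac:(lia).
  apply: reach_leq; first apply: (@reach_whilein _ _ 1) r.
  - by rewrite /ipos input_cellE //; lia.
  - have := reach_mv MoveR (Store i [::] [::] [::] [::] [::]).
    by rewrite /advance (_ : (i%:Z + shift MoveR)%R = i.+1) //= -addn1 PoszD.
  - lia.
have go_left y z : x = y ++ z -> reach x (WhileIn load_bit)
    (Store ((size y)%:Z - 1)%R [::] (code (enc z)) [::] [::] [::]) (16 * size y + 1)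
    (Store (-1)%R [::] (code (enc x)) [::] [::] [::]).
  elim/last_ind: y z => [|y b IH] z E; first by rewrite -[z]E; apply: reach_whilein_end.
  have r := IH (b :: z) ltac:(by rewrite E cat_rcons).
  have Ei : input_cell x ((size (rcons y b))%:Z - 1)%R = Some b.
    rewrite size_rcons (_ : _ - 1 = size y :> int)%R; last by lia.
    by rewrite [LHS]input_cellE E ?size_cat ?size_rcons ?cat_rcons ?nth_cat ?ltnn ?subnn //; lia.
  apply: reach_leq; first apply: (@reach_whilein _ _ 11) r.
  - by rewrite /ipos Ei.
  - set s1 := Store _ _ (code (enc z)) _ _ _.
    have rb : reach x (In Skip (Seq (Push kV false) (Push kV true))
        (Seq (Push kV false) (Seq (Push kV false) (Seq (Push kV true) (Push kV true)))))
        s1 10 (Store (ipos s1) [::] (code (enc (b :: z))) [::] [::] [::]).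
      apply: (@reach_leq _ _ _ (8 + 2)) => //; apply: reach_in; rewrite /ipos Ei.
      by case: b {E Ei} @s1 => s1; (apply: reach_leq; [straight | ]).
    have := reach_seq rb (reach_mv MoveL _).
    rewrite /advance (_ : (ipos s1 + shift MoveL)%R = ((size y)%:Z - 1)%R) //.
    by rewrite /= size_rcons -addn1 PoszD GRing.addrK.
  - by rewrite size_rcons; lia.
have r1 := go_right (size x) 0 erefl.
have r2 := go_left x [::] (esym (cats0 x)).
have r3 := reach_mv MoveL (Store (size x) [::] [::] [::] [::] [::]).
have r4 := reach_push x kV false (Store ((size x)%:Z - 1)%R [::] [::] [::] [::] [::]).
apply: reach_leq (reach_seq r1 (reach_seq r3 (reach_seq r4 r2))) _; lia.
Qed.

(** The bit popped by the loop belongs to a list node. The entry that follows is coded 0 or 100, and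
    in the latter case two leaves remain to be removed. *)
Definition unload : cmd :=
  While kV (Pop kV Skip (Out false)
    (Seq (Pop kV Skip Skip Skip) (Seq (Pop kV Skip Skip Skip) (Out true)))).

Lemma reach_unload i o w : reach x unload (Store i o (code (enc w)) [::] [::] [::])
  (20 * size w + 1) (Store i (o ++ w) [::] [::] [::] [::]).
Proof.
elim: w o => [|b w IH] o; first by rewrite cats0; apply: (@reach_while_end _ kV).
have r := IH (rcons o b); rewrite cat_rcons in r.
have rb : reach x (Pop kV Skip (Out false)
    (Seq (Pop kV Skip Skip Skip) (Seq (Pop kV Skip Skip Skip) (Out true))))
    (Store i o (code (enc b) ++ code (enc w)) [::] [::] [::]) 10
    (Store i (rcons o b) (code (enc w)) [::] [::] [::]).
  case: b {r}; (apply: reach_leq; [straight; exact: reach_out | by []]).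
apply: reach_leq (@reach_while x kV _ (Store i o (code (enc (b :: w))) [::] [::] [::])
  _ _ _ _ _ erefl rb r) _.
by rewrite /=; lia.
Qed.
End Load.

Lemma FP_polytime_fun (f : word -> word) : FP f -> polytime_fun f.
Proof.
move=> Pf; have pf := FP_esize Pf; case: Pf => p Ep cp.
have pb : pbounded (fun x : word => 20 * esize x + 20 + (cost p (enc x) +
   (20 * esize (f x) + 1)) + 1) by pbound.
have [c lec] := pbounded_word pb.
exists (machine_of (Seq load (Seq (cmd_of p) unload))), c => x.
have r2 : reach x (cmd_of p) (Store (-1)%R [::] (code (enc x)) [::] [::] [::])
    (cost p (enc x)) (Store (-1)%R [::] (code (enc (f x))) [::] [::] [::]).
  by rewrite -Ep -[code (enc x)]cats0 -[code (eval _ _)]cats0; apply: reach_cmd_of.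
have [n le_n e] := reach_seq (reach_load x) (reach_seq r2 (reach_unload x (-1)%R [::] (f x))).
have vd := machine_of_verdict e I I; have out := machine_of_output e I I.
have hd : halted (run (machine_of (Seq load (Seq (cmd_of p) unload))) x n.+1).
  by rewrite /halted vd.
have le_c : n.+1 <= poly c (size x).
  apply: leq_trans (lec x); rewrite addn1 ltnS; apply: leq_trans le_n _.
  by rewrite !leq_add // ?leq_mul2l /= ltnW // leq_size_esize.
by rewrite (run_halted hd le_c).
Qed.

Lemma FP_PTIME (f : word -> bool) : FP f -> PTIME (fun x => f x).
Proof.
move=> [p Ep cp].
have pb : pbounded (fun x : word => 20 * esize x + 20 + cost p (enc x) + 1) by pbound.
have [c lec] := pbounded_word pb.
exists (machine_of (Seq load (cmd_of p))), c => x; exists (f x) => //.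
have r2 : reach x (cmd_of p) (Store (-1)%R [::] (code (enc x)) [::] [::] [::])
    (cost p (enc x)) (Store (-1)%R [::] (code (enc (f x))) [::] [::] [::]).
  by rewrite -Ep -[code (enc x)]cats0 -[code (eval _ _)]cats0; apply: reach_cmd_of.
have [n le_n e] := reach_seq (reach_load x) r2.
have vd := machine_of_verdict e I I.
have hd : halted (run (machine_of (Seq load (cmd_of p))) x n.+1) by rewrite /halted vd.
have le_c : n.+1 <= poly c (size x).
  apply: leq_trans (lec x); rewrite addn1 ltnS; apply: leq_trans le_n _.
  by rewrite !leq_add // ?leq_mul2l /= ltnW // leq_size_esize.
by rewrite (run_halted hd le_c) vd /=; case: (f x).
Qed.

(** * Finite types and integers as data *)

Definition finEnc (T : finType) : Enc T := fun x => enc (enum_rank x : nat).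
Arguments finEnc T : clear implicits.

Lemma finEnc_inj (T : finType) : injective (@enc T (finEnc T)).
Proof.
have inj_nat : injective (@enc nat _) by apply: (can_inj (g := spine)) => n; rewrite spine_nat.
by move=> x y /inj_nat/val_inj/enum_rank_inj.
Qed.

(** A finite table is built into the program, with one equality test per value; transition functions
    enter the algebra in this way. *)
Lemma FP_fincase A C {EA : Enc A} {EC : Enc C} (T : finType) (u : A -> T) (G : T -> A -> C) :
  @FP A T EA (finEnc T) u -> (forall x, FP (G x)) -> FP (fun a => G (u a) a).
Proof.
move=> Pu PG; pose EF := finEnc T.
have Pis x : FP (fun a => u a == x).
  apply: (@FP_eq A T EA EF u (fun _ => x) (fun y z => y == z) (@finEnc_inj T)) => //.
    by move=> y z; apply: eqP.
  exact: FP_const.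
have h s x0 : FP (fun a => if u a \in x0 :: s then G (u a) a else G x0 a).
  elim: s => [|x s IH].
    by apply: FP_ext (PG x0) => a; rewrite inE; case: eqP => // ->.
  apply: FP_ext (FP_if (Pis x) (PG x) IH) => a; rewrite !inE; case: (eqVneq (u a) x) => [->|_].
    by rewrite orbT.
  by rewrite [in RHS]orbA orbF.
case E: (enum T) => [|x0 s].
  (* If [T] is empty then so is [A], and any program will do. *)
  exists FLeaf => [a|]; last exact: pbounded_mul (pbounded_const _) pbounded_esize.
  by have := mem_enum T (u a); rewrite E.
by apply: FP_ext (h s x0) => a; rewrite -E mem_enum.
Qed.

(** * Finite functions as data *)

Instance Enc_ffun (I : finType) B {EB : Enc B} : Enc {ffun I -> B} :=
  fun f => enc [seq f i | i <- enum I].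

Arguments Enc_ffun I {B} EB f.

Section FinFuns.
Context {A B : Type} {EA : Enc A} {EB : Enc B} (I : finType).

Lemma FP_ffun_app (F : A -> {ffun I -> B}) i : FP F -> FP (fun a => F a i).
Proof.
move=> PF.
have Pl : FP (fun a => [seq enc (F a i) | i <- enum I]).
  apply: FP_recode PF => a; rewrite {1}/enc /Enc_ffun.
  by elim: (enum I) => //= j s IH; apply: (f_equal (Node _) IH).
apply: FP_recode (FP_nth Leaf Pl (FP_const (index i (enum I)))) => a.
by rewrite (nth_map i) ?index_mem ?mem_enum // nth_index ?mem_enum.
Qed.

Lemma FP_ffun_make (F : I -> A -> B) : (forall i, FP (F i)) -> FP (fun a => [ffun i => F i a]).
Proof.
move=> PF; have Pl : FP (fun a => [seq F i a | i <- enum I]).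
  elim: (enum I) => [|i s IH] /=; first by fp.
  exact: FP_cons.
by apply: FP_recode Pl => a; rewrite {2}/enc /Enc_ffun; under [in RHS]eq_map do rewrite ffunE.
Qed.

Lemma leq_esize_ffun (f : {ffun I -> B}) b : (forall i, esize (f i) <= b) ->
  esize f <= #|I| * (b + 1) + 1.
Proof.
move=> le_b; rewrite /esize {1}/enc /Enc_ffun -/(esize _) cardE.
elim: (enum I) => // i s IH; rewrite [map _ _]/= esize_cons [size _]/= mulSn.
by apply: leq_ltn_trans (leq_add (le_b i) IH) _; lia.
Qed.
End FinFuns.

(** The functions form a finite type, but they are encoded as lists of values and not by a rank;
    hence the case distinction goes through the arguments one at a time. *)
Lemma FP_ffun_case A C {EA : Enc A} {EC : Enc C} (I T : finType) (x0 : T)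
    (u : A -> {ffun I -> T}) (G : {ffun I -> T} -> A -> C) :
  @FP A _ EA (Enc_ffun I (finEnc T)) u -> (forall r, FP (G r)) -> FP (fun a => G (u a) a).
Proof.
move=> Pu PG.
(* The values outside [s] have already been distinguished and are fixed in [r]. *)
have h (s : seq I) (r : {ffun I -> T}) : FP (fun a => G [ffun i => if i \in s then u a i else r i] a).
  elim: s r => [|i s IH] r.
    by apply: FP_ext (PG r) => a; congr G; apply/ffunP => i; rewrite ffunE.
  pose r' x := [ffun j => if j == i then x else r j].
  have Pi := @FP_ffun_app A T EA (finEnc T) I u i Pu.
  apply: FP_ext (@FP_fincase _ _ _ _ T (fun a => u a i)
    (fun x a => G [ffun j => if j \in s then u a j else r' x j] a) Pi (fun x => IH (r' x))) => a.
  congr G; apply/ffunP => j; rewrite !ffunE inE.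
  by case: (boolP (j \in s)) => [|_]; rewrite ?orbT // orbF; case: eqP => // ->.
apply: FP_ext (h (enum I) [ffun => x0]) => a; congr G; apply/ffunP => i.
by rewrite ffunE mem_enum.
Qed.

(** * Binary numerals in canonical form *)

Fixpoint binc (w : word) : word :=
  match w with
  | [::] => [:: true]
  | false :: w' => true :: w'
  | true :: w' => false :: binc w'
  end.

(* The binary representation of [n], least significant bit first, without
   leading zeros. *)
Definition bits (n : nat) : word := iter n binc [::].

Definition lsb_value (w : word) : nat := foldr (fun (b : bool) v => v.*2 + b) 0 w.

Lemma lsb_value_binc w : lsb_value (binc w) = (lsb_value w).+1.
Proof. by elim: w => // -[] w IH /=; rewrite ?IH; lia. Qed.

Lemma bitsK n : lsb_value (bits n) = n.
Proof. by elim: n => //= n IH; rewrite lsb_value_binc IH. Qed.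

Definition bcons (b : bool) (w : word) : word := if b then true :: w else
  if nilp w then [::] else false :: w.

Lemma bits_double n (b : bool) : bits (n.*2 + b) = bcons b (bits n).
Proof.
elim: n => [|n IH]; first by case: b.
rewrite doubleS !addSn /bits !iterS -![iter _ binc _]/(bits _) IH.
by case: b {IH}; case: (bits n) => [|[] w].
Qed.

(** The word on an index tape may have leading zeros, which [bcons] drops. Numerals have to be
    canonical because positions are compared by comparing their encodings. *)
Lemma bits_binary_value w : foldl (fun v b => bcons b v) [::] w = bits (binary_value w).
Proof.
rewrite -[[::]]/(bits 0) /binary_value; elim: w 0 => //= b w IH n.
by rewrite -bits_double IH.
Qed.

Lemma binary_value_rev w : binary_value (rev w) = lsb_value w.
Proof. by rewrite /binary_value foldl_rev. Qed.

Lemma size_bits_double n (b : bool) : size (bits (n.*2 + b)) <= (size (bits n)).+1.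
Proof. by rewrite bits_double /bcons; case: b => //; case: nilp. Qed.

Lemma size_bits_binary_value w : size (bits (binary_value w)) <= size w.
Proof.
rewrite /binary_value -[size w]addn0 -{2}[0]/(size (bits 0)).
elim: w 0 => //= b w IH n; apply: leq_trans (IH _) _.
by have := size_bits_double n b; lia.
Qed.

Lemma size_binc w : size (binc w) <= (size w).+1.
Proof. by elim: w => // -[] w IH //=. Qed.

Lemma esize_true : esize true = 3. Proof. by []. Qed.
Lemma esize_false : esize false = 1. Proof. by []. Qed.

Section Binary.
Context {A : Type} {EA : Enc A}.

Lemma FP_binc (f : A -> seq bool) : FP f -> FP (fun a => binc (f a)).
Proof.
move=> Pf.
pose g (p : seq bool * ((bool * seq bool) * bool)) : bool * seq bool :=
  let c := p.2.1.1 in let acc := p.2.1.2 in let b := p.2.2 in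
  if c then (if b then (true, false :: acc) else (false, true :: acc)) else (false, b :: acc).
have Pg : FP g by rewrite /g; fp.
have Pl : FP (fun w : seq bool => foldl (fun c b => g (w, (c, b))) (true, [::]) w).
  apply: (FP_foldl_add (s := fun w => w) (z := fun _ => (true, [::])) (q := fun _ => 10)); fp.
    by pbound.
  by move=> a [[] acc] []; rewrite /g /= !esize_pair /= esize_cons
    ?esize_true ?esize_false; lia.
have Ph : FP (fun w : seq bool => let r := foldl (fun c b => g (w, (c, b))) (true, [::]) w in
    if r.1 then rev (true :: r.2) else rev r.2).
  by cbv zeta; fp; apply: FP_rev; fp.
apply: (FP_comp (g := binc)) Pf; apply: FP_ext Ph => w /=.
(* If the carry survives, the new top bit of [binc v] is still missing from the accumulator, hence
   [take (size v)]. *)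
have Eg v c acc : foldl (fun c b => g (w, (c, b))) (c, acc) v =
   (c && all id v, catrev (if c then take (size v) (binc v) else v) acc).
  elim: v c acc => [|b v IH] c acc; first by case: c.
  by rewrite /= {1}/g /=; case: c; case: b => /=; rewrite IH //= take_size.
rewrite Eg /= catrevE cats0; case: (boolP (all id w)) => [aw|naw].
  rewrite rev_cons revK -cats1.
  by elim: w {Eg} aw => //= -[] //= w IH /IH {2}<-.
rewrite revK; elim: w {Eg} naw => //= -[] w IH; last by rewrite /= take_size.
by move=> /= /IH ->.
Qed.
End Binary.

(** ** Predecessors and integers *)

Fixpoint bsub1 (w : word) : word :=
  match w with
  | [::] => [::]
  | true :: w' => false :: w'
  | false :: w' => true :: bsub1 w'
  end.

Lemma lsb_value_bsub1 w : 0 < lsb_value w -> (lsb_value (bsub1 w)).+1 = lsb_value w.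
Proof.
by elim: w => // -[] w IH /= v_gt0; [lia | have := IH ltac:(lia); lia].
Qed.

Lemma FP_foldl_bcons : FP (fun w : seq bool => foldl (fun v b => bcons b v) [::] w).
Proof.
apply: (FP_foldl_add (s := fun w => w) (z := fun _ => [::])
  (f := fun p : seq bool * (seq bool * bool) => bcons p.2.2 p.2.1) (q := fun _ => 10)).
- by fp.
- by rewrite /bcons; fp.
- by fp.
- by pbound.
- by move=> a w []; rewrite /bcons /=; case: w => [|b w] //=;
    rewrite ?esize_cons ?esize_true ?esize_false; lia.
Qed.

Lemma FP_bits_pred A {EA : Enc A} (f : A -> nat) :
  FP (fun a => bits (f a)) -> FP (fun a => bits (f a).-1).
Proof.
move=> Pf.
pose g (p : seq bool * ((bool * seq bool) * bool)) : bool * seq bool :=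
  let c := p.2.1.1 in let acc := p.2.1.2 in let b := p.2.2 in
  if c then (if b then (false, false :: acc) else (true, true :: acc)) else (false, b :: acc).
have Pg : FP g by rewrite /g; fp.
have Pl : FP (fun w : seq bool => foldl (fun c b => g (w, (c, b))) (true, [::]) w).
  apply: (FP_foldl_add (s := fun w => w) (z := fun _ => (true, [::])) (q := fun _ => 10)); fp.
    by pbound.
  by move=> a [[] acc] []; rewrite /g /= !esize_pair /= esize_cons
    ?esize_true ?esize_false; lia.
have Eg v c acc w : foldl (fun c b => g (w, (c, b))) (c, acc) v =
   (c && ~~ has id v, catrev (if c then bsub1 v else v) acc).
  elim: v c acc => [|b v IH] c acc; first by case: c.
  by rewrite /= {1}/g /=; case: c; case: b => /=; rewrite IH.
have Ps : FP (fun a => (foldl (fun c b => g (bits (f a), (c, b))) (true, [::]) (bits (f a))).2).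
  by apply: FP_snd; apply: (FP_comp Pl) Pf.
have Pe : FP (fun a => nilp (bits (f a))) by fp.
(* The accumulator holds the result with its most significant bit first, possibly a zero; folding
   [bcons] over it restores the canonical form. *)
apply: FP_ext (FP_if Pe (FP_const [::]) (FP_comp FP_foldl_bcons Ps)) => a.
rewrite Eg /= bits_binary_value -/(rev _) binary_value_rev.
case E: (nilp _); first by case: (f a) E (bitsK (f a)) => // n E; rewrite (nilP E).
congr bits; apply: succn_inj; rewrite lsb_value_bsub1 bitsK ?prednK //.
  by case: (f a) E.
by case: (f a) E.
Qed.

Instance Enc_int : Enc int := fun z =>
  match z with Posz n => enc (false, bits n) | Negz n => enc (true, bits n) end.

Lemma enc_int_inj : injective (@enc int _).
Proof.
have inj_w : injective (@enc (bool * seq bool) _).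
  by apply: enc_pair_inj enc_bool_inj _; apply: enc_seq_inj enc_bool_inj.
by move=> [m|m] [n|n] /inj_w [] // /(congr1 lsb_value); rewrite !bitsK => ->.
Qed.

Definition is_neg (z : int) : bool := if z is Negz _ then true else false.
Definition magnitude (z : int) : nat := match z with Posz n => n | Negz n => n end.

Section Integers.
Context {A : Type} {EA : Enc A}.

Lemma FP_sign (f : A -> int) : FP f -> FP (fun a => is_neg (f a)).
Proof.
move=> Pf; have Pp : FP (fun a => (is_neg (f a), bits (magnitude (f a)))).
  by apply: FP_recode Pf => a; case: (f a).
exact: FP_fst Pp.
Qed.

Lemma FP_magnitude (f : A -> int) : FP f -> FP (fun a => bits (magnitude (f a))).
Proof.
move=> Pf; have Pp : FP (fun a => (is_neg (f a), bits (magnitude (f a)))).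
  by apply: FP_recode Pf => a; case: (f a).
exact: FP_snd Pp.
Qed.

Lemma FP_int (s : A -> bool) (n : A -> nat) : FP s -> FP (fun a => bits (n a)) ->
  FP (fun a => if s a then Negz (n a) else Posz (n a)).
Proof.
move=> Ps Pn; apply: FP_recode (FP_pair Ps Pn) => a.
by case: (s a).
Qed.

Lemma FP_addz1 (f : A -> int) : FP f -> FP (fun a => (f a + 1)%R).
Proof.
move=> Pf; have Ps := FP_sign Pf; have Pm := FP_magnitude Pf.
have P1 := FP_int (FP_const false) (n := fun a => (magnitude (f a)).+1) (FP_binc Pm).
have P2 := FP_int (FP_const true) (FP_bits_pred Pm).
(* [Negz 0] is -1, the only negative number whose successor is not negative. *)
have P3 := FP_if (FP_nilp Pm) (FP_const (Posz 0)) P2.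
apply: FP_ext (FP_if Ps P3 P1) => a; case: (f a) => [n|[|n]] /=; first by lia.
  by [].
have -> : nilp (binc (iter n binc [::])) = false.
  by case: (iter n binc [::]) => // -[].
lia.
Qed.

Lemma FP_subz1 (f : A -> int) : FP f -> FP (fun a => (f a - 1)%R).
Proof.
move=> Pf; have Ps := FP_sign Pf; have Pm := FP_magnitude Pf.
have P1 := FP_int (FP_const true) (n := fun a => (magnitude (f a)).+1) (FP_binc Pm).
have P2 := FP_int (FP_const false) (FP_bits_pred Pm).
have P3 := FP_if (FP_nilp Pm) (FP_const (Negz 0)) P2.
apply: FP_ext (FP_if Ps P1 P3) => a; case: (f a) => [[|n]|n] /=; [by [] | | by lia].
have -> : nilp (binc (iter n binc [::])) = false.
  by case: (iter n binc [::]) => // -[].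
lia.
Qed.

Lemma FP_shift m (f : A -> int) : FP f -> FP (fun a => (f a + shift m)%R).
Proof.
case: m => /= Pf; first exact: FP_subz1.
  by apply: FP_ext Pf => a; rewrite GRing.addr0.
exact: FP_addz1.
Qed.

Lemma FP_eqz (f g : A -> int) : FP f -> FP g -> FP (fun a => f a == g a).
Proof. by apply: FP_eq enc_int_inj _ => x y; apply: eqP. Qed.

End Integers.

Definition zsize (z : int) : nat := size (bits (magnitude z)).

Lemma leq_esize_int z : esize z <= 4 * zsize z + 6.
Proof.
have h (s : bool) n : esize (s, bits n) <= 4 * size (bits n) + 6.
  rewrite esize_pair; apply: (@leq_trans (3 + (4 * size (bits n) + 1)).+1); last by lia.
  by rewrite ltnS leq_add ?esize_word //; case: s.
by case: z => n; [exact: (h false n) | exact: (h true n)].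
Qed.

Lemma size_binc_geq w : size w <= size (binc w).
Proof. by elim: w => // -[] w IH /=. Qed.

Lemma zsize_shift m z : zsize (z + shift m)%R <= (zsize z).+1.
Proof.
have up n : (n%:Z + 1)%R = n.+1 by lia.
have up' n : (Negz n.+1 + 1)%R = Negz n by lia.
have down n : (n.+1%:Z + -1)%R = n by lia.
have down' n : (Negz n + -1)%R = Negz n.+1 by lia.
case: m; rewrite [shift _]/=.
- case: z => [[|n]|n]; rewrite ?down ?down' //; last exact: size_binc.
  by apply: leqW; apply: size_binc_geq.
- by rewrite GRing.addr0 leqnSn.
- case: z => [n|[|n]]; rewrite ?up ?up' //; first exact: size_binc.
  by apply: leqW; apply: size_binc_geq.
Qed.

(** * Simulation of Turing machines *)

(* A tape as its head position and the list of all writes, newest first. *)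
Definition log_tape (S : Type) : Type := (int * seq (int * option S))%type.

Section Lookup.
Variable S : Type.
Implicit Type l : seq (int * option S).

Definition lookup (p : int) l : option S :=
  foldr (fun e r => if e.1 == p then e.2 else r) None l.

Lemma lookup_notin p l : p \notin map fst l -> lookup p l = None.
Proof.
by elim: l => //= e l IH; rewrite inE negb_or eq_sym => /andP[/negbTE-> /IH].
Qed.

Definition log_prefix l (k : nat) : seq S :=
  nonblank_prefix (mkseq (fun i => lookup i%:Z l) k).

Lemma nonblank_prefix_rcons (s : seq (option S)) a :
  nonblank_prefix (rcons s a) = if size (nonblank_prefix s) == size s
    then (if a is Some x then rcons (nonblank_prefix s) x else nonblank_prefix s)
    else nonblank_prefix s.
Proof.
elim: s => [|[b|] s IH] //=.
by rewrite IH eqSS; case: ifP => _ //; case: (a).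
Qed.

Lemma log_prefixS l k : log_prefix l k.+1 = if size (log_prefix l k) == k
  then (if lookup k%:Z l is Some x then rcons (log_prefix l k) x else log_prefix l k)
  else log_prefix l k.
Proof. by rewrite /log_prefix mkseqS nonblank_prefix_rcons size_mkseq. Qed.

Lemma size_log_prefix l k : size (log_prefix l k) <= k.
Proof.
elim: k => // k IH; rewrite log_prefixS; case: ifP => [/eqP E|_]; last exact: leqW.
by case: lookup => [a|]; rewrite ?size_rcons E ?leqnn.
Qed.

Lemma log_prefix_full l k : size (log_prefix l k) = k ->
  forall i, i < k -> lookup i%:Z l <> None.
Proof.
elim: k => // k IH; rewrite log_prefixS; case: ifP => [/eqP E|_] Ek; last first.
  by have := size_log_prefix l k; rewrite Ek ltnn.
move=> i; rewrite ltnS leq_eqVlt => /predU1P[->|]; last exact: IH.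
by case: lookup Ek => // Ek; move: Ek; rewrite E; lia.
Qed.

(** By the pigeonhole principle: [k] nonblank cells need writes at [k] different positions, so the
    word on a tape is no longer than its log. *)
Lemma log_prefix_stable l k : size l <= k -> log_prefix l k = log_prefix l (size l).
Proof.
elim: k => [|k IH]; first by rewrite leqn0 => /eqP->.
rewrite leq_eqVlt => /predU1P[->//|]; rewrite ltnS => le_k.
rewrite log_prefixS -(IH le_k); case: eqP => // E.
case E2: lookup => [a|] //.
have full : size (log_prefix l k.+1) = k.+1 by rewrite log_prefixS E eqxx E2 size_rcons E.
have sub : {subset [seq Posz i | i <- iota 0 k.+1] <= map fst l}.
  move=> p /mapP[i]; rewrite mem_iota /= add0n => lt_i ->; apply/negPn/negP => /lookup_notin.
  exact: log_prefix_full full i lt_i.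
have uq : uniq [seq Posz i | i <- iota 0 k.+1] by rewrite map_inj_uniq ?iota_uniq // => ? ? [].
by have := uniq_leq_size uq sub; rewrite !size_map size_iota; lia.
Qed.

Definition agree (t : tape S) (l : log_tape S) : Prop :=
  head t = l.1 /\ forall p, cell t p = lookup p l.2.

Lemma agree_contents t (l : log_tape S) : agree t l -> contents t = log_prefix l.2 (size l.2).
Proof.
move=> [_ Ec]; set k := size (nneg t).
(* A length that is large enough on both sides: the tape is blank from cell [k] on, and the prefix
   of the log is stable from [size l.2] on. *)
rewrite -(@log_prefix_stable _ (k + size l.2)) ?leq_addl //.
have -> : contents t = log_prefix l.2 k.
  congr nonblank_prefix; rewrite -[LHS](mkseq_nth None); apply: eq_mkseq => i.
  by rewrite -Ec.
elim: (size l.2) => [|m IH]; first by rewrite addn0.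
rewrite addnS log_prefixS -IH -Ec /cell nth_default ?leq_addr //.
by case: ifP.
Qed.

Definition log_read (l : log_tape S) : option S := lookup l.1 l.2.
Definition log_write (a : option S) (l : log_tape S) : log_tape S := (l.1, (l.1, a) :: l.2).
Definition log_move (m : move) (l : log_tape S) : log_tape S := ((l.1 + shift m)%R, l.2).

Lemma agree_read t (l : log_tape S) : agree t l -> read t = log_read l.
Proof. by move=> [Eh Ec]; rewrite readE Ec Eh. Qed.

Lemma agree_write a t (l : log_tape S) : agree t l -> agree (write a t) (log_write a l).
Proof.
move=> [Eh Ec]; split=> [|p]; first by rewrite head_write.
by rewrite cell_write /= Eh Ec eq_sym.
Qed.

Lemma agree_move m t (l : log_tape S) : agree t l -> agree (move_head m t) (log_move m l).
Proof. by move=> [Eh Ec]; split=> [|p]; [rewrite /= Eh | exact: Ec]. Qed.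

Lemma agree_jump n t (l : log_tape S) : agree t l -> agree (jump n t) (Posz n, l.2).
Proof. by move=> [_ Ec]; split. Qed.

End Lookup.

Instance Enc_option (S : finType) : Enc (option S) := finEnc (option S).

Section LookupFP.
Context {A : Type} {EA : Enc A} (S : finType).

Lemma FP_lookup (p : A -> int) (l : A -> seq (int * option S)) :
  FP p -> FP l -> FP (fun a => lookup (p a) (l a)).
Proof.
move=> Pp Pl.
have Pq : FP (fun q : A * (option S * (int * option S)) =>
    if q.2.2.1 == p q.1 then q.2.2.2 else q.2.1).
  fp; apply: FP_eqz; first by fp.
  exact: FP_comp Pp (FP_fst FP_id).
apply: FP_ext (FP_foldl_add (z := fun _ => None) (q := fun _ => 1) (FP_rev Pl) Pq _ _ _).
- by move=> a; rewrite foldl_rev.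
- by fp.
- by pbound.
- by move=> a r e; rewrite /= esize_pair; case: ifP => _; lia.
Qed.

Lemma FP_isSome (u : A -> option S) : FP u -> FP (fun a => isSome (u a)).
Proof.
move=> Pu; apply: (@FP_fincase _ _ _ _ _ u (fun x _ => isSome x) Pu) => x; fp.
Qed.

End LookupFP.

Section LogPrefixFP.
Context {A : Type} {EA : Enc A} (S : finType).

Lemma FP_log_prefix (phi : S -> bool) (l : A -> seq (int * option S)) : FP l ->
  FP (fun a => [seq phi b | b <- log_prefix (l a) (size (l a))]).
Proof.
move=> Pl; have Pn := FP_size Pl; have pn := pbounded_nat Pn.
pose g (q : A * (bool * (int * seq bool))) : bool * (int * seq bool) :=
  let s := lookup q.2.2.1 (l q.1) in
  if q.2.1 && isSome s then
    (true, ((q.2.2.1 + 1)%R, (if s is Some b then phi b else false) :: q.2.2.2))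
  else (false, q.2.2).
have Pg : FP g.
  have Ps : FP (fun q : A * (bool * (int * seq bool)) => lookup q.2.2.1 (l q.1)).
    by apply: FP_lookup; [fp | exact: FP_comp Pl (FP_fst FP_id)].
  have Pi := FP_isSome Ps.
  rewrite /g; cbv zeta; apply: FP_if; first by apply: FP_andb; fp.
    apply: FP_pair; first by fp.
    apply: FP_pair; first by apply: FP_addz1; fp.
    apply: FP_cons; last by fp.
    apply: (@FP_fincase _ _ _ _ _ (fun q : A * (bool * (int * seq bool)) => lookup q.2.2.1 (l q.1))
      (fun x _ => if x is Some b then phi b else false) Ps) => x; fp.
  by fp.
(* The flag says that no blank has been met yet, that is, that the prefix has its full length
   [k]. *)
have Eg a k : iter k (fun c => g (a, c)) (true, (Posz 0, [::])) =
    (size (log_prefix (l a) k) == k,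
     (Posz (size (log_prefix (l a) k)), rev [seq phi b | b <- log_prefix (l a) k])).
  elim: k => // k IH; rewrite iterS IH /g [_.2]/= [_.1]/= log_prefixS.
  case: eqP => [E|ne] /=; last first.
    by rewrite -[k.+1]addn1; case: eqP => // E; have := size_log_prefix (l a) k; lia.
  rewrite E; case: lookup => [b|] /=.
    rewrite size_rcons E eqxx map_rcons rev_rcons.
    by congr (_, (_, _)); lia.
  by rewrite E; case: eqP => // E2; lia.
have Pk : FP (fun a => iter (size (l a)) (fun c => g (a, c)) (true, (Posz 0, [::]))).
  apply: (FP_iter (q := fun a => 8 * size (l a) + 20) Pn Pg); first by fp.
    by pbound.
  move=> a i le_i; rewrite Eg !esize_pair /=.
  have le_p := size_log_prefix (l a) i.
  set j := size _ in le_p *.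
  have le_j : zsize j <= j.
    by rewrite /zsize /=; elim: (j) => // m IH; apply: leq_trans (size_binc _) _.
  have E1 : esize (j == i) <= 3 by case: eqP.
  have E2 := leq_esize_int j.
  have E3 : esize (rev [seq phi b | b <- log_prefix (l a) i]) <= 4 * j + 1.
    by apply: leq_trans (esize_word _) _; rewrite size_rev size_map.
  lia.
apply: FP_ext (FP_rev (FP_snd (FP_snd Pk))) => a.
by rewrite Eg /= revK.
Qed.

End LogPrefixFP.

Instance Enc_state (M : tm) : Enc (state M) := finEnc (state M).

Lemma leq_esize_fin (T : finType) (x : T) : @esize T (finEnc T) x <= #|T|.*2.+1.
Proof.
rewrite (_ : @esize T (finEnc T) x = esize (enum_rank x : nat)) // esize_nat.
by rewrite ltnS leq_double ltnW.
Qed.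

Section Simulator.
Variables (M : tm) (acc : pred (state M)).
Variable ixd : state M -> {ffun 'I_(nwork M).+2 -> option (bool + aux M)} ->
  {ffun 'I_(nwork M).+2 -> option bool * move}.

Local Notation I := 'I_(nwork M).+2.
Local Notation S := ((bool + aux M)%type : finType).

(* Machines with index tapes whose heads jump upon entering a state in [acc]:
   random-access machines have one such state, ordinary machines none. *)
Definition gnext (c : config M * {ffun I -> tape bool}) : config M * {ffun I -> tape bool} :=
  let act := ixd c.1.1 (scan c.1) in
  let ix := [ffun i => move_head (act i).2 (write (act i).1 (c.2 i))] in
  let: (q, ts) := next c.1 in
  (q, if acc q then [ffun i => jump (binary_value (contents (ix i))) (ts i)] else ts, ix).

Definition gstep c := if halted c.1 then c else gnext c.

Definition log_config : Type :=
  (state M * ({ffun I -> log_tape S} * {ffun I -> log_tape bool}))%type.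

Definition log_index (e : {ffun I -> option bool * move}) (s : log_config) i : log_tape bool :=
  log_move (e i).2 (log_write (e i).1 (s.2.2 i)).

Definition log_act (d : {ffun I -> option S * move}) (s : log_config) i : log_tape S :=
  log_move (d i).2 (if i == in_tape (nwork M) then s.2.1 i else log_write (d i).1 (s.2.1 i)).

Definition log_jump (e : {ffun I -> option bool * move}) (d : {ffun I -> option S * move})
    (s : log_config) i : log_tape S :=
  let l := (log_index e s i).2 in
  (Posz (binary_value [seq id b | b <- log_prefix l (size l)]), (log_act d s i).2).

(** With state [q] and scanned symbols [r] as separate arguments, each of the finitely many
    instances is a fixed combination of tape operations; [FP_log_step] only has to select the right
    one. *)
Definition log_next_with q (r : {ffun I -> option S}) (s : log_config) : log_config :=
  let d := delta q r in let e := ixd q r in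
  (d.1, ([ffun i => if acc d.1 then log_jump e d.2 s i else log_act d.2 s i],
         [ffun i => log_index e s i])).

Definition log_step (s : log_config) : log_config :=
  if isSome (verdict s.1) then s else log_next_with s.1 [ffun i => log_read (s.2.1 i)] s.

Definition agree_config (c : config M * {ffun I -> tape bool}) (s : log_config) : Prop :=
  [/\ c.1.1 = s.1, forall i, agree (c.1.2 i) (s.2.1 i) & forall i, agree (c.2 i) (s.2.2 i)].

Lemma agree_step c s : agree_config c s -> agree_config (gstep c) (log_step s).
Proof.
move=> [Eq At Ai]; rewrite /gstep /log_step /halted Eq; case: ifP => _ //.
have Er : scan c.1 = [ffun i => log_read (s.2.1 i)].
  by apply/ffunP => i; rewrite !ffunE; apply: agree_read.
rewrite /gnext /next Er Eq.
set r := [ffun i => _]; rewrite /log_next_with; case Ed: (delta s.1 r) => [q act] /=.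
have Ai' i : agree (move_head (ixd s.1 r i).2 (write (ixd s.1 r i).1 (c.2 i)))
    (log_index (ixd s.1 r) s i).
  by apply: agree_move; apply: agree_write.
have At' i : agree (move_head (act i).2
        (if i == in_tape (nwork M) then c.1.2 i else write (act i).1 (c.1.2 i)))
    (log_act act s i).
  by apply: agree_move; case: ifP => _ //; apply: agree_write.
split=> //= i; last by rewrite !ffunE.
case: (acc q); rewrite !ffunE //.
by rewrite /log_jump map_id -(agree_contents (Ai' i)); apply: agree_jump (At' i).
Qed.

Definition input_log (x : seq bool) : int * seq (int * option S) :=
  foldl (fun c b => ((c.1 + 1)%R, (c.1, Some (inl b)) :: c.2)) (Posz 0, [::]) x.

Definition log_init (x : seq bool) : log_config :=
  (start M, ([ffun i => (Posz 0, if i == in_tape (nwork M) then (input_log x).2 else [::])],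
             [ffun => (Posz 0, [::])])).

Lemma input_logP x : (input_log x).1 = size x /\ forall p, lookup p (input_log x).2 =
  cell (tape_of [seq inl b | b <- x]) p.
Proof.
elim/last_ind: x => [|x b [IH1 IH2]]; first by split=> // -[n|n]; rewrite /cell /= nth_nil.
rewrite /input_log foldl_rcons -/(input_log x) size_rcons; split=> [|p] /=.
  by rewrite IH1; lia.
rewrite IH1 IH2 /cell /=; case: p => [n|n]; last by rewrite nth_nil.
rewrite !map_rcons nth_rcons !size_map eq_sym [_ == _ in LHS]/=.
case: ltngtP => lt_n; last by rewrite lt_n eqxx.
  by case: eqP => // E; lia.
by rewrite nth_default ?size_map 1?ltnW //; case: eqP => // E; lia.
Qed.

Lemma agree_init x : agree_config (init M x, [ffun => tape_of [::]]) (log_init x).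
Proof.
split=> //= i; rewrite !ffunE; split=> //= p.
  case: ifP => _; last by case: p => n; rewrite /cell /= nth_nil.
  by have [_ ->] := input_logP x.
by case: p => n; rewrite /cell /= nth_nil.
Qed.

Lemma agree_iter x t : agree_config (iter t gstep (init M x, [ffun => tape_of [::]]))
  (iter t log_step (log_init x)).
Proof. by elim: t => [|t IH]; [apply: agree_init | rewrite !iterS; apply: agree_step]. Qed.

(** ** Sizes *)

Let C := (#|{: option S}|.*2 + #|{: option bool}|.*2 + 20)%N.

(** Each step adds at most one write, whose address has at most [t] bits after [t] steps: a move
    lengthens the numeral of the position by at most one bit, and a jump goes to an address spelled
    out on an index tape. So the log grows quadratically even where addresses are exponential. *)
Definition bounded_log (T : finType) (t L : nat) (l : log_tape T) : Prop :=
  zsize l.1 <= t /\ esize l.2 <= L + t * (4 * t + C).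

Definition bounded_config (t L : nat) (s : log_config) : Prop :=
  forall i, [/\ bounded_log t L (s.2.1 i), bounded_log t 1 (s.2.2 i) & size (s.2.2 i).2 <= t].

Lemma bounded_init x : bounded_config 0 (esize (input_log x).2) (log_init x).
Proof.
move=> i; rewrite !ffunE /bounded_log /= addn0; split=> //; split=> //.
by case: ifP => // _; apply: esize_gt0.
Qed.

Lemma bounded_log_leq (T : finType) t L (l : log_tape T) :
  bounded_log t L l -> bounded_log t.+1 L l.
Proof. by move=> [h1 h2]; split; [lia | nia]. Qed.

Lemma bounded_log_write (T : finType) t L a (l : log_tape T) : #|{: option T}|.*2 + 20 <= C ->
  bounded_log t L l -> zsize (log_write a l).1 <= t /\
  esize (log_write a l).2 <= L + t.+1 * (4 * t.+1 + C).
Proof.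
move=> le_C [h1 h2]; split=> //; rewrite /log_write /= esize_cons esize_pair /=.
have E : t.+1 * (4 * t.+1 + C) = t * (4 * t + C) + (8 * t + C + 4) by nia.
have ea : esize a <= #|{: option T}|.*2.+1 by apply: leq_esize_fin.
by have := leq_esize_int l.1; rewrite E; lia.
Qed.

Lemma bounded_log_move (T : finType) t L m (l : log_tape T) :
  zsize l.1 <= t -> esize l.2 <= L + t.+1 * (4 * t.+1 + C) -> bounded_log t.+1 L (log_move m l).
Proof. by move=> h1 h2; split=> //=; apply: leq_trans (zsize_shift _ _) _. Qed.

Lemma C_sym : #|{: option S}|.*2 + 20 <= C. Proof. by rewrite /C; lia. Qed.
Lemma C_bit : #|{: option bool}|.*2 + 20 <= C. Proof. by rewrite /C; lia. Qed.

Lemma bounded_step t L s : bounded_config t L s -> bounded_config t.+1 L (log_step s).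
Proof.
move=> Bs; rewrite /log_step; case: ifP => _ i.
  by have [h1 h2 h3] := Bs i; split; [exact: bounded_log_leq.. | exact: leqW].
set r := [ffun i => _]; rewrite /log_next_with /= !ffunE; set d := delta _ r; set e := ixd _ r.
have [h1 h2 h3] := Bs i.
have Bi : bounded_log t.+1 1 (log_index e s i).
  by have [w1 w2] := bounded_log_write (e i).1 C_bit h2; apply: bounded_log_move.
have Ba : bounded_log t.+1 L (log_act d.2 s i).
  rewrite /log_act; case: ifP => _.
    by have [w1 w2] := bounded_log_leq h1; apply: bounded_log_move => //; case: h1.
  have [w1 w2] := bounded_log_write (d.2 i).1 C_sym h1.
  exact: bounded_log_move.
have Bsz : size (log_index e s i).2 <= t.+1 by [].
split=> //; case: ifP => // _; split; last by case: Ba.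
(* The target of a jump has no more bits than there have been writes on the index tape. *)
rewrite /log_jump map_id /= /zsize /=.
apply: leq_trans (size_bits_binary_value _) _; apply: leq_trans (size_log_prefix _ _) _.
exact: Bsz.
Qed.

Lemma bounded_esize t L s : bounded_config t L s -> esize s <= 2 * #|{: state M}| +
  2 * ((nwork M).+2 * (4 * t + L + t * (4 * t + C) + 10)) + 20.
Proof.
move=> Bs; rewrite esize_pair.
have le0 : esize s.1 <= _ := leq_esize_fin s.1.
have le1 : esize s.2.1 <= #|{: I}| * (4 * t + L + t * (4 * t + C) + 9 + 1) + 1.
  apply: leq_esize_ffun => i; rewrite esize_pair.
  have [[h1 h2] _ _] := Bs i.
  apply: (@leq_trans (4 * t + 6 + (L + t * (4 * t + C))).+1); last by lia.
  by rewrite ltnS leq_add //; apply: leq_trans (leq_esize_int _) _; rewrite leq_add2r leq_mul2l h1.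
have le2 : esize s.2.2 <= #|{: I}| * (4 * t + L + t * (4 * t + C) + 9 + 1) + 1.
  apply: leq_esize_ffun => i; rewrite esize_pair.
  have [_ [h1 h2] _] := Bs i.
  apply: (@leq_trans (4 * t + 6 + (1 + t * (4 * t + C))).+1); last by lia.
  by rewrite ltnS leq_add //; apply: leq_trans (leq_esize_int _) _; rewrite leq_add2r leq_mul2l h1.
rewrite card_ord in le1 le2.
have le3 : esize s.2 <= ((nwork M).+2 * (4 * t + L + t * (4 * t + C) + 9 + 1) + 1 +
    ((nwork M).+2 * (4 * t + L + t * (4 * t + C) + 9 + 1) + 1)).+1.
  by rewrite esize_pair ltnS; apply: leq_add le1 le2.
apply: leq_trans (_ : (#|{: state M}|.*2.+1 + _).+1 <= _).
  by rewrite ltnS; apply: leq_add le0 le3.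
by lia.
Qed.

(** ** The simulation in polynomial time *)

Lemma FP_log_tape (i : I) : FP (fun s : log_config => s.2.1 i).
Proof. by apply: FP_ffun_app; fp. Qed.

Lemma FP_index_tape (i : I) : FP (fun s : log_config => s.2.2 i).
Proof. by apply: FP_ffun_app; fp. Qed.

Lemma FP_log_write_move A {EA : Enc A} (T : finType) m (a : option T) (l : A -> log_tape T) :
  FP l -> FP (fun x => log_move m (log_write a (l x))).
Proof.
move=> Pl; apply: FP_pair; first exact: FP_shift (FP_fst Pl).
apply: FP_cons (FP_snd Pl); apply: FP_pair (FP_fst Pl) _; exact: FP_const.
Qed.

Lemma FP_log_act d i : FP (fun s => log_act d s i).
Proof.
rewrite /log_act; case: (i == _); last exact: FP_log_write_move (FP_log_tape i).
by apply: FP_pair; [exact: FP_shift (FP_fst (FP_log_tape i)) | exact: FP_snd (FP_log_tape i)].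
Qed.

Lemma FP_log_next_with q r : FP (log_next_with q r).
Proof.
have Pe e i : FP (fun s => log_index e s i) by apply: FP_log_write_move (FP_index_tape i).
apply: FP_pair; first by fp.
apply: FP_pair; apply: FP_ffun_make => i; last exact: Pe.
case: (acc _); last exact: FP_log_act.
apply: FP_pair; last exact: FP_snd (FP_log_act _ _).
apply: (FP_int (FP_const false)).
have Pl := FP_log_prefix id (FP_snd (Pe (ixd q r) i)).
by apply: FP_ext (FP_comp FP_foldl_bcons Pl) => s; rewrite bits_binary_value.
Qed.

Lemma FP_log_step : FP log_step.
Proof.
have Pr : FP (fun s : log_config => [ffun i => log_read (s.2.1 i)]).
  apply: FP_ffun_make => i.
  by apply: FP_lookup; [exact: FP_fst (FP_log_tape i) | exact: FP_snd (FP_log_tape i)].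
have Ps : FP (fun s : log_config => s.1) by fp.
apply: (@FP_fincase _ _ _ _ _ (fun s : log_config => s.1) (fun q s =>
  if isSome (verdict q) then s else log_next_with q [ffun i => log_read (s.2.1 i)] s) Ps) => q.
case: (isSome _); first exact: FP_id.
apply: (@FP_ffun_case _ _ _ _ _ _ None (fun s : log_config => [ffun i => log_read (s.2.1 i)])
  (fun r s => log_next_with q r s) Pr) => r.
exact: FP_log_next_with.
Qed.

Lemma leq_esize_input_log x : esize (input_log x).1 <= 4 * size x + 6 /\
  esize (input_log x).2 <= 1 + size x * (4 * size x + C).
Proof.
have le1 y : esize (input_log y).1 <= 4 * size y + 6.
  have [-> _] := input_logP y; apply: leq_trans (leq_esize_int _) _.
  rewrite leq_add2r leq_mul2l /=; elim: (size y) => // n IH.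
  exact: leq_trans (size_binc _) _.
split=> //; elim/last_ind: x => // x b IH.
rewrite /input_log foldl_rcons -/(input_log x) size_rcons esize_cons esize_pair.
have E : (size x).+1 * (4 * (size x).+1 + C) =
  size x * (4 * size x + C) + (8 * size x + C + 4) by nia.
have ea : esize (Some (inl b) : option S) <= #|{: option S}|.*2.+1 by apply: leq_esize_fin.
apply: leq_trans (_ : (4 * size x + 6 + #|{: option S}|.*2.+1).+1 +
   (1 + size x * (4 * size x + C)) < _).
  by rewrite ltnS leq_add // ltnS; apply: leq_add (le1 _) ea.
by rewrite E /C; lia.
Qed.

Lemma FP_log_init A {EA : Enc A} (x : A -> seq bool) : FP x -> FP (fun a => log_init (x a)).
Proof.
move=> Px; have pn := pbounded_nat (FP_size Px).
have Pl : FP (fun a => input_log (x a)).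
  apply: (FP_foldl (f := fun p : A * ((int * seq (int * option S)) * bool) =>
      ((p.2.1.1 + 1)%R, (p.2.1.1, Some (inl p.2.2)) :: p.2.1.2)) (z := fun _ => (Posz 0, [::]))
    (q := fun a => (4 * size (x a) + 6 + (1 + size (x a) * (4 * size (x a) + C))) + 1) Px).
  - apply: FP_pair; first by apply: FP_addz1; fp.
    apply: FP_cons; last by fp.
    apply: FP_pair; first by fp.
    apply: (@FP_recode _ _ _ _ _ _ (fun p : A * ((int * seq (int * option S)) * bool) =>
      if p.2.2 then Some (inl true) : option S else Some (inl false) : option S)); last by fp.
    by move=> [a [l []]].
  - by fp.
  - by pbound.
  - move=> a i; rewrite -[foldl _ _ _]/(input_log (take i (x a))) esize_pair addn1 ltnS.
    have [le1 le2] := leq_esize_input_log (take i (x a)).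
    have le_s : size (take i (x a)) <= size (x a) by rewrite size_take; case: ltnP; lia.
    apply: leq_trans (leq_add le1 le2) _.
    by have := leq_mul le_s (_ : 4 * size (take i (x a)) + C <= 4 * size (x a) + C); lia.
apply: FP_pair; first by fp.
apply: FP_pair; last by fp.
apply: FP_ffun_make => i; case: (i == _); last by fp.
by apply: FP_pair; [fp | exact: FP_snd Pl].
Qed.

Lemma FP_log_run A {EA : Enc A} (n : A -> nat) (x : A -> seq bool) : FP n -> FP x ->
  FP (fun a => iter (n a) log_step (log_init (x a))).
Proof.
move=> Pn Px; have pn := pbounded_nat Pn; have pm := pbounded_nat (FP_size Px).
pose L a := 1 + size (x a) * (4 * size (x a) + C).
have pL : pbounded L by rewrite /L; pbound.
apply: (FP_iter (f := fun p : A * log_config => log_step p.2) (q := fun a =>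
  2 * #|{: state M}| + 2 * ((nwork M).+2 * (4 * n a + L a + n a * (4 * n a + C) + 10)) + 20)
  Pn _ (FP_log_init Px)).
- exact: FP_comp FP_log_step (FP_snd FP_id).
- by pbound.
move=> a i le_i; have [_ le2] := leq_esize_input_log (x a).
have Bi : bounded_config i (esize (input_log (x a)).2) (iter i log_step (log_init (x a))).
  by elim: (i) => [|j IH]; [apply: bounded_init | rewrite iterS; apply: bounded_step].
have := bounded_esize Bi.
move/leq_trans; apply.
rewrite leq_add2r leq_add2l leq_mul2l /= leq_mul2l /= leq_add2r.
by rewrite leq_add // ?leq_mul // ?leq_add // leq_mul2l.
Qed.

Lemma FP_log_out A {EA : Enc A} (phi : S -> bool) (s : A -> log_config) i : FP s ->
  FP (fun a => let l := ((s a).2.1 i).2 in [seq phi b | b <- log_prefix l (size l)]).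
Proof. by move=> Ps; apply: FP_log_prefix; apply: FP_comp (FP_snd (FP_log_tape i)) Ps. Qed.

Lemma FP_log_verdict A {EA : Enc A} (s : A -> log_config) : FP s ->
  FP (fun a => verdict (s a).1 == Some true).
Proof.
move=> /FP_fst Ps.
apply: (@FP_fincase _ _ _ _ _ (fun a => (s a).1) (fun q _ => verdict q == Some true) Ps) => q.
exact: FP_const.
Qed.

End Simulator.

(** * Runs of given length as polynomial-time functions *)

Section Runs.
Context {A : Type} {EA : Enc A}.

Definition sym_bit (T : Type) (b : bool + T) : bool := if b is inl c then c else false.

Lemma gstep_tm (M : tm) x t :
  (iter t (@gstep M pred0 (fun _ _ => [ffun => (None, MoveS)]))
    (init M x, [ffun => tape_of [::]])).1 = run M x t.
Proof.
elim: t => // t IH; rewrite iterS /run iterS -/(run M x t) -IH.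
by rewrite /gstep /step; case: ifP => // _; rewrite /gnext; case: (next _).
Qed.

Lemma FP_run_output (M : tm) (n : A -> nat) (x : A -> seq bool) : FP n -> FP x ->
  FP (fun a => [seq sym_bit b |
    b <- contents ((run M (x a) (n a)).2 (out_tape (nwork M)))]).
Proof.
move=> Pn Px; pose ixd (q : state M) (r : {ffun 'I_(nwork M).+2 -> option (bool + aux M)}) :
  {ffun 'I_(nwork M).+2 -> option bool * move} := [ffun => (None, MoveS)].
have Ps := FP_log_run pred0 ixd Pn Px.
apply: FP_ext (FP_log_out (@sym_bit (aux M)) (out_tape (nwork M)) Ps) => a /=.
have [_ At _] := agree_iter pred0 ixd (x a) (n a).
by rewrite -(agree_contents (At _)) gstep_tm.
Qed.

Lemma FP_run_verdict (M : tm) (n : A -> nat) (x : A -> seq bool) : FP n -> FP x ->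
  FP (fun a => verdict (run M (x a) (n a)).1 == Some true).
Proof.
move=> Pn Px; pose ixd (q : state M) (r : {ffun 'I_(nwork M).+2 -> option (bool + aux M)}) :
  {ffun 'I_(nwork M).+2 -> option bool * move} := [ffun => (None, MoveS)].
have Ps := FP_log_run pred0 ixd Pn Px.
apply: FP_ext (FP_log_verdict Ps) => a /=.
have [Eq _ _] := agree_iter pred0 ixd (x a) (n a).
by rewrite -Eq gstep_tm.
Qed.

Lemma FP_rrun_verdict (M : ratm) (n : A -> nat) (x : A -> seq bool) : FP n -> FP x ->
  FP (fun a => verdict (rrun M (x a) (n a)).1.1 == Some true).
Proof.
move=> Pn Px; have Ps := FP_log_run (pred1 (access M)) (@index_delta M) Pn Px.
apply: FP_ext (FP_log_verdict Ps) => a /=.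
by have [<- _ _] := agree_iter (pred1 (access M)) (@index_delta M) (x a) (n a).
Qed.

End Runs.

Lemma FP_poly c : FP (fun x : seq bool => poly c (size x)).
Proof.
by apply: FP_addn; [apply: FP_expn; apply: FP_size | ]; fp.
Qed.

Lemma sym_bitK T (w : word) : [seq sym_bit b | b <- [seq (inl b : bool + T) | b <- w]] = w.
Proof. by rewrite -map_comp map_id. Qed.

Lemma polytime_fun_FP (f : word -> word) : polytime_fun f -> FP f.
Proof.
move=> [M [c H]]; apply: FP_ext (FP_run_output M (FP_poly c) FP_id) => x.
by have [_ ->] := H x; apply: sym_bitK.
Qed.

Lemma PTIME_FP (L : language) : PTIME L -> exists2 f : word -> bool, FP f & forall x, f x <-> L x.
Proof.
move=> [M [c H]]; exists (fun x => verdict (run M x (poly c (size x))).1 == Some true).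
  exact: FP_run_verdict (FP_poly c) FP_id.
by move=> x; have [b -> <-] := H x; case: b.
Qed.

(** * Evaluation of described circuits *)

Definition ones (w : word) : nat :=
  (foldl (fun c b => if c.1 && b then (true, c.2.+1) else (false, c.2)) (true, 0) w).2.

Lemma ones_nat_code k w : ones (nat_code k ++ w) = k.
Proof.
rewrite /ones -catA /= -[RHS]addn0; elim: k 0 => [|k IH] m /=.
  by rewrite add0n; elim: w => //= b w.
by rewrite IH addnS.
Qed.

Lemma drop_nat_code k w : drop k.+1 (nat_code k ++ w) = w.
Proof. by rewrite drop_size_cat // size_cat size_nseq addn1. Qed.

Definition gate_step (x : word) (c : word * word) : word * word :=
  let: (w, v) := c in
  let w3 := drop 3 w in
  let i := ones w3 in let w4 := drop i.+1 w3 in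
  let j := ones w4 in let w5 := drop j.+1 w4 in
  if nth false w 0 then
    if nth false w 1 then (w, v) else (w5, rcons v (nth false v i || nth false v j))
  else if nth false w 1 then
    if nth false w 2 then (w5, rcons v (nth false v i && nth false v j))
    else (w4, rcons v (~~ nth false v i))
  else
    if nth false w 2 then (behead w3, rcons v (seq.head false w3))
    else (w4, rcons v (nth false x i)).

Lemma gate_step_code x g w v :
  gate_step x (gate_code g ++ w, v) = (w, rcons v (gate_value x v g)).
Proof.
by case: g => [i|b|j|j k|j k]; rewrite /gate_step /= ?drop0
  -?(catA (nat_code _)) ?(ones_nat_code, drop_nat_code).
Qed.

Definition output_step (v : word) (c : word * word) : word * word :=
  let: (w, o) := c in
  if nilp w then (w, o) else (drop (ones w).+1 w, rcons o (nth false v (ones w))).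

(** Every gate and every output takes at least one letter of [d], so [size d] rounds suffice.
    Further rounds do no harm: [gate_step] is stationary at the mark 111 and [output_step] at the
    empty word. *)
Definition eval_code (d x : word) : word :=
  let: (w, v) := iter (size d) (gate_step x) (d, [::]) in
  (iter (size d) (output_step v) (drop 3 w, [::])).2.

Lemma iter_fix T (f : T -> T) n m x y : iter m f x = y -> f y = y -> m <= n -> iter n f x = y.
Proof.
move=> <- E /subnK <-; rewrite iterD; elim: (n - m) => //= k ->.
exact: E.
Qed.

Lemma eval_circuit_code C x : eval_code (circuit_code C) x = circuit_eval C x.
Proof.
rewrite /eval_code; set d := circuit_code C.
set v := foldl (fun v g => rcons v (gate_value x v g)) [::] (gates C).
set os := flatten [seq nat_code j | j <- outputs C].
have le_g : size (gates C) <= size d.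
  rewrite /d /circuit_code size_cat; apply: leq_trans (leq_addr _ _).
  by elim: (gates C) => //= g s IH; rewrite size_cat -add1n leq_add //; case: g.
have le_o : size (outputs C) <= size d.
  rewrite /d /circuit_code !size_cat; apply: leq_trans (leq_addl _ _); apply: leq_trans (leq_addl _ _).
  by elim: (outputs C) => //= j s IH; rewrite size_cat -add1n leq_add //; case: j.
have Eg s u : iter (size s) (gate_step x)
      (flatten [seq gate_code g | g <- s] ++ [:: true; true; true] ++ os, u) =
    ([:: true; true; true] ++ os, foldl (fun v g => rcons v (gate_value x v g)) u s).
  elim: s u => [|g s IH] u //.
  by rewrite [size _]/= iterSr [flatten _]/= -catA gate_step_code; exact: IH.
have Eo s u : iter (size s) (output_step v) (flatten [seq nat_code j | j <- s], u) =
    ([::], u ++ [seq nth false v j | j <- s]).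
  elim: s u => [|j s IH] u; first by rewrite cats0.
  rewrite [size _]/= iterSr [flatten _]/= {2}/output_step.
  have -> : nilp (nat_code j ++ flatten [seq nat_code j | j <- s]) = false by case: j.
  by rewrite ones_nat_code drop_nat_code IH /= cat_rcons.
rewrite (iter_fix (Eg _ [::])) //= drop0.
by rewrite (iter_fix (Eo _ [::])).
Qed.

Section EvalFP.
Context {A : Type} {EA : Enc A}.

Lemma FP_ones (w : A -> seq bool) : FP w -> FP (fun a => ones (w a)).
Proof.
move=> Pw; have Pl : FP (fun a => foldl (fun c b => if c.1 && b then (true, c.2.+1)
    else (false, c.2)) (true, 0) (w a)).
  apply: (FP_foldl_add (f := fun p : A * ((bool * nat) * bool) =>
    if p.2.1.1 && p.2.2 then (true, p.2.1.2.+1) else (false, p.2.1.2))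
    (z := fun _ => (true, 0)) (q := fun _ => 10) Pw).
  - apply: FP_if; first by apply: FP_andb; fp.
      by apply: FP_pair; fp; apply: FP_succn; fp.
    by fp.
  - by fp.
  - by pbound.
  - by move=> a [b n] b'; rewrite /= !esize_pair; case: ifP => _; rewrite /= !esize_nat;
      case/andP: (esize_bool b); case/andP: (esize_bool b'); rewrite ?esize_true ?esize_false; lia.
exact: FP_snd Pl.
Qed.

Lemma FP_odrop (w : A -> seq bool) : FP w -> FP (fun a => drop (ones (w a)).+1 (w a)).
Proof. by move=> Pw; apply: FP_drop => //; apply: FP_succn; apply: FP_ones. Qed.

End EvalFP.

Lemma esize_rcons_bit (v : seq bool) b : esize (rcons v b) <= esize v + 4.
Proof.
have E : (esize (v ++ [:: b])).+1 = esize v + esize [:: b] by exact: esize_cat.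
by rewrite cats1 esize_cons esize_nil in E; case/andP: (esize_bool b); lia.
Qed.

Lemma FP_eval_code A {EA : Enc A} (d x : A -> seq bool) :
  FP d -> FP x -> FP (fun a => eval_code (d a) (x a)).
Proof.
move=> Pd Px; have Pn := FP_size Pd.
pose T := (A * (seq bool * seq bool))%type.
have Pw : FP (fun p : T => p.2.1) by fp.
have Pv : FP (fun p : T => p.2.2) by fp.
have Px' : FP (fun p : T => x p.1) by apply: FP_comp Px (FP_fst FP_id).
have P3 : FP (fun p : T => drop 3 p.2.1) by apply: FP_drop; fp.
have Pi := FP_ones P3; have P4 := FP_odrop P3; have Pj := FP_ones P4; have P5 := FP_odrop P4.
have Pb k : FP (fun p : T => nth false p.2.1 k) by apply: FP_nth; fp.
have Pvi := FP_nth false Pv Pi; have Pvj := FP_nth false Pv Pj.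
have Pg : FP (fun p : T => gate_step (x p.1) p.2).
  apply: (@FP_ext _ _ _ _ (fun p : T =>
    if nth false p.2.1 0 then if nth false p.2.1 1 then p.2 else
      (drop (ones (drop (ones (drop 3 p.2.1)).+1 (drop 3 p.2.1))).+1
         (drop (ones (drop 3 p.2.1)).+1 (drop 3 p.2.1)),
       rcons p.2.2 (nth false p.2.2 (ones (drop 3 p.2.1)) ||
         nth false p.2.2 (ones (drop (ones (drop 3 p.2.1)).+1 (drop 3 p.2.1)))))
    else if nth false p.2.1 1 then if nth false p.2.1 2 then
      (drop (ones (drop (ones (drop 3 p.2.1)).+1 (drop 3 p.2.1))).+1
         (drop (ones (drop 3 p.2.1)).+1 (drop 3 p.2.1)),
       rcons p.2.2 (nth false p.2.2 (ones (drop 3 p.2.1)) &&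
         nth false p.2.2 (ones (drop (ones (drop 3 p.2.1)).+1 (drop 3 p.2.1)))))
      else (drop (ones (drop 3 p.2.1)).+1 (drop 3 p.2.1),
        rcons p.2.2 (~~ nth false p.2.2 (ones (drop 3 p.2.1))))
    else if nth false p.2.1 2 then
      (behead (drop 3 p.2.1), rcons p.2.2 (seq.head false (drop 3 p.2.1)))
      else (drop (ones (drop 3 p.2.1)).+1 (drop 3 p.2.1),
        rcons p.2.2 (nth false (x p.1) (ones (drop 3 p.2.1)))))).
    by move=> [a [w v]].
  apply: FP_if => //; apply: FP_if => //; try by fp.
  - by apply: FP_pair => //; apply: FP_rcons => //; apply: FP_orb.
  - apply: FP_if => //; apply: FP_pair => //; apply: FP_rcons => //; first exact: FP_andb.
    exact: FP_negb.
  - apply: FP_if => //; apply: FP_pair; [by fp| |by []|].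
      by apply: FP_rcons => //; fp.
    by apply: FP_rcons => //; apply: FP_nth.
have Pgs : FP (fun a => iter (size (d a)) (gate_step (x a)) (d a, [::])).
  apply: (FP_iter_add (f := fun p : T => gate_step (x p.1) p.2) (q := fun _ => 10) Pn Pg).
  - by fp.
  - by pbound.
  move=> a [w v]; rewrite [(_, _).2]/= [(_, _).1]/= /gate_step.
  set w3 := drop 3 w; set w4 := drop _ w3; set w5 := drop _ w4.
  have l3 : esize w3 <= esize w by apply: esize_drop.
  have l4 : esize w4 <= esize w by apply: leq_trans (esize_drop _ _) l3.
  have l5 : esize w5 <= esize w by apply: leq_trans (esize_drop _ _) l4.
  have l6 : esize (behead w3) <= esize w by rewrite -drop1; apply: leq_trans (esize_drop _ _) l3.
  have h (w' : seq bool) b : esize w' <= esize w -> esize (w', rcons v b) <= esize (w, v) + 10.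
    move=> le; rewrite !esize_pair [(_, _).1]/= [(_, _).2]/= addSn ltnS.
    apply: leq_trans (leq_add le (esize_rcons_bit v b)) _.
    by rewrite addnA leq_add2l.
  by do !case: ifP => _; first [exact: leq_addr | exact: h].
pose v a := (iter (size (d a)) (gate_step (x a)) (d a, [::])).2.
have Pvv : FP v by apply: FP_snd Pgs.
have Po : FP (fun p : T => output_step (v p.1) p.2).
  apply: (@FP_ext _ _ _ _ (fun p : T => if nilp p.2.1 then p.2 else
      (drop (ones p.2.1).+1 p.2.1, rcons p.2.2 (nth false (v p.1) (ones p.2.1))))).
    by move=> [a [w o]].
  apply: FP_if; [by fp | by fp | apply: FP_pair; first exact: FP_odrop].
  apply: FP_rcons => //; apply: FP_nth; last exact: FP_ones.
  exact: FP_comp Pvv (FP_fst FP_id).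
apply: (@FP_ext _ _ _ _ (fun a => (iter (size (d a)) (output_step (v a))
   (drop 3 (iter (size (d a)) (gate_step (x a)) (d a, [::])).1, [::])).2)).
  by move=> a; rewrite /eval_code /v; case: (iter _ (gate_step _) _).
apply: FP_snd; apply: (FP_iter_add (f := fun p : T => output_step (v p.1) p.2)
   (q := fun _ => 10) Pn Po).
- by apply: FP_pair; [apply: FP_drop; [fp | exact: FP_fst Pgs] | fp].
- by pbound.
move=> a [w o]; rewrite [(_, _).2]/= [(_, _).1]/= /output_step; case: ifP => _.
  exact: leq_addr.
rewrite !esize_pair [(_, _).1]/= [(_, _).2]/= addSn ltnS.
apply: leq_trans (leq_add (esize_drop _ _) (esize_rcons_bit _ _)) _.
by rewrite addnA leq_add2l.
Qed.

(** Read from the right, the first 1 is the end mark, and all that comes after it is kept. *)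
Definition unpad (y : word) : word :=
  (foldl (fun c b => if c.1 then (true, b :: c.2) else (b, c.2)) (false, [::]) (rev y)).2.

Lemma unpadK w j : unpad (w ++ true :: nseq j false) = w.
Proof.
rewrite /unpad rev_cat rev_cons rev_nseq foldl_cat -cats1 foldl_cat /=.
have -> (u : word) : foldl (fun c b => if c.1 then (true, b :: c.2) else (b, c.2)) (false, u)
  (nseq j false) = (false, u) by elim: j.
rewrite /= -[RHS]cats0 -[w in RHS]revK -catrevE; elim: (rev w) [::] => //= b s IH u.
Qed.

Lemma FP_unpad A {EA : Enc A} (y : A -> seq bool) : FP y -> FP (fun a => unpad (y a)).
Proof.
move=> Py; apply: FP_snd; apply: (FP_foldl_add (f := fun p : A * ((bool * seq bool) * bool) =>
    if p.2.1.1 then (true, p.2.2 :: p.2.1.2) else (p.2.2, p.2.1.2))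
    (z := fun _ => (false, [::])) (q := fun _ => 10) (FP_rev Py)).
- by fp.
- by fp.
- by pbound.
by move=> a [b w] b'; rewrite /= !esize_pair; case: ifP => _; rewrite /= ?esize_cons;
  case/andP: (esize_bool b); case/andP: (esize_bool b'); rewrite ?esize_true; lia.
Qed.

(** * Logarithmic space is contained in polynomial time *)

Section Logspace.
Variables (M : tm) (x : word) (s : nat).
Hypotheses (ow : one_way_output M) (sp : in_space M x s).

Local Notation I := 'I_(nwork M).+2.
Local Notation it := (in_tape (nwork M)).
Local Notation ot := (out_tape (nwork M)).

(* The output tape, which cannot influence the run, is left out. *)
Definition same_view (c c' : config M) : Prop :=
  c.1 = c'.1 /\ forall i, i != ot ->
    head (c.2 i) = head (c'.2 i) /\ forall p, cell (c.2 i) p = cell (c'.2 i) p.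

Lemma same_view_step c c' : same_view c c' -> same_view (step c) (step c').
Proof.
move=> [Eq Et]; rewrite /step /halted Eq; case: ifP => // _.
have Ed : delta c.1 (scan c) = delta c'.1 (scan c').
  rewrite Eq; apply: ow.1 => i ne_i; rewrite !ffunE !readE.
  by have [-> ->] := Et i ne_i.
rewrite /next Ed; case: (delta _ _) => q act; split=> //= i ne_i.
have [Eh Ec] := Et i ne_i; rewrite !ffunE /=; case: (i == it); split=> [|p].
- by rewrite Eh.
- exact: Ec.
- by rewrite !head_write Eh.
- by rewrite !cell_move !cell_write Eh Ec.
Qed.

Lemma same_view_iter c c' k : same_view c c' ->
  same_view (iter k (@step M) c) (iter k (@step M) c').
Proof. by move=> E; elim: k => //= k; apply: same_view_step. Qed.

Lemma input_cells t p : cell ((run M x t).2 it) p = cell ((init M x).2 it) p.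
Proof.
elim: t => // t IH; rewrite /run iterS -/(run M x t) /step; case: ifP => // _.
by rewrite /next; case: (delta _ _) => q act /=; rewrite ffunE eqxx cell_move.
Qed.

Lemma work_cells t (i : I) p : (1 < i)%N -> cell ((run M x t).2 i) p <> None ->
  (`|p| <= s%:Z)%R.
Proof.
move=> lt_i; have ne_in : (i == it) = false by apply/eqP => E; rewrite E in lt_i.
elim: t => [|t IH].
  by rewrite /= ffunE ne_in /cell; case: p => n; rewrite /= nth_nil.
rewrite /run iterS -/(run M x t) /step; case: ifP => // _.
rewrite /next; case: (delta _ _) => q act /=; rewrite ffunE ne_in cell_move cell_write.
by case: eqP => // -> _; have [_ /(_ lt_i)] := sp t i.
Qed.

(** Finitely many data that determine a reachable configuration up to [same_view]: the input head
    has [size x + 2] possible positions, and a work tape is blank beyond distance [s]. *)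
Definition view : finType :=
  (state M * ('I_(size x).+2 * ({ffun I -> 'I_(2 * s).+1} *
    {ffun I * 'I_(2 * s).+1 -> option (bool + aux M)})))%type.

Definition view_of (c : config M) : view :=
  (c.1, (inord `|(head (c.2 it) + 1)%R|,
    ([ffun i => inord `|(head (c.2 i) + s%:Z)%R|],
     [ffun ij : I * 'I_(2 * s).+1 => cell (c.2 ij.1) (ij.2%:Z - s%:Z)%R]))).

Lemma inord_inj_abs n (a b : int) : (0 <= a <= n%:Z)%R -> (0 <= b <= n%:Z)%R ->
  inord `|a| = inord `|b| :> 'I_n.+1 -> a = b.
Proof. by move=> Ha Hb /(congr1 val); rewrite /= !inordK; lia. Qed.

Lemma view_of_inj t t' : view_of (run M x t) = view_of (run M x t') ->
  same_view (run M x t) (run M x t').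
Proof.
case=> Eq Ei Eh Ec; split=> // i ne_i.
have [Ein|ne_in] := eqVneq i it.
  rewrite Ein; split=> [|p]; last by rewrite !input_cells.
  have [/(_ erefl) h _] := sp t it; have [/(_ erefl) h' _] := sp t' it.
  by apply: (@GRing.addIr _ 1%R); apply: inord_inj_abs Ei; lia.
have lt_i : (1 < i)%N.
  have : nat_of_ord i != 0 by apply: contra_neq ne_in => E; apply: val_inj.
  have : nat_of_ord i != 1 by apply: contra_neq ne_i => E; apply: val_inj.
  by case: (nat_of_ord i) => [|[]].
split=> [|p].
  have [_ /(_ lt_i) h] := sp t i; have [_ /(_ lt_i) h'] := sp t' i.
  move/ffunP/(_ i): Eh; rewrite !ffunE => /inord_inj_abs E.
  by apply: (@GRing.addIr _ (s%:Z)%R); apply: E; lia.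
have [le_p|lt_p] := boolP (`|p| <= s%:Z)%R.
  have lt_j : `|(p + s%:Z)%R| < (2 * s).+1 by lia.
  move/ffunP/(_ (i, Ordinal lt_j)): Ec; rewrite !ffunE /=.
  by have -> : (`|(p + s%:Z)%R|%:Z - s%:Z)%R = p by lia.
have none u : cell ((run M x u).2 i) p = None.
  case E: (cell _ _) => [a|] //; case/negP: lt_p; apply: (@work_cells u i) => //.
  by rewrite E.
by rewrite !none.
Qed.

(** If two views at times [t1 < t2] up to the first halting time were equal, the machine would
    already halt [t2 - t1] steps earlier. So the views up to that time are distinct. *)
Lemma logspace_halts t : halted (run M x t) -> halted (run M x #|view|).
Proof.
move=> Ht; have ex : exists t, halted (run M x t) by exists t.
case: (ex_minnP ex) => T HT minT.
rewrite (run_halted HT) //.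
have inj : injective (fun t : 'I_T.+1 => view_of (run M x t)).
  move=> t1 t2; wlog lt12 : t1 t2 / t1 < t2 => [W|] E.
    by case: (ltngtP t1 t2) => [/W->|/W->|/val_inj].
  have E2 := same_view_iter (T - t2) (view_of_inj E).
  rewrite /run -!iterD subnK in E2; last by have := ltn_ord t2; lia.
  have Hh : halted (run M x (T - t2 + t1)) by rewrite /halted /run E2.1.
  by have := minT _ Hh; have := ltn_ord t2; lia.
by have := leq_card _ inj; rewrite card_ord; lia.
Qed.

Lemma card_view : #|view| = #|{: state M}| * ((size x).+2 * ((2 * s).+1 ^ (nwork M).+2 *
  #|{: option (bool + aux M)}| ^ ((nwork M).+2 * (2 * s).+1))).
Proof. by rewrite !card_prod !card_ffun !card_prod !card_ord. Qed.

End Logspace.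

Lemma pbounded_id : pbounded (fun n : nat => n).
Proof. by apply: pbounded_leq pbounded_esize => n; rewrite esize_nat; lia. Qed.

(** An exponential of a logarithm is polynomial: [g <= 2 ^ g] reduces the count of tape inscriptions
    to powers of [2 ^ trunc_log 2 n], which is at most [n + 1]. *)
Lemma pbounded_card_view q K g c : pbounded (fun n : nat =>
  q * (n.+2 * ((2 * (c * trunc_log 2 n + c)).+1 ^ K *
    g ^ (K * (2 * (c * trunc_log 2 n + c)).+1)))).
Proof.
have pi := pbounded_id.
have le_log n : trunc_log 2 n <= n.
  case: n => // n; have := trunc_logP (isT : 1 < 2) (isT : 0 < n.+1).
  by have := ltn_expl (trunc_log 2 n.+1) (isT : 1 < 2); lia.
have le_exp n : 2 ^ trunc_log 2 n <= n + 1.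
  by case: n => // n; apply: leq_trans (trunc_logP _ _) _ => //; rewrite addn1.
apply: (@pbounded_leq _ _ _ (fun n => q * ((n + 2) * ((2 * (c * n + c) + 1) ^ K *
   ((n + 1) ^ (2 * c * g * K) * 2 ^ (g * K * (2 * c + 1))))))); last by pbound.
move=> n; rewrite leq_mul2l; apply/orP; right; rewrite addn2 leq_mul2l /=.
apply: leq_mul.
  by apply: leq_exp2; rewrite addn1 ltnS leq_mul2l /= leq_add2r leq_mul2l le_log orbT.
apply: leq_trans (_ : (2 ^ g) ^ (K * (2 * (c * trunc_log 2 n + c)).+1) <= _).
  by apply: leq_exp2; apply: ltnW; apply: ltn_expl.
rewrite -expnM (_ : g * _ = trunc_log 2 n * (2 * c * g * K) + g * K * (2 * c + 1)); last by nia.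
by rewrite expnD; apply: leq_mul => //; rewrite [leqLHS]expnM; apply: leq_exp2.
Qed.

Lemma logspace_uniform_FP C : logspace_uniform C ->
  FP (fun x : word => circuit_code (C (size x))).
Proof.
move=> [M [c [ow H]]].
have [d led] := pbounded_card_view #|{: state M}| (nwork M).+2 #|{: option (bool + aux M)}| c.
have Px : FP (fun x : seq bool => nseq (size x) true) by apply: FP_nseq; [apply: FP_size; fp | fp].
(* This is the bound [(esize n).+2 ^ d] at [n = size x], as [esize n] is [n.*2.+1]. *)
have Pn : FP (fun x : seq bool => (size x + size x + 3) ^ d).
  by apply: FP_expn; do 2?apply: FP_addn; try apply: FP_size; fp.
apply: FP_ext (FP_run_output M Pn Px) => x; set n := size x.
have [sp [t [Ht Et]]] := H n.
have Hv := logspace_halts ow sp Ht.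
have le_v : #|view M (nseq n true) (c * trunc_log 2 n + c)| <= (n + n + 3) ^ d.
  rewrite card_view size_nseq; apply: leq_trans (led n) _; apply: leq_exp2.
  by rewrite esize_nat; lia.
have Er u : halted (run M (nseq n true) u) -> run M (nseq n true) u = run M (nseq n true) t.
  move=> Hu; case/orP: (leq_total u t) => le; first by rewrite (run_halted Hu le).
  by rewrite (run_halted Ht le).
by rewrite (run_halted Hv le_v) (Er _ Hv) Et sym_bitK.
Qed.

Lemma nc_fun_FP f : nc_fun f -> FP f.
Proof.
move=> [C [c [lu _ _ H]]]; have Pc := logspace_uniform_FP lu.
apply: FP_ext (FP_unpad (FP_eval_code Pc FP_id)) => x.
by rewrite eval_circuit_code; have [j ->] := H x; rewrite unpadK.
Qed.

(** * Problems that can be made pseudo-tractable are in P *)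

Lemma FP_double A {EA : Enc A} (w : A -> seq bool) : FP w -> FP (fun a => double (w a)).
Proof.
move=> Pw; apply: FP_ext (FP_foldl_add (f := fun p : A * (seq bool * bool) =>
  p.2.2 :: p.2.2 :: p.2.1) (z := fun _ => [::]) (q := fun _ => 10) (FP_rev Pw) _ _ _ _).
- by move=> a; rewrite foldl_rev /double; elim: (w a) => //= b u ->.
- by fp.
- by fp.
- by pbound.
- by move=> a u b; rewrite /= !esize_cons; case/andP: (esize_bool b); lia.
Qed.

Lemma FP_pair_code A {EA : Enc A} (D Q : A -> seq bool) : FP D -> FP Q ->
  FP (fun a => pair_code (D a) (Q a)).
Proof.
move=> PD PQ; apply: FP_cat; first exact: FP_double.
by apply: FP_cat; [fp | exact: FP_double].
Qed.

Lemma rrun_halted (M : ratm) x t t' : halted (rrun M x t).1 -> t <= t' ->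
  rrun M x t' = rrun M x t.
Proof.
move=> Ht /subnK <-; rewrite addnC /rrun addnC iterD.
by elim: (t' - t) => //= n ->; rewrite /rstep -/(rrun M x t) Ht.
Qed.

(** A time bound [t] need not be computable, but [n + B] is, and a halted machine keeps its verdict
    when it is run longer. [B] covers the values of [t] below the threshold for the factor 1. *)
Lemma little_o_bounded t : little_o t -> exists B, forall n, t n <= n + B.
Proof.
move=> /(_ 1) [n0 H]; exists (\max_(i < n0) t i) => n.
have [le_n|lt_n] := leqP n0 n; first by have := H n le_n; lia.
by apply: leq_trans (leq_addl _ _); apply: (leq_bigmax (Ordinal lt_n)).
Qed.

Lemma pseudo_tractable_PTIME L (U : factorization L) cond :
  pseudo_tractable cond (pair_language U) -> PTIME L.
Proof.
move=> [Pi [S' [/polytime_fun_FP PPi ES _ [M [t [/little_o_bounded[B le_t] HM]]]]]].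
have P1 := nc_fun_FP (pi1_nc U); have P2 := nc_fun_FP (pi2_nc U).
have [g /nc_fun_FP Pg Eg] := rho_nc U.
have Pc := FP_pair_code (FP_comp PPi P1) P2.
have Pn : FP (fun x : seq bool => size (pi1 U x) + B).
  by apply: FP_addn; [exact: FP_size P1 | fp].
have Pv := FP_rrun_verdict M Pn Pc.
have Pr : FP (fun x : seq bool => g (pair_code (pi1 U x) (pi2 U x)) == x).
  apply: (@FP_eq _ _ _ _ _ _ (fun y z => y == z)); last exact: FP_id.
  - exact: enc_seq_inj enc_bool_inj.
  - by move=> y z; apply: eqP.
  - exact: FP_comp Pg (FP_pair_code P1 P2).
have := FP_PTIME (FP_andb Pv Pr); congr (PTIME _); apply/funext => x; apply/propext.
have Ev : verdict (rrun M (pair_code (Pi (pi1 U x)) (pi2 U x)) (size (pi1 U x) + B)).1.1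
    == Some true <-> S' (Pi (pi1 U x), pi2 U x).
  have [b Eb <-] := HM (pi1 U x) (pi2 U x).
  rewrite (@rrun_halted _ _ (t (size (pi1 U x)))) ?le_t /halted ?Eb //.
  by case: b {Eb}.
rewrite Eg; split=> [/andP[/Ev/ES [y Ly [E1 E2]] /eqP Er]|Lx].
  (* The pair of [x] is also that of some [y] in [L]; the value of [rho] there is [y] by the
     factorization and [x] by the test. *)
  by rewrite -Er -E1 -E2 (rhoK U Ly).
rewrite (rhoK U Lx) eqxx andbT; apply/Ev/ES; by exists x.
Qed.

Lemma PTP_PTIME L : PTP L -> PTIME L.
Proof. by move=> [U [] H]; apply: pseudo_tractable_PTIME H. Qed.

(** * Stack programs in logarithmic space *)

Section Space.
Variables (x : word) (b : nat).

Definition fits (s : store) : bool :=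
  [&& (-1 <= ipos s <= (size x)%:Z)%R, size (sV s) <= b, size (sW s) <= b,
      size (sX s) <= b & size (sK s) <= b].

Definition leads (c : cmd) (s s' : store) : Prop := exists m, exec x fits c s m s'.

Lemma leads_skip s : leads Skip s s.
Proof. by exists 0; constructor. Qed.

Lemma leads_push k a s : fits (put k (a :: get k s) s) ->
  leads (Push k a) s (put k (a :: get k s) s).
Proof. by move=> f; exists 2; constructor. Qed.

Lemma leads_out a s : fits (emit a s) -> leads (Out a) s (emit a s).
Proof. by move=> f; exists 1; constructor. Qed.

Lemma leads_mv m s : fits (advance m s) -> leads (Mv m) s (advance m s).
Proof. by move=> f; exists 1; constructor. Qed.

Lemma leads_seq c1 c2 s s1 s2 : leads c1 s s1 -> leads c2 s1 s2 -> leads (Seq c1 c2) s s2.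
Proof. by move=> [m1 e1] [m2 e2]; exists (m1 + m2); apply: exec_seq e1 e2. Qed.

Lemma leads_pop k ce cf ct s s' : fits (put k (behead (get k s)) s) ->
  leads (branch (ohead (get k s)) ce cf ct) (put k (behead (get k s)) s) s' ->
  leads (Pop k ce cf ct) s s'.
Proof. by move=> f [m e]; exists (1 + m + 1); constructor. Qed.

Lemma leads_in ce cf ct s s' : leads (branch (input_cell x (ipos s)) ce cf ct) s s' ->
  leads (In ce cf ct) s s'.
Proof. by move=> [m e]; exists (1 + m + 1); constructor. Qed.

Lemma leads_loop_end k cf ct s : get k s = [::] -> leads (Loop k cf ct) s s.
Proof. by move=> E; exists 1; constructor. Qed.

Lemma leads_loop k cf ct s a w s1 s2 : get k s = a :: w -> fits (put k w s) ->
  leads (if a then ct else cf) (put k w s) s1 -> leads (Loop k cf ct) s1 s2 ->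
  leads (Loop k cf ct) s s2.
Proof.
by move=> E f [m1 e1] [m2 e2]; exists (1 + m1 + 1 + m2); apply: exec_loop E f e1 e2.
Qed.

Lemma leads_while_end k c s : ohead (get k s) <> Some true ->
  fits (put k (behead (get k s)) s) -> leads (While k c) s (put k (behead (get k s)) s).
Proof. by move=> E f; exists 1; apply: exec_while_end. Qed.

Lemma leads_while k c s w s1 s2 : get k s = true :: w -> fits (put k w s) ->
  leads c (put k w s) s1 -> leads (While k c) s1 s2 -> leads (While k c) s s2.
Proof.
by move=> E f [m1 e1] [m2 e2]; exists (1 + m1 + 1 + m2); apply: exec_while E f e1 e2.
Qed.

Lemma leads_whilein_end c s : input_cell x (ipos s) = None -> leads (WhileIn c) s s.
Proof. by move=> E; exists 1; constructor. Qed.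

Lemma leads_whilein c s s1 s2 : input_cell x (ipos s) <> None ->
  leads c s s1 -> leads (WhileIn c) s1 s2 -> leads (WhileIn c) s s2.
Proof.
by move=> E [m1 e1] [m2 e2]; exists (1 + m1 + 1 + m2); apply: exec_whilein E e1 e2.
Qed.

(** ** A binary counter on [kV] *)

(** The leading run of ones goes to [kW] as zeros, the next bit or the end of the numeral becomes 1,
    and the zeros are moved back. The single bit on [kK] is the loop condition. *)
Definition incr : cmd :=
  Seq (Push kK true) (Seq (While kK (Pop kV (Push kV true) (Push kV true)
    (Seq (Push kW false) (Push kK true)))) (move_all kW kV)).

(* Moves right as often as the counter says, and clears it; a decrement that
   runs out of bits ends the loop. *)
Definition restore : cmd :=
  Seq (Push kX true) (While kX (Seq (Push kK true) (While kK
    (Pop kV (Loop kW Skip Skip) (Seq (Push kW true) (Push kK true))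
      (Seq (Push kV false) (Seq (move_all kW kV) (Seq (Mv MoveR) (Push kX true)))))))).

(** The head walks to the left end and prints a 1 for each cell that it passes. The binary counter,
    which fits into logarithmic space, remembers the way back. *)
Definition print_pos : cmd :=
  Seq (Mv MoveL) (Seq (WhileIn (Seq (Out true) (Seq incr (Mv MoveL))))
    (Seq (Mv MoveR) restore)).

Local Notation S p o v w y z := (Store p o v w y z).
Hypothesis b_gt0 : 0 < b.

Ltac fit := rewrite /fits /=; lia.

Lemma leads_move_WV p o v w y z : (-1 <= p <= (size x)%:Z)%R ->
  size v + size w <= b -> size y <= b -> size z <= b ->
  leads (move_all kW kV) (S p o v w y z) (S p o (catrev w v) [::] y z).
Proof.
move=> Hp; elim: w v => [|a w IH] v /= lvw ly lz; first exact: leads_loop_end.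
have r := IH (a :: v) ltac:(rewrite /=; lia) ly lz.
apply: (@leads_loop kW) r => //; first by fit.
by case: a; apply: leads_push; fit.
Qed.

Lemma leads_incr p o v y : (-1 <= p <= (size x)%:Z)%R -> size y <= b -> size (binc v) <= b ->
  leads incr (S p o v [::] y [::]) (S p o (binc v) [::] y [::]).
Proof.
move=> Hp ly lv; rewrite /incr; set c := While kK _.
have loop w : size w + size (binc v) <= b -> exists v' w', [/\
    leads c (S p o v w y [:: true]) (S p o v' w' y [::]), size v' + size w' <= b
    & catrev w' v' = catrev w (binc v)].
  elim: v w lv => [|[] v IH] w /= lv lw.
  - exists [:: true], w; split=> //; last by rewrite /=; lia.
    apply: (@leads_while kK); [by [] | by fit | |].
      by apply: leads_pop; [fit | apply: leads_push; fit].
    by apply: (@leads_while_end kK) => //; fit.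
  - have [v' [w' [r l E]]] := IH (false :: w) ltac:(lia) ltac:(rewrite /=; lia).
    exists v', w'; split=> //.
    apply: (@leads_while kK) r; [by [] | by have := size_binc_geq v; fit |].
    have := size_binc_geq v => lb.
    apply: leads_pop; first by fit.
    apply: leads_seq; first by apply: leads_push; fit.
    by apply: leads_push; fit.
  - exists (true :: v), w; split=> //; last by rewrite /=; lia.
    apply: (@leads_while kK); [by [] | by fit | |].
      by apply: leads_pop; [fit | apply: leads_push; fit].
    by apply: (@leads_while_end kK) => //; fit.
have [v' [w' [r l E]]] := loop [::] lv.
apply: leads_seq; first by apply: leads_push; have := size_binc_geq v; fit.
apply: leads_seq r _; rewrite -[binc v]E.
exact: leads_move_WV.
Qed.

Lemma leads_clear_W p o v w y z : (-1 <= p <= (size x)%:Z)%R ->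
  size v <= b -> size w <= b -> size y <= b -> size z <= b ->
  leads (Loop kW Skip Skip) (S p o v w y z) (S p o v [::] y z).
Proof.
move=> Hp lv; elim: w => [|a w IH] /= lw ly lz; first exact: leads_loop_end.
have r := IH (ltnW lw) ly lz.
apply: (@leads_loop kW) r => //; first by fit.
by case: a; apply: leads_skip.
Qed.

Lemma leads_restore p o v : (-1 <= p)%R -> (p + (lsb_value v)%:Z <= (size x)%:Z)%R ->
  size v <= b ->
  leads restore (S p o v [::] [::] [::]) (S (p + (lsb_value v)%:Z)%R o [::] [::] [::] [::]).
Proof.
rewrite /restore; set cX := While kX _; set cK := While kK _ in cX *.
(* Decrements leave zeros at the top of the numeral, so the end is characterized by the value 0 and
   not by an empty counter. *)
have dec0 u w q : (-1 <= q <= (size x)%:Z)%R -> size w + size u <= b -> lsb_value u = 0 ->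
    leads cK (S q o u w [::] [:: true]) (S q o [::] [::] [::] [::]).
  move=> Hq; elim: u w => [|[] u IH] w /= l E; last 2 first.
  - by rewrite addn1 in E.
  - have r := IH (true :: w) ltac:(rewrite /=; lia) ltac:(lia).
    apply: (@leads_while kK) r; [by [] | by fit |].
    apply: leads_pop; first by fit.
    by apply: leads_seq; apply: leads_push; fit.
  apply: (@leads_while kK); [by [] | by fit | |].
    apply: leads_pop; first by fit.
    by apply: leads_clear_W => //; lia.
  by apply: (@leads_while_end kK) => //; fit.
have dec u w q : (-1 <= q)%R -> (q + 1 <= (size x)%:Z)%R ->
    size w + size u <= b -> 0 < lsb_value u ->
    leads cK (S q o u w [::] [:: true])
      (S (q + 1)%R o (catrev w (bsub1 u)) [::] [:: true] [::]).
  move=> Hq Hq'; elim: u w => [|[] u IH] w //= l lt.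
    apply: (@leads_while kK); [by [] | by fit | |].
      apply: leads_pop; first by fit.
      apply: leads_seq; first by apply: leads_push; fit.
      apply: leads_seq; first by apply: leads_move_WV => //=; lia.
      apply: leads_seq; first by apply: leads_mv; rewrite /= catrevE /fits /= size_cat size_rev /=; lia.
      by apply: leads_push; rewrite /= catrevE /fits /= size_cat size_rev /=; lia.
    by apply: (@leads_while_end kK) => //; rewrite /= catrevE /fits /= size_cat size_rev /=; lia.
  have r := IH (true :: w) ltac:(rewrite /=; lia) ltac:(lia).
  apply: (@leads_while kK) r; [by [] | by fit |].
  apply: leads_pop; first by fit.
  by apply: leads_seq; apply: leads_push; fit.
move=> Hp Hp' lv; apply: leads_seq; first by apply: leads_push; fit.
move E: (lsb_value v) Hp' => k; elim: k p v lv E Hp => [|k IH] p v lv E Hp Hp'.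
  rewrite GRing.addr0; apply: (@leads_while kX); [by [] | by fit | |].
    apply: leads_seq; first by apply: leads_push; fit.
    by apply: dec0 => //; lia.
  by apply: (@leads_while_end kX) => //; fit.
have Ev := @lsb_value_bsub1 v ltac:(lia).
have ls : size (bsub1 v) <= b.
  by rewrite (_ : size (bsub1 v) = size v) //; elim: (v) => // -[] u //= ->.
have -> : (p + k.+1%:Z)%R = (p + 1 + k%:Z)%R by lia.
have r := IH (p + 1)%R (bsub1 v) ls ltac:(lia) ltac:(lia) ltac:(lia).
apply: (@leads_while kX) r; [by [] | by fit |].
apply: leads_seq; first by apply: leads_push; fit.
by apply: (dec v [::]) => //; lia.
Qed.

Hypothesis bits_fit : forall n, n <= size x -> size (bits n) <= b.

Lemma input_cell_lt (i : nat) : i < size x -> input_cell x i <> None.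
Proof. by move=> lt_i; rewrite input_cellE. Qed.

Lemma input_cell_end : input_cell x (size x) = None.
Proof. by rewrite /= nth_default ?size_map. Qed.

Lemma leads_print_pos (q : nat) o : q <= size x ->
  leads print_pos (S q o [::] [::] [::] [::]) (S q (o ++ nseq q true) [::] [::] [::] [::]).
Proof.
move=> le_q; rewrite /print_pos; set cI := WhileIn _.
have loop j k u : j + k = q -> leads cI (S (j%:Z - 1)%R u (bits k) [::] [::] [::])
    (S (-1)%R (u ++ nseq j true) (bits q) [::] [::] [::]).
  elim: j k u => [|j IH] k u E.
    by rewrite add0n in E; rewrite E cats0; apply: leads_whilein_end.
  have r := IH k.+1 (rcons u true) ltac:(lia); rewrite cat_rcons in r.
  have lk := bits_fit (_ : k <= size x); have lk1 := bits_fit (_ : k.+1 <= size x).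
  have {}lk := lk ltac:(lia); have {}lk1 := lk1 ltac:(lia).
  have -> : (j.+1%:Z - 1)%R = Posz j by lia.
  apply: leads_whilein r; first by apply: input_cell_lt; lia.
  apply: leads_seq; first by apply: leads_out; fit.
  apply: leads_seq; first by apply: leads_incr => //; lia.
  have := @leads_mv MoveL (S j (rcons u true) (bits k.+1) [::] [::] [::]).
  rewrite /bits iterS -/(bits k) in lk1 *.
  by rewrite /advance /=; apply; rewrite /fits /=; lia.
apply: leads_seq.
  by apply: (@leads_mv MoveL (S q o [::] [::] [::] [::])); fit.
apply: leads_seq; first exact: (loop q 0 o (addn0 q)).
have lq := bits_fit le_q.
apply: leads_seq.
  by apply: (@leads_mv MoveR); rewrite /fits; cbn [ipos sV sW sX sK size advance shift]; lia.
have := @leads_restore 0%R (o ++ nseq q true) (bits q) isT; rewrite bitsK GRing.add0r.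
by apply => //; lia.
Qed.

End Space.

(** * Logspace-uniform circuits for selections of input bits *)

Lemma expn2_size_bits k : 0 < k -> 2 ^ size (bits k) <= 2 * k.
Proof.
have [n] := ubnP k; elim: n k => // n IH k lt_kn k_gt0.
have E := odd_double_half k; rewrite addnC in E.
have [h0|h_gt0] := posnP k./2.
  by rewrite h0 add0n in E; rewrite -E; case: (odd k) E k_gt0 => // <-.
rewrite -{1}E; apply: (@leq_trans (2 ^ (size (bits k./2)).+1)).
  by rewrite leq_exp2l // size_bits_double.
by rewrite expnS -mul2n in E *; have := IH k./2 ltac:(lia) h_gt0; lia.
Qed.

Lemma size_bits_log k n : k <= n -> size (bits k) <= trunc_log 2 n + 1.
Proof.
case: k => // k le_k; have := expn2_size_bits (isT : 0 < k.+1).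
case E: (size _) => [|s] //; rewrite expnS leq_mul2l /= => le_s.
by rewrite addn1 ltnS; apply: trunc_log_max => //; apply: leq_trans le_s le_k.
Qed.

(* Gate [0] is the constant 1 and gate [i.+1] is input [i]. *)
Definition selection (n : nat) (os : seq nat) : circuit :=
  Circuit (GConst true :: [seq GInput i | i <- iota 0 n]) os.

Lemma selection_eval (w : word) os :
  circuit_eval (selection (size w) os) w = [seq nth false (true :: w) j | j <- os].
Proof.
rewrite /circuit_eval; congr map; rewrite /selection /=.
suff E s v : foldl (fun v g => rcons v (gate_value w v g)) v [seq GInput i | i <- s] =
    v ++ [seq nth false w i | i <- s].
  by rewrite E /= -[in RHS](mkseq_nth false w).
by elim: s v => [|i s IH] v /=; rewrite ?cats0 // IH cat_rcons.
Qed.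

Lemma selection_depth n os : circuit_depth (selection n os) = 0.
Proof.
rewrite /circuit_depth /=.
have E s d : foldl (fun d g => rcons d (gate_depth d g)) d [seq GInput i | i <- s] =
    d ++ [seq 0 | _ <- s].
  by elim: s d => [|i s IH] d /=; rewrite ?cats0 // IH cat_rcons.
rewrite E big_cons max0n.
by elim: (iota _ _) => [|i s IH] /=; rewrite ?big_nil // big_cons IH.
Qed.

Definition outs (w : word) : cmd := foldr (fun a => Seq (Out a)) Skip w.

Definition print_code : cmd := Seq print_pos (Out false).

Definition print_gates (c : cmd) : cmd :=
  Seq (outs [:: false; false; true; true])
  (Seq (WhileIn (Seq (outs [:: false; false; false])
     (Seq print_code (Mv MoveR))))
  (Seq (Mv MoveL) (Seq (WhileIn (Mv MoveL)) (Seq (Mv MoveR)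
  (Seq (outs [:: true; true; true]) c))))).

Local Notation S p o := (Store p o [::] [::] [::] [::]).

Section Printing.
Variable n : nat.
Local Notation x := (nseq n true).
Local Notation b := (trunc_log 2 n + 1).
Local Notation leads := (leads x b).

Lemma fits_empty p o : (-1 <= p <= n%:Z)%R -> fits x b (S p o).
Proof. by rewrite /fits size_nseq /= => ->. Qed.

Lemma leads_outs w p o : (-1 <= p <= n%:Z)%R -> leads (outs w) (S p o) (S p (o ++ w)).
Proof.
move=> Hp; elim: w o => [|a w IH] o /=; first by rewrite cats0; apply: leads_skip.
apply: leads_seq; first by apply: leads_out; apply: fits_empty.
by rewrite -cat_rcons; apply: IH.
Qed.

Lemma leads_right (p : nat) o : p < n -> leads (Mv MoveR) (S p o) (S p.+1 o).
Proof.
move=> lt_p; have -> : S p.+1 o = advance MoveR (S p o) by congr Store; rewrite /=; lia.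
by apply: leads_mv; apply: fits_empty; rewrite /=; lia.
Qed.

Lemma leads_left (p : nat) o : p <= n -> leads (Mv MoveL) (S p o) (S (p%:Z - 1)%R o).
Proof.
move=> lt_p; apply: (@leads_mv _ _ MoveL (S p o)); apply: fits_empty; rewrite /=; lia.
Qed.

Lemma leads_print (p : nat) o : p <= n ->
  leads print_code (S p o) (S p (o ++ nat_code p)).
Proof.
move=> le_p; apply: leads_seq.
  apply: leads_print_pos; rewrite ?size_nseq ?addn1 //.
  by move=> k /size_bits_log; rewrite addn1.
have -> : S p (o ++ nat_code p) = emit false (S p (o ++ nseq p true)).
  by rewrite /emit -cats1 -catA.
by apply: leads_out; apply: fits_empty; lia.
Qed.

Lemma cell_in (p : nat) : p < n -> input_cell x p <> None.
Proof. by move=> lt_p; apply: input_cell_lt; rewrite size_nseq. Qed.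

Lemma cell_end : input_cell x n = None.
Proof. by have := input_cell_end x; rewrite size_nseq. Qed.

Lemma leads_print_gates c p os :
  (forall o, leads c (S 0%N o) (S p (o ++ flatten [seq nat_code j | j <- os]))) ->
  leads (print_gates c) empty_store (S p (circuit_code (selection n os))).
Proof.
move=> lc; rewrite /print_gates.
apply: leads_seq; first by apply: (@leads_outs _ 0%R [::]); lia.
have loop j k o : j + k = n -> leads (WhileIn (Seq (outs [:: false; false; false])
     (Seq print_code (Mv MoveR)))) (S j o)
   (S n (o ++ flatten [seq gate_code g | g <- [seq GInput i | i <- iota j k]])).
  elim: k j o => [|k IH] j o E.
    by rewrite addn0 in E; rewrite E cats0; apply: leads_whilein_end; apply: cell_end.
  have r := IH j.+1 ((o ++ [:: false; false; false]) ++ nat_code j) ltac:(lia).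
  have -> : o ++ flatten [seq gate_code g | g <- [seq GInput i | i <- iota j k.+1]] =
    ((o ++ [:: false; false; false]) ++ nat_code j) ++
      flatten [seq gate_code g | g <- [seq GInput i | i <- iota j.+1 k]].
    by rewrite -[RHS]catA -[RHS]catA.
  apply: leads_whilein r; first by apply: cell_in; lia.
  apply: leads_seq; first by apply: leads_outs; lia.
  apply: leads_seq; first by apply: leads_print; lia.
  by apply: leads_right; lia.
have back j o : j <= n -> leads (WhileIn (Mv MoveL)) (S (j%:Z - 1)%R o) (S (-1)%R o).
  elim: j => [|j IH] le_j; first exact: leads_whilein_end.
  have r := IH (ltnW le_j).
  have -> : (j.+1%:Z - 1)%R = Posz j by lia.
  by apply: leads_whilein r; [apply: cell_in | apply: leads_left; lia].
apply: leads_seq; first exact: (loop 0 n _ erefl).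
apply: leads_seq; first exact: leads_left.
apply: leads_seq; first exact: back.
apply: leads_seq.
  by apply: (@leads_mv _ _ MoveR (S (-1)%R _)); apply: fits_empty; rewrite /=; lia.
apply: leads_seq; first by apply: (@leads_outs _ 0%R); lia.
set o := (_ ++ [:: true; true; true]).
have -> : circuit_code (selection n os) = o ++ flatten [seq nat_code j | j <- os].
  by rewrite /o -!catA.
exact: lc.
Qed.

End Printing.

Lemma selection_uniform c (os : nat -> seq nat) :
  (forall n, exists2 p : int, (-1 <= p <= n%:Z)%R &
    forall o, leads (nseq n true) (trunc_log 2 n + 1) c (S 0%R o)
      (S p (o ++ flatten [seq nat_code j | j <- os n]))) ->
  logspace_uniform (fun n => selection n (os n)).
Proof.
(* The factor 1 is enough: the space [trunc_log 2 n + 1] is the bound on the length of a numeral up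
   to [n]. *)
move=> H; exists (machine_of (print_gates c)), 1; split; first exact: machine_one_way.
move=> n; set x := nseq n true; set b := trunc_log 2 n + 1.
have f0 : fits x b empty_store by apply: fits_empty.
have [p Hp lc] := H n; have [m e] := leads_print_gates lc.
have f1 : fits x b (S p (circuit_code (selection n (os n)))) by apply: fits_empty.
have [_ tr] := machine_of_runs e f0 f1.
have vd := machine_of_verdict e f0 f1; have out := machine_of_output e f0 f1.
split=> [t i q|]; last by exists m.+1; rewrite /halted vd.
rewrite mul1n /q; have [s [/and5P[Hi fV fW fX fK] Ei Ek]] := tr t.
split=> [->|lt_i]; first by rewrite Ei.
case: (tapeP i) lt_i => [->|->|[k ->]] // _.
by apply: Order.POrderTheory.le_trans (Ek k) _; case: k {Ek} => /=; lia.
Qed.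

Lemma selection_nc (os : nat -> seq nat) (f : word -> word) :
  logspace_uniform (fun n => selection n (os n)) ->
  (forall x : word, exists j, [seq nth false (true :: x) i | i <- os (size x)] =
     f x ++ true :: nseq j false) -> nc_fun f.
Proof.
move=> lu H; exists (fun n => selection n (os n)), 1; split=> // [n|n|x].
- by rewrite /= size_map size_iota /poly expn1 addn1.
- by rewrite selection_depth.
- by have [j E] := H x; exists j; rewrite selection_eval.
Qed.

Lemma nil_nc : nc_fun (fun _ => [::]).
Proof.
apply: (@selection_nc (fun _ => [:: 0])); last by move=> x; exists 0.
apply: (@selection_uniform (Out false)) => n; exists 0%R => // o.
have -> : S 0%R (o ++ flatten [seq nat_code j | j <- [:: 0]]) = emit false (S 0%R o).
  by rewrite /= -cats1.
by apply: leads_out; apply: fits_empty.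
Qed.

Lemma cons2_nc : nc_fun (fun x => true :: true :: x).
Proof.
(* The constant gate 0 provides the two letters of the prefix and, at the end, the end mark. *)
apply: (@selection_nc (fun n => 0 :: 0 :: [seq i.+1 | i <- iota 0 n] ++ [:: 0])); last first.
  move=> x; exists 0; rewrite /= map_cat -map_comp /=; congr (_ :: _ :: _ ++ _).
  by rewrite -[RHS](mkseq_nth false).
apply: (@selection_uniform (Seq (outs [:: false; false])
  (Seq (WhileIn (Seq (Mv MoveR) print_code)) (Out false)))) => n.
exists n%:Z%R; first by lia.
move=> o; apply: leads_seq; first exact: leads_outs.
have loop j k u : j + k = n -> leads (nseq n true) (trunc_log 2 n + 1)
    (WhileIn (Seq (Mv MoveR) print_code)) (S j u)
    (S n (u ++ flatten [seq nat_code i | i <- [seq i.+1 | i <- iota j k]])).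
  elim: k j u => [|k IH] j u E.
    by rewrite addn0 in E; rewrite E cats0; apply: leads_whilein_end; apply: cell_end.
  have r := IH j.+1 (u ++ nat_code j.+1) ltac:(lia).
  have -> : u ++ flatten [seq nat_code i | i <- [seq i.+1 | i <- iota j k.+1]] =
    (u ++ nat_code j.+1) ++ flatten [seq nat_code i | i <- [seq i.+1 | i <- iota j.+1 k]].
    by rewrite -[RHS]catA.
  apply: leads_whilein r; first by apply: cell_in; lia.
  by apply: leads_seq; [apply: leads_right; lia | apply: leads_print; lia].
apply: leads_seq; first exact: (loop 0 n).
set fl := flatten (map nat_code (map _ _)).
have -> : S n (o ++ flatten [seq nat_code j | j <- 0 :: 0 :: [seq i.+1 | i <- iota 0 n] ++ [:: 0]]) =
    emit false (S n ((o ++ [:: false; false]) ++ fl)).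
  by rewrite /emit -cats1 -!catA /= map_cat flatten_cat.
by apply: leads_out; apply: fits_empty; lia.
Qed.

(* On <11x, []> this reads off x. *)
Definition odd_bits (w : word) : word :=
  [seq nth false w (5 + i.*2) | i <- iota 0 (size w - 5)./2].

(** A circuit has to be printed for lengths below 5 as well, and then the head must not run past the
    blank next to the input. *)
Definition skip_right : cmd := In Skip (Mv MoveR) (Mv MoveR).

Lemma odd_bits_nc : nc_fun odd_bits.
Proof.
(* Gate [6 + i.*2] is input bit [5 + i.*2]: the doubled prefix fills positions 0 to 3, and the
   second copy of each bit of [x] is selected. Gate 0 is the end mark. *)
apply: (@selection_nc (fun n => [seq 6 + i.*2 | i <- iota 0 (n - 5)./2] ++ [:: 0])); last first.
  by move=> x; exists 0; rewrite map_cat -map_comp.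
pose body := Seq print_code (Mv MoveR).
apply: (@selection_uniform (Seq skip_right (Seq skip_right (Seq skip_right (Seq skip_right
  (Seq skip_right (Seq (WhileIn (Seq (Mv MoveR) (In Skip body body))) (Out false)))))))) => n.
exists n%:Z%R; first by lia.
move=> o.
have cellE (p : nat) : p < n -> input_cell (nseq n true) p = Some true.
  by move=> lt_p; rewrite input_cellE ?size_nseq // nth_nseq lt_p.
have skip j : leads (nseq n true) (trunc_log 2 n + 1) skip_right
    (S (minn j n) o) (S (minn j.+1 n) o).
  have [le_n|lt_n] := leqP n j.
    rewrite (minn_idPr (leqW le_n)).
    by apply: leads_in; rewrite [ipos _]/= cell_end; apply: leads_skip.
  rewrite (minn_idPl lt_n).
  by apply: leads_in; rewrite [ipos _]/= cellE //; apply: leads_right.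
(* A full round consumes two cells; if only one is left, the inner test suppresses the output, which
   accounts for the rounding in [(n - j)./2]. *)
have loop k j u : j <= n -> (n - j)./2 = k -> leads (nseq n true) (trunc_log 2 n + 1)
    (WhileIn (Seq (Mv MoveR) (In Skip body body))) (S j u)
    (S n (u ++ flatten [seq nat_code i | i <- [seq j.+1 + i.*2 | i <- iota 0 k]])).
  elim: k j u => [|k IH] j u le_j E.
    rewrite cats0; have [lt_j|ge_j] := ltnP j n; last first.
      have -> : j = n by lia.
      by apply: leads_whilein_end; apply: cell_end.
    have Ej : j.+1 = n by lia.
    apply: (@leads_whilein _ _ _ _ (S n u)); first exact: cell_in.
      apply: leads_seq; first by apply: leads_right.
      by apply: leads_in; rewrite [ipos _]/= Ej cell_end; apply: leads_skip.
    by apply: leads_whilein_end; apply: cell_end.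
  have lt_j : j.+1 < n by lia.
  have r := IH j.+2 (u ++ nat_code j.+1) ltac:(lia) ltac:(lia).
  have -> : [seq j.+1 + i.*2 | i <- iota 0 k.+1] = j.+1 :: [seq j.+3 + i.*2 | i <- iota 0 k].
    rewrite /= addn0; congr (_ :: _).
    by rewrite -[1]addn0 iotaDl -map_comp; apply: eq_map => i /=; lia.
  have -> : u ++ flatten [seq nat_code i | i <- j.+1 :: [seq j.+3 + i.*2 | i <- iota 0 k]] =
    (u ++ nat_code j.+1) ++ flatten [seq nat_code i | i <- [seq j.+3 + i.*2 | i <- iota 0 k]].
    by rewrite -[RHS]catA.
  apply: leads_whilein r; first by apply: cell_in; lia.
  apply: leads_seq; first by apply: leads_right; lia.
  apply: leads_in; rewrite [ipos _]/= cellE //.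
  by apply: leads_seq; [apply: leads_print; lia | apply: leads_right].
have -> : S 0%R o = S (minn 0 n) o by rewrite min0n.
do 5![apply: leads_seq; first exact: skip].
have Eh : (n - minn 5 n)./2 = (n - 5)./2 by have [le|lt] := leqP n 5; lia.
apply: leads_seq; first by apply: (loop (n - 5)./2) Eh; lia.
have Em : [seq (minn 5 n).+1 + i.*2 | i <- iota 0 (n - 5)./2] =
    [seq 6 + i.*2 | i <- iota 0 (n - 5)./2].
  have [le|lt] := leqP n 5; last by [].
  by have -> : n - 5 = 0 by lia.
rewrite Em map_cat flatten_cat catA.
have -> p u : S p (u ++ flatten [seq nat_code j | j <- [:: 0]]) = emit false (S p u).
  by rewrite /= -cats1.
by apply: leads_out; apply: fits_empty; lia.
Qed.

(** * Problems in P can be made pseudo-tractable *)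

(* A halting access state makes a random-access machine an ordinary one. *)
Definition plain_ratm (c : cmd) : ratm :=
  @RATM (machine_of c) ord_max (fun _ _ => [ffun => (None, MoveS)]).

Lemma plain_ratm_state c y t :
  (rrun (plain_ratm c) y t).1.1 = (run (machine_of c) y t).1.
Proof.
(* The access state is the rejecting one. The jump upon entering it can make the head positions
   differ, but then the run is over; hence the disjunction. *)
suff [] : (rrun (plain_ratm c) y t).1.1 = (run (machine_of c) y t).1 /\
  (halted (run (machine_of c) y t) \/ (rrun (plain_ratm c) y t).1 = run (machine_of c) y t) by [].
elim: t => [|t [Eq IH]]; first by split; [|right].
rewrite /rrun /run !iterS -/(rrun _ y t) -/(run _ y t) /rstep /step.
have Eh : halted (rrun (plain_ratm c) y t).1 = halted (run (machine_of c) y t).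
  by rewrite /halted Eq.
rewrite Eh; case: ifP => [h|nh]; first by split; [|left].
case: IH => [|E]; first by rewrite nh.
rewrite /rnext E; case: (next _) => q ts /=; split=> //.
case: eqP => [->|_]; [left | by right].
by rewrite /halted /= eqxx; case: ifP.
Qed.

Fixpoint check (w : word) : cmd :=
  match w with
  | [::] => In (Push kV true) Skip Skip
  | a :: w' => let c := Seq (Mv MoveR) (check w') in
      if a then In Skip Skip c else In Skip c Skip
  end.

Lemma reach_check y w p : p <= size y -> exists q v,
  reach y (check w) (Store p [::] [::] [::] [::] [::]) (10 * size w + 10)
    (Store q [::] v [::] [::] [::]) /\ (ohead v == Some true) = (drop p y == w).
Proof.
elim: w p => [|a w IH] p le_p.
  have [lt_p|ge_p] := ltnP p (size y).
    exists p%:Z%R, [::]; rewrite /= (drop_nth false lt_p); split=> //.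
    apply: (@reach_leq _ _ _ (0 + 2)) => //; apply: reach_in.
    by rewrite input_cellE //; case: (nth _ _ _); apply: reach_skip.
  exists p%:Z%R, [:: true]; rewrite drop_oversize //; split=> //.
  apply: (@reach_leq _ _ _ (2 + 2)) => //; apply: reach_in.
  by rewrite /= nth_default ?size_map //; apply: reach_push.
have [lt_p|ge_p] := ltnP p (size y); last first.
  exists p%:Z%R, [::]; rewrite drop_oversize //; split=> //.
  apply: (@reach_leq _ _ _ (0 + 2)); last by lia.
  by case: a; apply: reach_in; rewrite /= nth_default ?size_map //; apply: reach_skip.
rewrite (drop_nth false lt_p) eqseq_cons.
have [E|ne] := eqVneq (nth false y p) a; last first.
  exists p%:Z%R, [::]; split=> //; apply: (@reach_leq _ _ _ (0 + 2)); last by lia.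
  by case: a ne; case E: (nth _ _ _) => // _; apply: reach_in;
    rewrite input_cellE // E; apply: reach_skip.
have [q [v [r Ev]]] := IH p.+1 lt_p; exists q, v; split=> //.
have Ep : Store p.+1 [::] [::] [::] [::] [::] = advance MoveR (Store p [::] [::] [::] [::] [::]).
  by congr Store; rewrite /=; lia.
rewrite Ep in r.
apply: (@reach_leq _ _ _ (1 + (10 * size w + 10) + 2)); last by rewrite /=; lia.
by case: a E => E; apply: reach_in; rewrite input_cellE // E; apply: reach_seq (reach_mv _ _ _) r.
Qed.

(** The time depends on [w] alone, because the comparison ends at the first mismatch or at the cell
    just after [w]. *)
Lemma check_decides w : exists T, forall y,
  verdict (rrun (plain_ratm (check w)) y T).1.1 = Some (y == w).
Proof.
exists (10 * size w + 11) => y.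
have [q [v [[n le_n e] Ev]]] := @reach_check y w 0 (leq0n _); rewrite drop0 in Ev.
have vd := machine_of_verdict e I I; rewrite /= Ev in vd.
rewrite plain_ratm_state (@run_halted _ _ n.+1) ?[X in X = _]vd //; last by lia.
by rewrite /halted /= vd.
Qed.

Lemma size_double w : size (double w) = (size w).*2.
Proof. by elim: w => //= b w ->. Qed.

Lemma nth_double w i : nth false (double w) i.*2.+1 = nth false w i.
Proof. by elim: w i => [|b w IH] [|i] //=; rewrite ?nth_nil // IH. Qed.

Lemma odd_bits_pair_code x : odd_bits (pair_code (true :: true :: x) [::]) = x.
Proof.
have Es : size (pair_code (true :: true :: x) [::]) = (size x + 3).*2.
  by rewrite /pair_code !size_cat !size_double /=; lia.
(* The size minus 5 is odd, namely [(size x).*2 + 1]; halving discards the remainder, which comes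
   from the separator. *)
rewrite /odd_bits Es (_ : (_ - 5)./2 = size x); last by lia.
rewrite -[RHS](mkseq_nth false); apply/eq_in_map => i; rewrite mem_iota add0n => lt_i.
have -> : 5 + i.*2 = i.+2.*2.+1 by lia.
by rewrite /pair_code nth_cat size_double ifT ?nth_double //=; lia.
Qed.

Lemma pair_code_true D Q : D = [::] \/ D = [:: true] ->
  (pair_code D Q == [:: true; true; false; true]) = (D == [:: true]) && (Q == [::]).
Proof. by case=> ->; case: Q. Qed.

Lemma PTIME_PTP L : PTIME L -> PTP L.
Proof.
move=> /PTIME_FP[f Pf Ef].
have rho_nc : nc_fun2 (fun D Q => odd_bits (pair_code D Q)).
  by exists odd_bits => //; exact: odd_bits_nc.
have K x : L x -> odd_bits (pair_code (true :: true :: x) [::]) = x.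
  by move=> _; apply: odd_bits_pair_code.
exists (Factorization cons2_nc nil_nc rho_nc K); left.
pose yes (D : word) :=
  [&& seq.head false D, seq.head false (behead D) & f (behead (behead D))].
pose Pi (D : word) : word := if yes D then [:: true] else [::].
have yesP D : yes D <-> exists2 x, L x & D = true :: true :: x.
  rewrite /yes; split=> [|[x /Ef fx ->]] //.
  by case: D => [|[] [|[] x]] //= /Ef Lx; exists x.
(* This word is [pair_code [:: true] [::]]. *)
have [T HT] := check_decides [:: true; true; false; true].
exists Pi, (fun p => p = ([:: true], [::])); split.
- apply: FP_polytime_fun; rewrite /Pi; apply: FP_if; [|by fp|by fp].
  have Pb : FP (fun D : seq bool => seq.head false D) by fp.
  have Pb2 : FP (fun D : seq bool => seq.head false (behead D)) by fp.
  have Pb3 : FP (fun D : seq bool => behead (behead D)) by fp.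
  by apply: FP_andb => //; apply: FP_andb => //; apply: FP_comp Pf Pb3.
- move=> D Q; rewrite /Pi; split=> [[x Lx [<- <-]]|].
    by rewrite (_ : yes _) //; apply/yesP; exists x.
  by case: ifP => // /yesP[x Lx ->] [->]; exists x.
(* A dataset mapped to the one-letter word has at least the two letters of the prefix, and any other
   nonempty dataset is longer than its image, the empty word. *)
- move=> D ne_D; rewrite /Pi; case: ifP => [/yesP[x _ ->] //|_].
  by case: (D) ne_D.
exists (plain_ratm (check [:: true; true; false; true])), (fun _ => T); split.
  by move=> c; exists (c * T).
move=> D Q; eexists; first exact: HT.
rewrite pair_code_true; last by rewrite /Pi; case: ifP; [right | left].
by split=> [/andP[/eqP-> /eqP->] // | [-> ->]].
Qed.

Theorem theorem10 : PTP = PTIME.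
Proof.
apply/funext => L; apply/propext; split; [exact: PTP_PTIME | exact: PTIME_PTP].
Qed.
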